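(* Let $\pi=\{\pi^r, r\in\mathbb{N}_+\}$ be an arbitrary sequence of admissible policies ($\pi^r$ admissible in the $r$th system for every $r$). Then $$\liminf_{r\rightarrow\infty} \sum_{j\in\mathcal{J}} h_j\, \mathbf{E}\left[ \int_0^\infty e^{-\delta t}\, \hat{Q}_j^{\pi,r}(t)\, dt\right] \;\geq\; \mathbf{E}\left[ \int_0^\infty e^{-\delta t}\, z\big(\tilde{W}^*(t)\big)\, dt\right],$$ where $\tilde W^*=(\tilde W^*_i,i\in\mathcal I^H)$ is the semimartingale reflected Brownian motion, and $z$ the linear-program value function, defined in the context.
   Context: **Network.** There are $J\in\mathbb N_+$ job types $\mathcal J=\{1,\dots,J\}$ and $I\in\mathbb N_+$ resources $\mathcal I=\{1,\dots,I\}$. $\mathcal I_j\subseteq\mathcal I$ is the set of resources simultaneously required to process a type $j$ job and $\mathcal J_i=\{j\in\mathcal J: i\in\mathcal I_j\}$; all $\mathcal I_j,\mathcal J_i$ are nonempty. For $i\neq k$, $\mathcal J_i\not\subset\mathcal J_k$ and $\mathcal J_k\not\subset\mathcal J_i$ (here $\subset$ allows equality). Each type has its own buffer and each job is processed once. *Hierarchical collaboration architecture* is assumed: if $\mathcal I_j\cap\mathcal I_l\neq\emptyset$ then $\mathcal I_j\subset\mathcal I_l$ or $\mathcal I_l\subset\mathcal I_j$. The graph associated with the architecture (job types as nodes, an edge between types sharing a resource) is connected. **Stochastic primitives.** All random objects live on a complete probability space $(\Omega,\mathcal F,\mathbf P)$. For each $j$, service times $\{v_{jn}\}_{n\ge1}$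 are strictly positive i.i.d. with mean $1/\mu_j$ and coefficient of variation $\sigma_j$; $\{\bar u_{jn}\}_{n\ge1}$ are strictly positive i.i.d. with mean $1$ and variance $\beta_j^2$. In the $r$th system ($r\in\mathbb N_+$) interarrival times are $u^r_{jn}=\bar u_{jn}/\lambda_j^r$ with $\lambda^r_j>0$. All these sequences are mutually independent. $V_j(n)=\sum_{k=1}^n v_{jk}$, $S_j(t)=\sup\{n\in\mathbb N:V_j(n)\le t\}$, $U_j^r(n)=\sum_{k=1}^n u_{jk}^r$, $E_j^r(t)=\sup\{n\in\mathbb N:U_j^r(n)\le t\}$. Moment assumption: there is $\bar\alpha>0$ with $\mathbf E[e^{\alpha\bar u_{j1}}]<\infty$ and $\mathbf E[e^{\alpha v_{j1}}]<\infty$ for all $\alpha\in(-\bar\alpha,\bar\alpha)$, $j\in\mathcal J$. **Asymptotic regime.** $\lambda_j^r\to\lambda_j>0$ for all $j$; with $\rho_i^r=\sum_{j\in\mathcal J_i}\lambda_j^r/\mu_j$, $r(\rho_i^r-1)\to\theta_i\in\mathbb R\cup\{-\infty\}$ for all $i$. $\mathcal I^H=\{i:\theta_i\in\mathbb R\}$ (heavy traffic, assumed nonempty), $\mathcal I^L=\{i:\theta_i=-\infty\}$ (light traffic), $a_1=|\mathcal I^H|$. $\mathcal J^H=\{j:\mathcal I_j\cap\mathcal I^H\ne\emptyset\}$, $\mathcal J^L=\mathcal J\setminus\mathcal J^H$, $\mathcal J^{HL}=\{j:\mathcal I_j\cap\mathcal I^H\neq\emptyset\text{ and }\mathcal I_j\cap\mathcal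 I^L\neq\emptyset\}$. **Dynamics and admissible policies.** $T_j^r(t)$ is the cumulative time type $j$ jobs are processed in $[0,t]$; $I_i^r(t)=t-\sum_{j\in\mathcal J_i}T_j^r(t)$ is the cumulative idle time of resource $i$; $Q_j^r(t)=Q_j^r(0)+E_j^r(t)-S_j(T_j^r(t))\ge0$ is the number of type $j$ jobs in the system; $V_j(S_j(T_j^r(t)))\le T_j^r(t)<V_j(S_j(T_j^r(t))+1)$ (head-of-the-line). $(Q_j^r(0))_j$ is an $\mathbb N^J$-valued random vector independent of all primitives. A policy $\pi^r=(T_j^r,j\in\mathcal J)$ is *admissible* in the $r$th system if these relations hold and for all $i,j,t$: (a) $T_j^r(t)$ is $\mathcal F$-measurable; (b) $T_j^r$ and $I_i^r$ are continuous, nondecreasing and start from $0$; (c) if $i\in\mathcal I^H$, $I_i^r(t)$ increases if and only if $\sum_{j\in\mathcal J_i}Q_j^r(t)=0$. A superscript $\pi$ denotes processes under policy $\pi^r$. **Scaling and initial state.** $\hat Q_j^r(t)=r^{-1}Q_j^r(r^2t)$, $\bar Q_j^r(t)=r^{-2}Q_j^r(r^2t)$. It is assumed that $\bar Q_j^r(0)\to0$ a.s. for all $j$ and $(\hat Q_j^r(0))_{j}\Rightarrow(\tilde Q_j(0))_{j}$, a random vector in $\mathbb R_+^J$ with $\tilde Q_j(0)=0$ for $j\in\mathcal J^L\cup\mathcal J^{HL}$. $\tilde W_i(0)=\sum_{j\in\mathcal J_i}\tilde Q_j(0)/\mu_j$. **Limit process.** $\tilde W^*=(\tilde W_i^*,i\in\mathcal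 I^H)$ is the semimartingale reflected Brownian motion with state space $\mathbb R_+^{a_1}$, drift $\Theta=(\theta_i,i\in\mathcal I^H)$, covariance matrix $\Sigma_{ik}=\sum_{j\in\mathcal J_i\cap\mathcal J_k}\lambda_j(\beta_j^2+\sigma_j^2)\mu_j^{-2}$ ($i,k\in\mathcal I^H$), identity reflection matrix, started at $(\tilde W_i(0),i\in\mathcal I^H)$. That is, $\tilde W_i^*(t)=X_i(t)+\sup_{0\le s\le t}(-X_i(s))^+$ where $X$ is a Brownian motion with drift $\Theta$ and covariance $\Sigma$ started at that initial vector. **Cost and LP.** $h_j>0$ are holding cost rates and $\delta>0$ is the discount rate. For $w=(w_i,i\in\mathcal I^H)\in\mathbb R_+^{a_1}$, $z(w)$ is the optimal value of the linear program: minimize $\sum_{j\in\mathcal J^H}h_jq_j$ subject to $\sum_{j\in\mathcal J_i}q_j/\mu_j=w_i$ for all $i\in\mathcal I^H$, and $q_j\ge0$ for all $j\in\mathcal J^H$. *)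

(* Defs.v *)
From HB Require Import structures.
From mathcomp Require Import all_boot all_order all_algebra.
From mathcomp Require Import all_classical all_reals all_analysis.

Set Implicit Arguments.
Unset Strict Implicit.
Unset Printing Implicit Defensive.

Import Order.TTheory GRing.Theory Num.Theory.
Import numFieldNormedType.Exports.

Local Open Scope classical_set_scope.
Local Open Scope ring_scope.

Section Network.
Variables (nI nJ : nat) (res : 'I_nJ -> {set 'I_nI}).

Definition jobs_of (i : 'I_nI) : {set 'I_nJ} := [set j | i \in res j]%SET.

Definition network : Prop :=
  [/\ forall j, res j != finset.set0,
      forall i, jobs_of i != finset.set0
    & forall i k, i != k -> ~~ (jobs_of i \subset jobs_of k)].

Definition hierarchical : Prop :=
  forall j l, (res j :&: res l)%SET != finset.set0 ->
    (res j \subset res l) || (res l \subset res j).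

Definition share_resource : rel 'I_nJ :=
  fun j l => (j != l) && ((res j :&: res l)%SET != finset.set0).

Definition connected_architecture : Prop :=
  forall j l, connect share_resource j l.

End Network.

Section Traffic.
Variables (R : realType) (nI nJ : nat) (res : 'I_nJ -> {set 'I_nI}).
Variable theta : 'I_nI -> \bar R.

Definition heavy_set : {set 'I_nI} := [set i | theta i \is a fin_num]%SET.
Definition light_set : {set 'I_nI} := [set i | theta i == -oo%E]%SET.

Definition heavy : finType := {i : 'I_nI | i \in heavy_set}.

Definition heavy_jobs : {set 'I_nJ} :=
  [set j | (res j :&: heavy_set)%SET != finset.set0]%SET.
Definition light_jobs : {set 'I_nJ} := (~: heavy_jobs)%SET.
Definition mixed_jobs : {set 'I_nJ} :=
  [set j | ((res j :&: heavy_set)%SET != finset.set0)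
        && ((res j :&: light_set)%SET != finset.set0)]%SET.

Definition load (mu lam : 'I_nJ -> R) (i : 'I_nI) : R :=
  \sum_(j in jobs_of res i) lam j / mu j.

(* The infimum is taken in \bar R, so an infeasible program has value +oo. *)
Definition lp_value (h mu : 'I_nJ -> R) (w : heavy -> R) : \bar R :=
  ereal_inf [set (\sum_(j in heavy_jobs) h j * q j)%:E | q in
    [set q : 'I_nJ -> R |
      (forall i : heavy, \sum_(j in jobs_of res (val i)) q j / mu j = w i) /\
      (forall j, j \in heavy_jobs -> 0 <= q j)]].

End Traffic.

Section Paths.
Variable R : realType.

Definition partial_sum (x : nat -> R) (n : nat) : R := \sum_(k < n) x k.

(* Whenever x is positive with divergent partial sums (almost surely the case
   for i.i.d. sequences), the set is nonempty and bounded for t >= 0, and this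
   is its maximum; outside that case [supremum] returns 0. *)
Definition renewal_count (x : nat -> R) (t : R) : nat :=
  supremum 0%N [set n : nat | partial_sum x n <= t].

Definition queue (q0 : nat) (u v : nat -> R) (T : R -> R) (t : R) : R :=
  q0%:R + (renewal_count u t)%:R - (renewal_count v (T t))%:R.

Definition cnd0 (f : R -> R) : Prop :=
  [/\ {within `[0, +oo[, continuous f},
      {in `[0, +oo[ &, {homo f : s t / s <= t}} & f 0 = 0].

Variables (nI nJ : nat) (res : 'I_nJ -> {set 'I_nI}).

Definition idle (T : 'I_nJ -> R -> R) (i : 'I_nI) (t : R) : R :=
  t - \sum_(j in jobs_of res i) T j t.

Variable IH : {set 'I_nI}.

(* In [adm_work], "idleness increases at t" means that t is a point of right
   increase; queue lengths are right-continuous step functions of time, so this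
   is insensitive to what happens just before t. *)
Record admissible_path (q0 : 'I_nJ -> nat) (u v : 'I_nJ -> nat -> R)
    (T : 'I_nJ -> R -> R) : Prop := AdmissiblePath {
  adm_queue : forall j t, 0 <= t -> 0 <= queue (q0 j) (u j) (v j) (T j) t ;
  adm_hol : forall j t, 0 <= t ->
    partial_sum (v j) (renewal_count (v j) (T j t)) <= T j t <
    partial_sum (v j) (renewal_count (v j) (T j t)).+1 ;
  adm_busy : forall j, cnd0 (T j) ;
  adm_idle : forall i, cnd0 (idle T i) ;
  adm_work : forall i t, i \in IH -> 0 <= t ->
    ((forall s, t < s -> idle T i t < idle T i s) <->
     \sum_(j in jobs_of res i) queue (q0 j) (u j) (v j) (T j) t = 0) }.

End Paths.

Section Probability.
Variables (R : realType) (d : measure_display) (Om : measurableType d).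
Variable P : probability Om R.

Definition sigma_of (A : Type) (d' : measure_display) (S : measurableType d')
    (X : A -> Om -> S) (D : set A) : set (set Om) :=
  <<s \bigcup_(a in D) preimage_set_system setT (X a) measurable >>.

Definition independent (F G : set (set Om)) : Prop :=
  forall A B, F A -> G B -> P (A `&` B) = (P A * P B)%E.

Definition mutually_independent (K : eqType) (F : K -> set (set Om)) : Prop :=
  forall (s : seq K) (A : K -> set Om), uniq s ->
    (forall k, k \in s -> F k (A k)) ->
    P (\bigcap_(k in [set` s]) A k) = (\prod_(k <- s) P (A k))%E.

Definition iid (X : nat -> Om -> R) : Prop :=
  mutually_independent (fun n => sigma_of X [set n]) /\
  (forall n B, measurable B -> P (X n @^-1` B) = P (X 0%N @^-1` B)).

Definition cvg_in_law (n : nat) (Y : nat -> Om -> 'rV[R]_n)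
    (Z : Om -> 'rV[R]_n) : Prop :=
  forall f : 'rV[R]_n -> R, continuous f ->
    (exists M, forall x, `|f x| <= M) ->
    ('E_P[f \o Y r] @[r --> \oo] --> 'E_P[f \o Z])%E.

(* [normal_prob m 0] is not a point mass in the library, hence the case
   distinction. *)
Definition has_gaussian_law (Y : Om -> R) (m s2 : R) : Prop :=
  forall B, measurable B ->
    P (Y @^-1` B) = if s2 == 0 then \d_m B else normal_prob m (Num.sqrt s2) B.

(* N(m, C) on R^K: every linear form a has law N(<a, m>, <a, C a>). *)
Definition has_multinormal_law (K : finType) (Y : Om -> K -> R) (m : K -> R)
    (C : K -> K -> R) : Prop :=
  forall a : K -> R,
    has_gaussian_law (fun w => \sum_k a k * Y w k)
      (\sum_k a k * m k) (\sum_k \sum_l a k * a l * C k l).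

(* Brownian motion on [0, +oo[ with arbitrary initial law. *)
Record brownian (K : finType) (drift : K -> R) (cov : K -> K -> R)
    (X : R -> Om -> K -> R) : Prop := Brownian {
  bm_measurable : forall t k, 0 <= t -> measurable_fun setT (fun w => X t w k) ;
  bm_continuous : {ae P, forall w, forall k,
    {within `[0, +oo[, continuous (fun t => X t w k)}} ;
  bm_independent : forall s t, 0 <= s < t ->
    independent
      (sigma_of (fun k w => X t w k - X s w k) setT)
      (sigma_of (fun a w => X a.1 w a.2) [set a | 0 <= a.1 <= s]) ;
  bm_law : forall s t, 0 <= s < t ->
    has_multinormal_law (fun w k => X t w k - X s w k)
      (fun k => drift k * (t - s)) (fun k l => cov k l * (t - s)) }.

Definition reflection (x : R -> R) (t : R) : R :=
  x t + sup [set Num.max (- x s) 0 | s in `[0, t]].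

(* Semimartingale reflected Brownian motion in the nonnegative orthant with
   identity reflection matrix, started at w0. *)
Definition srbm (K : finType) (drift : K -> R) (cov : K -> K -> R)
    (w0 : Om -> K -> R) (W : R -> Om -> K -> R) : Prop :=
  exists X : R -> Om -> K -> R,
    [/\ brownian drift cov X,
        {ae P, forall w, forall k, X 0 w k = w0 w k}
      & {ae P, forall w, forall k t, 0 <= t ->
          W t w k = reflection (fun s => X s w k) t}].

Definition discounted (delta : R) (Y : R -> Om -> \bar R) : \bar R :=
  (\int[P]_w \int[lebesgue_measure]_(t in `[0%R, +oo[)
     ((expR (- delta * t))%:E * Y t w))%E.

Variables (nI nJ : nat) (res : 'I_nJ -> {set 'I_nI}).

(* inl j: service times of type j; inr j: unscaled interarrival times. *)
Definition primitive (v ubar : 'I_nJ -> nat -> Om -> R)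
    (a : 'I_nJ + 'I_nJ) : nat -> Om -> R :=
  match a with inl j => v j | inr j => ubar j end.

Definition interarrival (lam : 'I_nJ -> R) (ubar : 'I_nJ -> nat -> Om -> R)
    (w : Om) (j : 'I_nJ) (n : nat) : R := ubar j n w / lam j.

Definition admissible (IH : {set 'I_nI}) (lam : 'I_nJ -> R)
    (v ubar : 'I_nJ -> nat -> Om -> R) (Q0 : 'I_nJ -> Om -> nat)
    (T : 'I_nJ -> R -> Om -> R) : Prop :=
  (forall j t, 0 <= t -> measurable_fun setT (T j t)) /\
  {ae P, forall w, admissible_path res IH (Q0 ^~ w) (interarrival lam ubar w)
    (fun j n => v j n w) (fun j t => T j t w)}.

Definition scaled_queue (r : nat) (lam : 'I_nJ -> R)
    (v ubar : 'I_nJ -> nat -> Om -> R) (Q0 : 'I_nJ -> Om -> nat)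
    (T : 'I_nJ -> R -> Om -> R) (j : 'I_nJ) (t : R) (w : Om) : R :=
  r%:R^-1 * queue (Q0 j w) (interarrival lam ubar w j) (fun n => v j n w)
              (fun s => T j s w) (r%:R ^+ 2 * t).

End Probability.

(* Main.v *)
(** A heavily loaded resource may idle only when it has no work, so its workload
    is the one-dimensional reflection of a netput process built from the
    primitives alone; no admissible policy can change it.  At each time the
    scaled holding cost is at least the value of the linear program at the
    current heavy workloads, by definition of the program, and that value is a
    Lipschitz function of the workloads because every resource has a job type
    that uses it alone.

    For a fixed time [t], the netput on a finite grid of [0, t] is a sum of
    independent centered random walks observed at deterministic times, up to an
    error controlled by the oscillations of these walks (Doob's inequality with
    fourth moments).  Lindeberg's replacement argument gives the limit of its
    characteristic function, which is that of the Brownian motion on the grid,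
    and Levy's continuity theorem gives the limit of the truncated cost.
    Refining the grid turns the discrete reflection into the reflection of the
    Brownian path.  Fubini's theorem and Fatou's lemma then integrate the bound
    over time. *)
Require Import Defs.
From HB Require Import structures.
From mathcomp Require Import all_boot all_order all_algebra.
From mathcomp Require Import all_classical all_reals all_analysis.
From mathcomp Require Import measurable_realfun.
From mathcomp Require Import ring lra zify.
Import Order.TTheory GRing.Theory Num.Theory.
Import numFieldNormedType.Exports.
Local Open Scope classical_set_scope.
Local Open Scope ring_scope.

Set Implicit Arguments.
Unset Strict Implicit.
Unset Printing Implicit Defensive.

(** * Independence *)

(** No functional limit theorem is used: the bound is needed only at fixed times and only from
    below. The cost may thus be capped at a level [M], which makes the test function bounded and
    Lipschitz; the cap is removed at the end by Fatou's lemma, so no uniform integrability enters.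
    The policy occurs only in a pathwise inequality on a quiet event, where every walk moves by at
    most [eta r] over windows of [kap r^2] steps and random renewal clocks can be exchanged for
    deterministic ones. Fourth moments make the bad event rare: with about [C / kap] windows, second
    moments leave a bound independent of [kap], fourth moments one proportional to [kap]. Hence the
    order of choice: [M], [eta], then [kap] and the initial bound [Mq], then the mesh [m], and [r]
    last. Characteristic functions appear in real form, as expectations of [cos (... + b)] for all
    phases [b], which carry real and imaginary parts alike. The path conditions of [admissible] hold
    almost surely, so versions that vanish off good events replace the processes under Fubini. *)

Section Independence.
Context {R : realType} {d : measure_display} {T : measurableType d}.
Variable P : probability T R.

Definition rv_indep (f g : T -> R) := forall A B, measurable A -> measurable B ->
  (P (f @^-1` A `&` g @^-1` B) = P (f @^-1` A) * P (g @^-1` B))%E.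

Notation integr f := (P.-integrable setT (EFin \o f)).

(** Independence makes the law of the pair the product of the marginal laws, by uniqueness of the
    product measure; Fubini for [(x, y) |-> x y] then factors the integral. *)
Lemma rv_indep_integral (f g : T -> R) : measurable_fun setT f -> measurable_fun setT g ->
  integr f -> integr g -> rv_indep f g ->
  integr (fun w => f w * g w) /\
  \int[P]_w (f w * g w) = (\int[P]_w f w) * (\int[P]_w g w).
Proof.
move=> mf mg If Ig fg.
pose f' : {mfun T >-> R} := HB.pack f (isMeasurableFun.Build _ _ _ _ f mf).
pose g' : {mfun T >-> R} := HB.pack g (isMeasurableFun.Build _ _ _ _ g mg).
have mh : measurable_fun setT (fun w => (f w, g w)) by exact: measurable_fun_pair.
pose h' : {mfun T >-> (R * R)%type} := HB.pack (fun w => (f w, g w)) (isMeasurableFun.Build _ _ _ _ _ mh).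
have E X : measurable X -> (distribution P f' \x distribution P g')%E X = distribution P h' X.
  by apply: product_measure_unique => A B mA mB; rewrite -fg.
pose F : R * R -> \bar R := fun xy => (xy.1 * xy.2)%:E.
have mF : measurable_fun setT F.
  apply/measurable_EFinP; apply: measurable_funM; [exact: measurable_fst|exact: measurable_snd].
have mabs : measurable_fun setT (fun x : R => `|x|%:E).
  exact: measurableT_comp (@EFin_measurable _ _) (@normr_measurable _ _).
have mid : measurable_fun setT (fun x : R => x%:E) by exact: EFin_measurable.
have IF : (distribution P f' \x distribution P g')%E.-integrable setT F.
  apply/integrable12ltyP => //.
  have E1 x : (\int[distribution P g']_y `|F (x, y)| = `|x|%:E * \int[distribution P g']_y `|y|%:E)%E.
    rewrite -ge0_integralZl//; try exact: mabs.
    by apply: eq_integral => y _; rewrite /F /= normrM EFinM.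
  rewrite (eq_integral (fun x : R => `|x|%:E * \int[distribution P g']_y `|y|%:E)%E) => [|x _]; last exact: E1.
  rewrite ge0_integralZr//; try exact: integral_ge0.
  rewrite !ge0_integral_distribution//; try exact: mabs.
  move/integrableP : If => [_ If]; move/integrableP : Ig => [_ Ig].
  by apply: lte_mul_pinfty; rewrite ?ge0_fin_numE ?integral_ge0// => *; rewrite lee_fin.
have EI G : (\int[distribution P h']_x G x = \int[distribution P f' \x distribution P g']_x G x)%E.
  by apply: eq_measure_integral => A mA _; exact/esym/E.
have IF' : (distribution P h').-integrable setT F.
  move/integrableP : IF => [_ IF]; apply/integrableP; split => //.
  by rewrite EI.
have Ifg : integr (fun w => f w * g w).
  move/integrableP : IF' => [_].
  rewrite ge0_integral_distribution//; last exact/measurableT_comp.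
  move=> IF'; apply/integrableP; split => //.
  by apply/measurable_EFinP; exact: measurable_funM.
split=> //.
rewrite /Rintegral.
have -> : (\int[P]_x (f x * g x)%:E = \int[distribution P h']_x F x)%E.
  by rewrite integral_distribution.
rewrite EI -integral12_prod_meas1//.
have Igd : (distribution P g').-integrable setT (fun y : R => y%:E).
  apply/integrableP; split => //.
  rewrite ge0_integral_distribution//; try exact: mabs.
  by move/integrableP : Ig => [].
have Ifd : (distribution P f').-integrable setT (fun y : R => y%:E).
  apply/integrableP; split => //.
  rewrite ge0_integral_distribution//; try exact: mabs.
  by move/integrableP : If => [].
have E2 x : fubini_F (distribution P g') F x = (x%:E * (\int[P]_w g w)%:E)%E.
  rewrite /fubini_F /F; under eq_integral => y _ do rewrite EFinM.
  rewrite integralZl// integral_distribution// fineK//.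
  exact: integrable_fin_num.
rewrite (eq_integral (fun x : R => x%:E * (\int[P]_w g w)%:E)%E) => [|x _]; last exact: E2.
rewrite integralZr//= fineM//; last exact: integrable_fin_num.
by rewrite integral_distribution.
Qed.

(** The pi-lambda argument with [B] fixed: the events that satisfy the product formula with [B] form
    a Dynkin system, and an intersection-closed class generates the same Dynkin system as
    sigma-algebra. *)
Lemma indep_dynkin (G : set_system T) B : setI_closed G -> G `<=` measurable ->
  measurable B -> (forall A, G A -> P (A `&` B) = (P A * P B)%E) ->
  forall A, <<s G >> A -> measurable A /\ P (A `&` B) = (P A * P B)%E.
Proof.
move=> GI Gm mB GB A.
rewrite -(setI_closed_g_dynkin_g_sigma_algebra GI).
suff: <<d G >> `<=` [set A | measurable A /\ P (A `&` B) = (P A * P B)%E] by exact.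
apply: smallest_sub; last by move=> X GX /=; split; [exact: Gm|exact: GB].
split.
- by split => //; rewrite setTI probability_setT mul1e.
- move=> X [mX XB]; split; first exact: measurableC.
  rewrite probability_setC// setIC -setDE.
  have -> : P (B `\` X) = (P B - P (B `&` X))%E.
    by rewrite measureD// (le_lt_trans (probability_le1 P mB))// ltry.
  rewrite setIC XB.
  rewrite -(fineK (fin_num_measure P _ mX)) -(fineK (fin_num_measure P _ mB)).
  by rewrite -!(EFinM,EFinB); congr (_%:E); rewrite mulrBl mul1r.
- move=> F tF FH; split; first by apply: bigcup_measurable => k _; have [] := FH k.
  rewrite setI_bigcupl measure_bigcup//; last 2 first.
  - by move=> k _; apply: measurableI => //; have [] := FH k.
  - exact: trivIset_setIr.
  rewrite measure_bigcup//; last by move=> k _; have [] := FH k.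
  rewrite muleC -(fineK (fin_num_measure P _ mB)) -nneseriesZl//.
  by apply: eq_eseriesr => k _; have [_ e] := FH k; apply: (etrans e); rewrite muleC fineK// fin_num_measure.
Qed.

(** One event is taken for every index at once; subfamilies are reached by choosing [setT], whence
    the hypotheses [F i setT] below. *)
Definition indep_family (K : finType) (F : K -> set_system T) :=
  forall A : K -> set T, (forall i, F i (A i)) ->
  P (\bigcap_i A i) = (\prod_i P (A i))%E.

(** Intersections whose [i0] component is [setT] form a pi-system generating everything outside
    [i0]; [indep_dynkin] extends the product formula from there. *)
Lemma indep_group (K : finType) (F : K -> set_system T) (i0 : K) :
  (forall i, F i `<=` measurable) -> (forall i, F i setT) ->
  (forall i, setI_closed (F i)) -> indep_family F ->
  forall A B, <<s \bigcup_(i in [set i | i != i0]) F i >> A -> F i0 B ->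
    P (A `&` B) = (P A * P B)%E.
Proof.
move=> Fm FT FI iF A B sA FB.
pose G := [set X | exists Y : K -> set T,
  [/\ forall i, F i (Y i), Y i0 = setT & X = \bigcap_i Y i]].
have GI : setI_closed G.
  move=> _ _ [Y [FY Yi ->]] [Z [FZ Zi ->]].
  exists (fun i => Y i `&` Z i); split => //.
  - by move=> i; exact: FI.
  - by rewrite Yi Zi setTI.
  - by rewrite bigcapI.
have Gm : G `<=` measurable.
  move=> _ [Y [FY Yi ->]]; apply: fin_bigcap_measurable; first exact: finite_finset.
  by move=> i _; exact/Fm/FY.
have GB X : G X -> P (X `&` B) = (P X * P B)%E.
  move=> [Y [FY Yi ->]].
  pose Z i := if i == i0 then B else Y i.
  have -> : \bigcap_i Y i `&` B = \bigcap_i Z i.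
    apply/seteqP; split => w /=.
      by move=> [Yw Bw] i _; rewrite /Z; case: ifP => // _; exact: Yw.
    move=> Zw; split; last by have := Zw i0 I; rewrite /Z eqxx.
    move=> i _; have := Zw i I; rewrite /Z; case: ifPn => // /eqP -> _.
    by rewrite Yi.
  rewrite !iF//; last by move=> i; rewrite /Z; case: ifPn => [/eqP ->|].
  rewrite (bigD1 i0)//= [in RHS](bigD1 i0)//= {1}/Z eqxx Yi probability_setT mul1e muleC.
  by congr (_ * _)%E; apply: eq_bigr => i /negbTE; rewrite /Z => ->.
have mB : measurable B by exact: (Fm i0).
have sub : <<s \bigcup_(i in [set i | i != i0]) F i >> `<=` <<s G >>.
  apply: sub_sigma_algebra2 => X [i /= ii0 FX].
  exists (fun k => if k == i then X else setT); split.
  - by move=> k; case: ifPn => // /eqP ->.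
  - by rewrite eq_sym (negbTE ii0).
  - apply/seteqP; split => w /=.
      by move=> Xw k _; case: ifP.
    by move=> /(_ i I); rewrite eqxx.
by have [] := indep_dynkin GI Gm mB GB (sub _ sA).
Qed.

End Independence.

(** * Taylor bounds for sine, cosine and the exponential *)

Section TrigBounds.
Context {R : realType}.
Implicit Types x : R.

Lemma derive_ge0_le0 (f f' : R -> R) : (forall x, is_derive x 1 f (f' x)) ->
  (forall x, 0 <= x -> 0 <= f' x) -> forall x, 0 <= x -> f 0 <= f x.
Proof.
move=> df f'0 x x0.
have [|c /itvP cx E] := MVT_segment x0 (fun y _ => df y).
  apply: continuous_subspaceT => y; apply: differentiable_continuous.
  exact/derivable1_diffP.
by rewrite -subr_ge0 E mulr_ge0 ?subr0// f'0// cx.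
Qed.

Lemma sin_le_id x : 0 <= x -> sin x <= x.
Proof.
move=> x0; rewrite -subr_ge0.
have := @derive_ge0_le0 (fun y => y - sin y) (fun y => 1 - cos y) _ _ x x0.
rewrite sin0 subrr; apply => y; last by rewrite subr_ge0 cos_le1.
Qed.

Lemma abs_sin_le x : `|sin x| <= `|x|.
Proof.
wlog x0 : x / 0 <= x.
  move=> h; have [/h //|/ltW] := leP 0 x.
  by rewrite -oppr_ge0 => /h; rewrite sinN !normrN.
rewrite (ger0_norm x0) ler_norml; apply/andP; split; last exact: sin_le_id.
rewrite -subr_ge0 opprK.
have := @derive_ge0_le0 (fun y => sin y + y) (fun y => cos y + 1) _ _ x x0.
rewrite sin0 addr0; apply => y; have := cos_geN1 y; lra.
Qed.

Lemma cos_lb x : 1 - x ^+ 2 / 2 <= cos x.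
Proof.
have -> : x = (x / 2) *+ 2 by rewrite -mulr_natr divfK.
move: (x / 2) => y; rewrite cos_mulr2n cos2sin2.
have : sin y ^+ 2 <= y ^+ 2.
  by rewrite -[leRHS]real_normK ?num_real// -[leLHS]real_normK ?num_real// lerXn2r ?nnegrE// abs_sin_le.
nra.
Qed.

Lemma sin_lb x : 0 <= x -> x - x ^+ 3 / 6 <= sin x.
Proof.
move=> x0; rewrite -subr_ge0.
have := @derive_ge0_le0 (fun y => sin y - (y - y ^+ 3 / 6)) (fun y => cos y - (1 - y ^+ 2 / 2)) _ _ x x0.
rewrite sin0 expr0n/= mul0r !subr0; apply => y; last first.
  by move=> _; rewrite subr_ge0 cos_lb.
by apply: is_derive_eq; rewrite /GRing.scale/=; lra.
Qed.

(** Half-angle formula [cos (2 y) = 1 - 2 sin^2 y] with the cubic lower bound on the sine; for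
    [|x| > 1] the right side already exceeds 1. *)
Lemma cos_ub x : cos x <= 1 - x ^+ 2 / 2 + `|x| ^+ 3.
Proof.
rewrite -cos_norm -(real_normK (num_real x)); move: (normr_ge0 x).
move: `|x| => {}x x0.
have [x1|x1] := leP x 1; last first.
  apply: le_trans (cos_le1 _) _.
  rewrite -subr_ge0; have -> : 1 - x ^+ 2 / 2 + x ^+ 3 - 1 = x ^+ 2 * (x - 2^-1) by field.
  by rewrite mulr_ge0 ?sqr_ge0//; lra.
have [y xE] : exists y, x = y *+ 2 by exists (x / 2); lra.
rewrite {x}xE cos_mulr2n cos2sin2 in x0 x1 *.
have y0 : 0 <= y by lra.
have y1 : y <= 1 / 2 by lra.
have sy := sin_lb y0.
have y3 : y ^+ 3 <= y.
  by rewrite -[leRHS]mulr1 exprS ler_wpM2l// exprn_ile1//; lra.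
have h : (y - y ^+ 3 / 6) ^+ 2 <= sin y ^+ 2.
  have u0 : 0 <= y - y ^+ 3 / 6 by lra.
  by apply: lerXn2r => //; rewrite ?nnegrE// (le_trans u0).
have y40 : y ^+ 4 <= y ^+ 3.
  by rewrite exprS -[leRHS]mul1r ler_wpM2r ?exprn_ge0//; lra.
have y60 : 0 <= y ^+ 6 by rewrite exprn_ge0.
have y30 : 0 <= y ^+ 3 by rewrite exprn_ge0.
have e : (y - y ^+ 3 / 6) ^+ 2 = y ^+ 2 - y ^+ 4 / 3 + y ^+ 6 / 36 by field.
have e2 : (y *+ 2) ^+ 2 = 4 * y ^+ 2 by ring.
have e3 : (y *+ 2) ^+ 3 = 8 * y ^+ 3 by ring.
rewrite e2 e3; lra.
Qed.

Lemma abs_cos_taylor x : `|cos x - (1 - x ^+ 2 / 2)| <= `|x| ^+ 3.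
Proof.
have := cos_lb x; have := cos_ub x; rewrite ler_norml => h1 h2.
have := exprn_ge0 3 (normr_ge0 x); lra.
Qed.

Lemma abs_sin_taylor x : `|sin x - x| <= `|x| ^+ 3.
Proof.
wlog x0 : x / 0 <= x.
  move=> h; have [/h //|/ltW] := leP 0 x.
  by rewrite -oppr_ge0 => /h; rewrite sinN -opprD !normrN.
have := sin_lb x0; have := sin_le_id x0; rewrite (ger0_norm x0) ler_norml.
have := exprn_ge0 3 x0; lra.
Qed.

Lemma expRN_taylor x : 0 <= x -> `|expR (- x) - (1 - x)| <= x ^+ 2.
Proof.
move=> x0; have := expR_ge1Dx (- x) => h1.
have h2 : expR (- x) <= 1 - x + x ^+ 2.
  have x1 : 0 < 1 + x by lra.
  rewrite expRN; apply: le_trans (_ : (1 + x)^-1 <= _).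
    by rewrite lef_pV2 ?posrE ?expR_gt0// expR_ge1Dx.
  rewrite -[leLHS]mul1r ler_pdivrMr//.
  have -> : (1 - x + x ^+ 2) * (1 + x) = 1 + x ^+ 3 by ring.
  by rewrite lerDl exprn_ge0.
by rewrite ler_norml; apply/andP; split; nra.
Qed.

End TrigBounds.

(** * Real expectations, and Lindeberg replacement for cosines *)

Definition Ex {R : realType} {d} {T : measurableType d} (P : probability T R)
  (f : T -> R) : R := \int[P]_w f w.

Definition integr {R : realType} {d} {T : measurableType d} (P : probability T R)
  (f : T -> R) : Prop := P.-integrable setT (EFin \o f).

Lemma measurable_cosT {R : realType} {d} {T : measurableType d} (f : T -> R) : measurable_fun setT f -> measurable_fun setT (fun w => cos (f w)).
Proof.
move=> mf; apply: (measurableT_comp _ mf); apply: continuous_measurable_fun.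
exact: continuous_cos.
Qed.

Lemma measurable_sinT {R : realType} {d} {T : measurableType d} (f : T -> R) : measurable_fun setT f -> measurable_fun setT (fun w => sin (f w)).
Proof.
move=> mf; apply: (measurableT_comp _ mf); apply: continuous_measurable_fun.
exact: continuous_sin.
Qed.

Section Expectation.
Context {R : realType} {d : measure_display} {T : measurableType d}.
Variable P : probability T R.
Implicit Types f g : T -> R.

Lemma integr_measurable f : integr P f -> measurable_fun setT f.
Proof. by move=> /integrableP[/measurable_EFinP]. Qed.

Lemma integr_le f g : measurable_fun setT f -> (forall w, `|f w| <= g w) ->
  integr P g -> integr P f.
Proof.
move=> mf fg ig; apply: (le_integrable _ _ _ ig) => //; first exact/measurable_EFinP.
by move=> w _; rewrite lee_fin (le_trans (fg w))// ler_norm.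
Qed.

Lemma integr_cst k : integr P (fun=> k).
Proof.
exact: finite_measure_integrable_cst.
Qed.

Lemma integr_bd f M : measurable_fun setT f -> (forall w, `|f w| <= M) -> integr P f.
Proof. by move=> mf fM; exact: (integr_le mf fM (integr_cst M)). Qed.

Lemma integrD f g : integr P f -> integr P g -> integr P (fun w => f w + g w).
Proof. by move=> fi gi; have := integrableD measurableT fi gi. Qed.

Lemma integrB f g : integr P f -> integr P g -> integr P (fun w => f w - g w).
Proof. by move=> fi gi; have := integrableB measurableT fi gi. Qed.

Lemma integrZ k f : integr P f -> integr P (fun w => k * f w).
Proof. by move=> fi; have := integrableZl measurableT k fi. Qed.

Lemma integr_norm f : integr P f -> integr P (fun w => `|f w|).
Proof. exact: integrable_norm. Qed.

Lemma integr_sum (I : Type) (s : seq I) (f : I -> T -> R) :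
  (forall i, integr P (f i)) -> integr P (fun w => \sum_(i <- s) f i w).
Proof.
move=> fi; elim: s => [|i s ih].
  by under eq_fun do rewrite big_nil; exact: integr_cst.
by under eq_fun do rewrite big_cons; exact: integrD.
Qed.

Lemma ExD f g : integr P f -> integr P g -> Ex P (fun w => f w + g w) = Ex P f + Ex P g.
Proof. by move=> ? ?; exact: RintegralD. Qed.

Lemma ExB f g : integr P f -> integr P g -> Ex P (fun w => f w - g w) = Ex P f - Ex P g.
Proof. by move=> ? ?; exact: RintegralB. Qed.

Lemma ExZ k f : integr P f -> Ex P (fun w => k * f w) = k * Ex P f.
Proof. by move=> ?; exact: RintegralZl. Qed.

Lemma Ex_cst k : Ex P (fun=> k) = k.
Proof. by rewrite /Ex Rintegral_cst//= probability_setT mulr1. Qed.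

Lemma Ex_sum (I : Type) (s : seq I) (f : I -> T -> R) :
  (forall i, integr P (f i)) ->
  Ex P (fun w => \sum_(i <- s) f i w) = \sum_(i <- s) Ex P (f i).
Proof.
move=> fi; elim: s => [|i s ih].
  by under eq_fun do rewrite big_nil; rewrite Ex_cst big_nil.
under eq_fun do rewrite big_cons.
by rewrite ExD ?big_cons ?ih//; exact: integr_sum.
Qed.

Lemma Ex_le f g : integr P f -> integr P g -> (forall w, f w <= g w) -> Ex P f <= Ex P g.
Proof. by move=> ? ? fg; apply: le_Rintegral. Qed.

Lemma Ex_ge0 f : (forall w, 0 <= f w) -> 0 <= Ex P f.
Proof. by move=> f0; exact: Rintegral_ge0. Qed.

Lemma Ex_norm f : integr P f -> `|Ex P f| <= Ex P (fun w => `|f w|).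
Proof. by move=> ?; exact: le_normr_Rintegral. Qed.

Lemma Ex_norm_le f g : integr P f -> integr P g -> (forall w, `|f w| <= g w) ->
  `|Ex P f| <= Ex P g.
Proof.
by move=> fi gi fg; apply: (le_trans (Ex_norm fi)); apply: Ex_le => //; exact: integr_norm.
Qed.

Lemma Ex_normB f g k : integr P f -> integr P g -> (forall w, `|f w - g w| <= k) ->
  `|Ex P f - Ex P g| <= k.
Proof.
move=> fi gi fg; rewrite -ExB// -[leRHS]Ex_cst; apply: Ex_norm_le => //.
- exact: integrB.
- exact: integr_cst.
Qed.

Lemma Ex_bd f M : measurable_fun setT f -> (forall w, `|f w| <= M) -> `|Ex P f| <= M.
Proof.
move=> mf fM; rewrite -[leRHS]Ex_cst; apply: Ex_norm_le => //; last exact: integr_cst.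
exact: integr_bd mf fM.
Qed.

Lemma integr_cos f : measurable_fun setT f -> integr P (fun w => cos (f w)).
Proof. by move=> mf; apply: (@integr_bd _ 1) => [|w]; [exact: measurable_cosT|exact: cos_max]. Qed.

Lemma integr_sin f : measurable_fun setT f -> integr P (fun w => sin (f w)).
Proof. by move=> mf; apply: (@integr_bd _ 1) => [|w]; [exact: measurable_sinT|exact: sin_max]. Qed.

Lemma rv_indep_comp f g (h k : R -> R) : measurable_fun setT h -> measurable_fun setT k ->
  rv_indep P f g -> rv_indep P (h \o f) (k \o g).
Proof.
move=> mh mk fg A B mA mB; apply: (fg (h @^-1` A) (k @^-1` B)).
- by rewrite -[X in measurable X]setTI; exact: mh.
- by rewrite -[X in measurable X]setTI; exact: mk.
Qed.

Lemma Ex_indep f g : integr P f -> integr P g -> rv_indep P f g ->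
  integr P (fun w => f w * g w) /\ Ex P (fun w => f w * g w) = Ex P f * Ex P g.
Proof.
move=> fi gi fg; apply: rv_indep_integral => //; exact: integr_measurable.
Qed.

(* One step of the characteristic function form of Lindeberg's argument. *)
Lemma cos_indep_step (Z x : T -> R) (s2 c b : R) :
  measurable_fun setT Z -> rv_indep P Z x ->
  integr P x -> integr P (fun w => x w ^+ 2) -> integr P (fun w => x w ^+ 4) ->
  Ex P x = 0 -> Ex P (fun w => x w ^+ 2) = s2 -> `|c| <= 1 ->
  `|Ex P (fun w => cos (Z w + c * x w + b))
    - expR (- (c ^+ 2 * s2 / 2)) * Ex P (fun w => cos (Z w + b))|
  <= (2 * (1 + Ex P (fun w => x w ^+ 4)) + s2 ^+ 2) * `|c| ^+ 3.
Proof.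
move=> mZ Zx ix ix2 ix4 x0 x2 c1.
have mx := integr_measurable ix.
set M := Ex P (fun w => x w ^+ 4).
have s20 : 0 <= s2 by rewrite -x2; apply: Ex_ge0 => w; exact: sqr_ge0.
have mZb : measurable_fun setT (fun w => Z w + b) by exact: measurable_funD.
have mcx : measurable_fun setT (fun w => c * x w) by exact: measurable_funM.
have x3 w : `|x w| ^+ 3 <= 1 + x w ^+ 4.
  have -> : x w ^+ 4 = `|x w| ^+ 4 by rewrite -normrX ger0_norm// -[4%N]/(2 * 2)%N exprM sqr_ge0.
  have := normr_ge0 (x w); move: `|x w| => y y0.
  have [y1|y1] := leP y 1.
    have := exprn_ile1 3 y0 y1; have := exprn_ge0 4 y0; lra.
  have : y ^+ 3 <= y ^+ 4 by rewrite ler_weXn2l// ltW.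
  lra.
have i3 : integr P (fun w => 1 + x w ^+ 4) by apply: integrD => //; exact: integr_cst.
have i3c : integr P (fun w => `|c| ^+ 3 * (1 + x w ^+ 4)) by exact: integrZ.
have E3 : Ex P (fun w => `|c| ^+ 3 * (1 + x w ^+ 4)) = `|c| ^+ 3 * (1 + M).
  by rewrite ExZ// ExD ?Ex_cst//; exact: integr_cst.
have c3 : 0 <= `|c| ^+ 3 by rewrite exprn_ge0.
have cosE : `|Ex P (fun w => cos (c * x w)) - (1 - c ^+ 2 * s2 / 2)| <= `|c| ^+ 3 * (1 + M).
  have -> : 1 - c ^+ 2 * s2 / 2 = Ex P (fun w => 1 - c ^+ 2 / 2 * x w ^+ 2).
    rewrite ExB ?Ex_cst ?ExZ ?x2//; first by field.
    - exact: integr_cst.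
    - exact: integrZ.
  rewrite -ExB; last 2 first.
  - exact: integr_cos.
  - by apply: integrB; [exact: integr_cst|exact: integrZ].
  rewrite -E3; apply: Ex_norm_le => //.
    apply: integrB; first exact: integr_cos.
    by apply: integrB; [exact: integr_cst|exact: integrZ].
  move=> w; have -> : 1 - c ^+ 2 / 2 * x w ^+ 2 = 1 - (c * x w) ^+ 2 / 2 by field.
  apply: le_trans (abs_cos_taylor _) _; rewrite normrM exprMn; exact: ler_wpM2l.
have sinE : `|Ex P (fun w => sin (c * x w))| <= `|c| ^+ 3 * (1 + M).
  (* The mean is zero, so subtracting the linear term changes nothing and leaves the cubic
     remainder. *)
  have -> : Ex P (fun w => sin (c * x w)) = Ex P (fun w => sin (c * x w) - c * x w).
    rewrite ExB; [|exact: integr_sin|exact: integrZ].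
    by rewrite ExZ// x0 mulr0 subr0.
  rewrite -E3; apply: Ex_norm_le => //.
    by apply: integrB; [exact: integr_sin|exact: integrZ].
  move=> w; apply: le_trans (abs_sin_taylor _) _; rewrite normrM exprMn; exact: ler_wpM2l.
have expE : `|expR (- (c ^+ 2 * s2 / 2)) - (1 - c ^+ 2 * s2 / 2)| <= s2 ^+ 2 * `|c| ^+ 3.
  apply: le_trans (expRN_taylor _) _.
    by rewrite divr_ge0// mulr_ge0// sqr_ge0.
  have -> : (c ^+ 2 * s2 / 2) ^+ 2 = (s2 ^+ 2 * c ^+ 4) / 4 by field.
  have -> : c ^+ 4 = `|c| ^+ 4 by rewrite -normrX ger0_norm// -[4%N]/(2 * 2)%N exprM sqr_ge0.
  have h : `|c| ^+ 4 <= `|c| ^+ 3 by rewrite exprS -[leRHS]mul1r ler_wpM2r.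
  have : s2 ^+ 2 * `|c| ^+ 4 <= s2 ^+ 2 * `|c| ^+ 3 by rewrite ler_wpM2l ?sqr_ge0.
  have : 0 <= s2 ^+ 2 * `|c| ^+ 3 by rewrite mulr_ge0 ?sqr_ge0.
  have : 0 <= s2 ^+ 2 * `|c| ^+ 4 by rewrite mulr_ge0 ?sqr_ge0 ?exprn_ge0.
  lra.
have mcos : measurable_fun setT (fun z : R => cos (z + b)).
  by apply: measurable_cosT; exact: measurable_funD.
have msin : measurable_fun setT (fun z : R => sin (z + b)).
  by apply: measurable_sinT; exact: measurable_funD.
have mcosc : measurable_fun setT (fun z : R => cos (c * z)).
  by apply: measurable_cosT; exact: measurable_funM.
have msinc : measurable_fun setT (fun z : R => sin (c * z)).
  by apply: measurable_sinT; exact: measurable_funM.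
have [i1 e1] := Ex_indep (integr_cos mZb) (integr_cos mcx) (rv_indep_comp mcos mcosc Zx).
have [i2 e2] := Ex_indep (integr_sin mZb) (integr_sin mcx) (rv_indep_comp msin msinc Zx).
have -> : Ex P (fun w => cos (Z w + c * x w + b)) =
    Ex P (fun w => cos (Z w + b)) * Ex P (fun w => cos (c * x w))
  - Ex P (fun w => sin (Z w + b)) * Ex P (fun w => sin (c * x w)).
  rewrite -e1 -e2 -ExB//; congr Ex; apply/funext => w.
  by rewrite -cosD; congr cos; ring.
have C1 : `|Ex P (fun w => cos (Z w + b))| <= 1.
  by apply: Ex_bd; [exact: measurable_cosT|move=> w; exact: cos_max].
have S1 : `|Ex P (fun w => sin (Z w + b))| <= 1.
  by apply: Ex_bd; [exact: measurable_sinT|move=> w; exact: sin_max].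
move: cosE sinE expE C1 S1.
set p := Ex P (fun w => cos (c * x w)); set q := Ex P (fun w => sin (c * x w)).
set u := Ex P (fun w => cos (Z w + b)); set v := Ex P (fun w => sin (Z w + b)).
set e := expR _; set o := 1 - _ => pE qE eE u1 v1.
(* [o] is the second-order Taylor value shared by the cosine transform [p] and the Gaussian factor
   [e]; each of the three terms is then of order [|c|^3]. *)
have -> : u * p - v * q - e * u = u * (p - o) - u * (e - o) - v * q by ring.
apply: le_trans (ler_normB _ _) _.
have h1 : `|v * q| <= `|c| ^+ 3 * (1 + M).
  by rewrite normrM -[leRHS]mul1r ler_pM.
apply: (@le_trans _ _ (`|c| ^+ 3 * (1 + M) + s2 ^+ 2 * `|c| ^+ 3 + `|c| ^+ 3 * (1 + M))).
  rewrite lerD// (le_trans (ler_normB _ _))// lerD// normrM -[leRHS]mul1r ler_pM//.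
lra.
Qed.

(** Variables are peeled off one at a time. The Gaussian factors produced on the way are at most 1,
    so the one-step errors simply add up. *)
Lemma cos_sum_approx (K : eqType) (x : K -> T -> R) (Z : T -> R) (s2 c C : K -> R) (b : R)
    (s : seq K) : measurable_fun setT Z ->
  (forall k, [/\ integr P (x k), integr P (fun w => x k w ^+ 2),
     integr P (fun w => x k w ^+ 4), Ex P (x k) = 0 & Ex P (fun w => x k w ^+ 2) = s2 k]) ->
  (forall k, 2 * (1 + Ex P (fun w => x k w ^+ 4)) + s2 k ^+ 2 <= C k) ->
  (forall k, `|c k| <= 1) ->
  (forall k s', uniq (k :: s') ->
    rv_indep P (fun w => Z w + \sum_(i <- s') c i * x i w) (x k)) ->
  uniq s ->
  `|Ex P (fun w => cos (Z w + \sum_(i <- s) c i * x i w + b))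
    - expR (- (\sum_(i <- s) c i ^+ 2 * s2 i / 2)) * Ex P (fun w => cos (Z w + b))|
  <= \sum_(i <- s) C i * `|c i| ^+ 3.
Proof.
move=> mZ xP CP c1 ind; elim: s => [|k s ih] us.
  under eq_fun do rewrite big_nil addr0.
  by rewrite !big_nil oppr0 expR0 mul1r subrr normr0.
have {}ih := ih (subseq_uniq (subseq_cons _ _) us).
have [ix ix2 ix4 x0 x2] := xP k.
have mS : measurable_fun setT (fun w => Z w + \sum_(i <- s) c i * x i w).
  apply: measurable_funD => //; apply: (@integr_measurable _ ).
  by apply: integr_sum => i; apply: integrZ; have [] := xP i.
have := cos_indep_step b mS (ind _ _ us) ix ix2 ix4 x0 x2 (c1 k).
rewrite !big_cons opprD expRD.
under [in X in _ -> X]eq_fun do rewrite big_cons (addrC (c k * _)) addrA.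
set A := Ex P _; set B := Ex P _ in ih *; set D := Ex P _ in ih *.
move=> h.
set e1 := expR _ in h *; set e2 := expR _ in ih *.
have -> : A - e1 * e2 * D = (A - e1 * B) + e1 * (B - e2 * D) by ring.
apply: le_trans (ler_normD _ _) _; rewrite lerD//.
  by apply: (le_trans h); rewrite ler_wpM2r// exprn_ge0.
have e11 : `|e1| <= 1.
  rewrite ger0_norm ?expR_ge0// -[leRHS]expR0 ler_expR oppr_le0 divr_ge0// mulr_ge0 ?sqr_ge0//.
  by rewrite -x2; apply: Ex_ge0 => w; exact: sqr_ge0.
by rewrite normrM -[leRHS]mul1r ler_pM.
Qed.

End Expectation.

(** * The Fourier transform of the normal law *)

Section GaussianFourier.
Context {R : realType}.
Variables (m s : R).
Hypothesis s0 : s != 0.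
Notation mu := (@lebesgue_measure R).
Let p : R -> R := normal_pdf m s.

Let s2 : 0 < s ^+ 2. Proof. by rewrite exprn_even_gt0. Qed.

Let pE x : p x = normal_peak s * expR (- (x - m) ^+ 2 / (s ^+ 2 *+ 2)).
Proof. by rewrite /p normal_pdfE. Qed.

Let p0 x : 0 <= p x. Proof. exact: normal_pdf_ge0. Qed.

Let mp : measurable_fun setT p. Proof. exact: measurable_normal_pdf. Qed.

Let is_derive_p (x : R) : is_derive x 1 p (- (x - m) / s ^+ 2 * p x).
Proof.
rewrite (_ : p = fun x => normal_peak s * expR (- (x - m) ^+ 2 / (s ^+ 2 *+ 2))); last exact/funext.
apply: is_derive_eq; rewrite /GRing.scale/=.
by field.
Qed.

Let ip : mu.-integrable setT (EFin \o p).
Proof. exact: integrable_normal_pdf. Qed.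

(** An integrable majorant: the density with doubled deviation. The ratio of the exponentials is
    [exp u] with [u = 3 y^2 / (8 s^2)], bounded below by [1 + u]; the factor [1 + 8 s^2 / 3] turns
    this into more than [1 + y^2], and 2 makes up for the halved peak. *)
Let xp_bound x : `|x - m| * p x <= (1 + 8 * s ^+ 2 / 3) * 2 * normal_pdf m (2 * s) x.
Proof.
have s20 : 2 * s != 0 by rewrite mulf_neq0.
rewrite pE normal_pdfE// /normal_fun.
have -> : normal_peak (2 * s) = normal_peak s / 2.
  rewrite /normal_peak exprMn -!mulrnAr -mulrA sqrtrM ?sqr_ge0// sqrtr_sqr ger0_norm// invfM.
  by rewrite mulrC.
set y := x - m; set k := normal_peak s.
have k0 : 0 <= k by exact: normal_peak_ge0.
have -> : (1 + 8 * s ^+ 2 / 3) * 2 * (k / 2 * expR (- y ^+ 2 / ((2 * s) ^+ 2 *+ 2)))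
  = k * ((1 + 8 * s ^+ 2 / 3) * expR (- y ^+ 2 / ((2 * s) ^+ 2 *+ 2))) by field.
rewrite mulrCA ler_wpM2l//.
have -> : - y ^+ 2 / ((2 * s) ^+ 2 *+ 2) = - y ^+ 2 / (s ^+ 2 *+ 2) + 3 * y ^+ 2 / (8 * s ^+ 2) by field.
rewrite expRD mulrCA mulrC ler_wpM2l ?expR_ge0//.
apply: (@le_trans _ _ ((1 + 8 * s ^+ 2 / 3) * (1 + 3 * y ^+ 2 / (8 * s ^+ 2)))); last first.
  rewrite ler_wpM2l ?expR_ge1Dx// addr_ge0// divr_ge0// mulr_ge0// ltW//.
have -> : (1 + 8 * s ^+ 2 / 3) * (1 + 3 * y ^+ 2 / (8 * s ^+ 2)) =
  1 + y ^+ 2 + 8 * s ^+ 2 / 3 + 3 * y ^+ 2 / (8 * s ^+ 2) by field.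
have h1 : 0 <= 8 * s ^+ 2 / 3 by rewrite divr_ge0// mulr_ge0// ltW.
have h2 : 0 <= 3 * y ^+ 2 / (8 * s ^+ 2) by rewrite divr_ge0// mulr_ge0// ?sqr_ge0// ltW.
have : `|y| <= 1 + y ^+ 2.
  rewrite -(real_normK (num_real y)); have := normr_ge0 y; nra.
lra.
Qed.

Let iG : mu.-integrable setT (EFin \o (fun x => `|x - m| * p x)).
Proof.
apply: (@le_integrable _ _ _ mu _ measurableT _ (EFin \o (fun x => (1 + 8 * s ^+ 2 / 3) * 2 * normal_pdf m (2 * s) x))).
- apply/measurable_EFinP; apply: measurable_funM => //.
  by apply: measurableT_comp => //; exact: measurable_funB.
- move=> x _; rewrite lee_fin (ger0_norm (mulr_ge0 (normr_ge0 _) (p0 x))).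
  exact: le_trans (xp_bound x) (ler_norm _).
- have := @integrableZl _ _ _ mu setT measurableT ((1 + 8 * s ^+ 2 / 3) * 2) _ (integrable_normal_pdf m (2 * s)).
  by [].
Qed.

(** Decay of the boundary terms in the integration by parts; a rate [1 / n] suffices and follows
    from [exp u >= 1 + u] and [n <= n^2]. *)
Let cvg_p : forall n : nat, p (m + n%:R) = p (m - n%:R) /\ p (m + n%:R) <= normal_peak s * (s ^+ 2 *+ 2) / (n%:R + s ^+ 2 *+ 2).
Proof.
move=> n; rewrite !pE; split.
  by rewrite (_ : m - n%:R - m = - (m + n%:R - m)) ?sqrrN//; rewrite opprB opprD [RHS]addrA [LHS]addrAC subrr !add0r.
rewrite -mulrA ler_wpM2l ?normal_peak_ge0//.
have n0 : 0 <= (n%:R : R) by [].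
have nn : (n%:R : R) <= n%:R ^+ 2.
  by case: n {n0} => [|n]; rewrite ?expr0n// exprS ler_peMl// ler1n.
rewrite (_ : - (m + n%:R - m) ^+ 2 / (s ^+ 2 *+ 2) = - (n%:R ^+ 2 / (s ^+ 2 *+ 2))); last first.
  by rewrite mulNr; congr (- (_ / _)); ring.
have d0 : 0 < s ^+ 2 *+ 2 by rewrite mulrn_wgt0.
move: (s ^+ 2 *+ 2) d0 => D d0.
rewrite expRN -[leLHS]mul1r ler_pdivrMr ?expR_gt0//.
have h : 1 + n%:R ^+ 2 / D <= expR (n%:R ^+ 2 / D) by exact: expR_ge1Dx.
have -> : D / (n%:R + D) = (1 + n%:R / D)^-1 by field; lra.
rewrite mulrC ler_pdivlMr; last by rewrite ltr_pwDl// divr_ge0// ltW.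
by rewrite mul1r (le_trans _ h)// lerD2l ler_pM2r ?invr_gt0.
Qed.

Let is_derive_sp (a b x : R) : is_derive x 1 (fun x => sin (a * (x - m) + b) * p x)
   (a * (cos (a * (x - m) + b) * p x) - (s ^+ 2)^-1 * ((x - m) * sin (a * (x - m) + b) * p x)).
Proof.
have dp := is_derive_p x.
by apply: is_derive_eq; rewrite /GRing.scale/=; field.
Qed.

Let icos (a b : R) : mu.-integrable setT (EFin \o (fun x => cos (a * (x - m) + b) * p x)).
Proof.
apply: (@le_integrable _ _ _ mu _ measurableT _ (EFin \o p)) => //.
- apply/measurable_EFinP; apply: measurable_funM => //; apply: measurable_cosT.
  by apply: measurable_funD => //; apply: measurable_funM => //; exact: measurable_funB.
- by move=> x _; rewrite lee_fin normrM ler_piMl// cos_max.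
Qed.

Let isin (a b : R) : mu.-integrable setT (EFin \o (fun x => (x - m) * sin (a * (x - m) + b) * p x)).
Proof.
apply: (@le_integrable _ _ _ mu _ measurableT _ (EFin \o (fun x => `|x - m| * p x))) => //.
- apply/measurable_EFinP; apply: measurable_funM => //; apply: measurable_funM; first exact: measurable_funB.
  apply: measurable_sinT.
  by apply: measurable_funD => //; apply: measurable_funM => //; exact: measurable_funB.
- move=> x _; rewrite lee_fin !normrM normr_id ler_wpM2r//.
  by rewrite ler_piMr// sin_max.
Qed.

(** Since [p' = - (x - m) / s^2 p], the difference of the two sides is, up to a factor, the integral
    of the derivative of [sin (a (x - m) + b) p], whose boundary values vanish. The whole line is
    exhausted by the intervals [[m - n, m + n]] under dominated convergence. *)
Let ibp (a b : R) : \int[mu]_x ((x - m) * sin (a * (x - m) + b) * p x) =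
   a * s ^+ 2 * \int[mu]_x (cos (a * (x - m) + b) * p x).
Proof.
pose H x := sin (a * (x - m) + b) * p x.
pose h x := a * (cos (a * (x - m) + b) * p x) - (s ^+ 2)^-1 * ((x - m) * sin (a * (x - m) + b) * p x).
have dH (x : R) : is_derive x 1 H (h x) by exact: is_derive_sp.
have i1 : mu.-integrable setT (EFin \o (fun x => a * (cos (a * (x - m) + b) * p x))).
  by have := integrableZl measurableT a (icos a b).
have i2 : mu.-integrable setT (EFin \o (fun x => (s ^+ 2)^-1 * ((x - m) * sin (a * (x - m) + b) * p x))).
  by have := integrableZl measurableT (s ^+ 2)^-1 (isin a b).
have ih : mu.-integrable setT (EFin \o h).
  by have := integrableB measurableT i1 i2.
have mh : measurable_fun setT h by case/integrableP: ih => /measurable_EFinP.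
suff : \int[mu]_x h x = 0.
  rewrite RintegralB//.
  rewrite (RintegralZl _ _ (icos a b))// (RintegralZl _ _ (isin a b))// => /eqP.
  rewrite subr_eq0 => /eqP e; rewrite mulrAC e mulrAC mulVf ?mul1r//.
  by rewrite gt_eqF.
have hc : continuous h.
  move=> x; rewrite /h.
  apply: cvgB; (apply: cvgM; first exact: cvg_cst); apply: cvgM; try (exact: continuous_normal_pdf).
    apply: continuous_comp; last exact: continuous_cos.
    by apply: cvgD; [apply: cvgM; [exact: cvg_cst|apply: cvgB => //; exact: cvg_cst]|exact: cvg_cst].
  apply: cvgM; first by apply: cvgB => //; exact: cvg_cst.
  apply: continuous_comp; last exact: continuous_sin.
  by apply: cvgD; [apply: cvgM; [exact: cvg_cst|apply: cvgB => //; exact: cvg_cst]|exact: cvg_cst].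
have Hn (n : nat) : (\int[mu]_(x in `[(m - n%:R)%R, (m + n%:R)%R]) (h x)%:E = ((H (m + n%:R) - H (m - n%:R))%R)%:E)%E.
  (* At [n = 0] the interval is a point, to which the fundamental theorem does not apply. *)
  case: n => [|n].
    by rewrite !addr0 subr0 subrr set_itv1 integral_set1.
  rewrite (@continuous_FTC2 _ h H)//.
  - by have := ltr0Sn R n; lra.
  - exact: continuous_subspaceT.
  - split.
    + by move=> x _; have [] := dH x.
    + apply: cvg_at_right_filter; apply: differentiable_continuous; apply/derivable1_diffP.
      by have [] := dH (m - n.+1%:R).
    + apply: cvg_at_left_filter; apply: differentiable_continuous; apply/derivable1_diffP.
      by have [] := dH (m + n.+1%:R).
  - by move=> x _; rewrite derive1E; exact: derive_val.
pose f_ n x := ((h \_ `[(m - n%:R)%R, (m + n%:R)%R]) x)%:E.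
have cvgI : (\int[mu]_x f_ n x @[n --> \oo] --> \int[mu]_x (h x)%:E)%E.
  have [] // := @dominated_convergence _ _ _ mu setT measurableT f_ (EFin \o h) (EFin \o (fun x => `|h x|)).
  - move=> n; apply/measurable_EFinP; by apply/(measurable_restrictT _ _).1 => //; exact: measurable_funTS.
  - exact/measurable_EFinP.
  - apply: aeW => x _; apply: cvg_near_cst; near=> n.
    rewrite /f_ patchE mem_set//= in_itv/=.
    have : `|x - m| <= n%:R by near: n; exact: nbhs_infty_ger.
    by rewrite ler_norml; lra.
  - exact: integrable_norm.
  - apply: aeW => x n _; rewrite /f_ patchE lee_fin; case: ifP => // _.
    by rewrite normr0.
have fE n : (\int[mu]_x f_ n x)%E = ((H (m + n%:R) - H (m - n%:R))%R)%:E.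
  rewrite -Hn [RHS]integral_mkcond; apply: eq_integral => x _.
  by rewrite /f_ !patchE; case: ifP.
have cvg0 : (H (m + n%:R) - H (m - n%:R)) @[n --> \oo] --> (0 : R).
  pose D := s ^+ 2 *+ 2; have D0 : 0 < D by rewrite mulrn_wgt0.
  pose K := normal_peak s * D * (1 + D^-1) * 2.
  apply/norm_cvg0P.
  apply: (@squeeze_cvgr _ _ _ _ (fun=> 0) (fun n => K * n.+1%:R^-1)).
  - near=> n; rewrite normr_ge0/=.
    have [e1 e2] := cvg_p n.
    apply: le_trans (ler_normB _ _) _.
    have h1 : `|H (m + n%:R)| <= p (m + n%:R) by rewrite normrM (ger0_norm (p0 _)) ler_piMl// sin_max.
    have h2 : `|H (m - n%:R)| <= p (m + n%:R) by rewrite e1 normrM (ger0_norm (p0 _)) ler_piMl// sin_max.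
    have h3 : normal_peak s * D / (n%:R + D) <= normal_peak s * D * ((1 + D^-1) / n.+1%:R).
      apply: ler_wpM2l; first by apply: mulr_ge0; [exact: normal_peak_ge0|exact: ltW].
      have nD : 0 < n%:R + D by rewrite ltr_wpDl.
      have D'0 : 0 <= D^-1 by rewrite invr_ge0 ltW.
      rewrite -[leLHS]mul1r ler_pdivrMr// mulrAC ler_pdivlMr// mul1r.
      have -> : (1 + D^-1) * (n%:R + D) = n%:R + 1 + (D + n%:R * D^-1) by field; rewrite gt_eqF.
      rewrite -[n.+1%:R]natr1 lerDl addr_ge0//; first exact: ltW.
      by rewrite mulr_ge0.
    have h4 : K / n.+1%:R = 2 * (normal_peak s * D * ((1 + D^-1) / n.+1%:R)) by rewrite /K; ring.
    rewrite h4; move: (le_trans e2 h3) h1 h2; set q := _ * (_ / _); lra.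
  - exact: cvg_cst.
  - rewrite -[X in _ --> X](mulr0 K); apply: cvgM; [exact: cvg_cst|exact: cvg_harmonic].
rewrite /Rintegral.
have -> : (\int[mu]_x (h x)%:E = 0)%E; last by [].
apply: (cvg_unique _ cvgI) => //.
rewrite /= (_ : (fun n => (\int[mu]_x f_ n x)%E) = (fun n => (H (m + n%:R) - H (m - n%:R))%:E)); last exact/funext.
by apply: cvg_EFin; [exact: nearW|exact: cvg0].
Unshelve. all: by end_near.
Qed.

(** Differentiating under the integral and applying [ibp] gives [F' = - a s^2 F]; with the
    integrating factor [exp (a^2 s^2 / 2)] the product is constant, and its value at [a = 0] is
    [cos b]. *)
Lemma gaussian_fourier (a b : R) :
  \int[mu]_x (cos (a * (x - m) + b) * normal_pdf m s x) = expR (- (a ^+ 2 * s ^+ 2 / 2)) * cos b.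
Proof.
rewrite -/p; pose f (a x : R) := cos (a * (x - m) + b) * p x.
pose F a := \int[mu]_x f a x.
have df (c x : R) : is_derive c 1 (f ^~ x) (- ((x - m) * sin (c * (x - m) + b) * p x)).
  by apply: is_derive_eq; rewrite /GRing.scale/=; ring.
have d1f (c x : R) : partial1of2 f c x = - ((x - m) * sin (c * (x - m) + b) * p x).
  by rewrite partial1of2E; exact: derive_val.
have ub (c x : R) : `|partial1of2 f c x| <= `|x - m| * p x.
  rewrite d1f normrN !normrM (ger0_norm (p0 _)) ler_wpM2r//.
  by rewrite ler_piMr// sin_max.
have dF (c : R) : is_derive c 1 F (- (c * s ^+ 2) * F c).
  have cI : `]c - 1, c + 1[%classic c by rewrite /= in_itv/=; lra.
  have intf : forall x : R, `]c - 1, c + 1[%classic x -> mu.-integrable setT (EFin \o f x).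
    by move=> x _; exact: icos.
  have der : forall x y : R, `]c - 1, c + 1[%classic x -> [set: R] y -> derivable (f ^~ y) x 1.
    by move=> x y _ _; have [] := df x y.
  have G0 y : 0 <= `|y - m| * p y by rewrite mulr_ge0.
  have ub' (x y : R) : `]c - 1, c + 1[%classic x -> [set: R] y -> `|partial1of2 f x y| <= `|y - m| * p y.
    by move=> _ _; exact: ub.
  have D1 := @derivable_under_integral _ _ _ mu f setT measurableT c _ _ cI intf der _ G0 iG ub'.
  have D2 := @differentiation_under_integral _ _ _ mu f setT measurableT c _ _ cI intf der _ G0 iG ub'.
  apply: DeriveDef => //; rewrite -derive1E D2.
  under eq_Rintegral do rewrite d1f -mulN1r.
  by rewrite RintegralZl// ?ibp ?mulN1r ?mulNr//; exact: isin.
have dPhi (c : R) : is_derive c (1 : R) (fun c => F c * expR (c ^+ 2 * s ^+ 2 / 2)) 0.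
  have dFc := dF c.
  by apply: is_derive_eq; rewrite /GRing.scale/=; field.
have := is_derive_0_is_cst a 0 dPhi.
rewrite expr0n/= !mul0r expR0 mulr1 /F => e.
have F0 : \int[mu]_x f 0 x = cos b.
  rewrite /f; under eq_Rintegral do rewrite mul0r add0r.
  by rewrite RintegralZl// /Rintegral integral_normal_pdf mulr1.
by rewrite expRN mulrC -F0 -e mulfK// gt_eqF// expR_gt0.
Qed.

End GaussianFourier.

(** The Radon-Nikodym derivative of the normal law is identified almost everywhere with its density,
    because both have the same integrals over measurable sets. *)
Lemma integral_normal_prob {R : realType} (m s : R) (f : R -> \bar R) :
  (normal_prob m s).-integrable setT f ->
  (\int[normal_prob m s]_x f x =
   \int[@lebesgue_measure R]_x (f x * (normal_pdf m s x)%:E))%E.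
Proof.
move=> fi; have mf := measurable_int _ fi.
rewrite -(Radon_Nikodym_change_of_variables (normal_prob_dominates m s))//=.
apply: ae_eq_integral => //.
- apply: emeasurable_funM => //; apply: (measurable_int (@lebesgue_measure R)).
  by apply: Radon_Nikodym_integrable; exact: normal_prob_dominates.
- by apply: emeasurable_funM => //=; apply/measurable_EFinP; exact: measurable_normal_pdf.
- apply: ae_eqe_mul2l => /=.
  rewrite Radon_NikodymE//=; first exact: normal_prob_dominates.
  move=> dom; case: cid => /= h [h1 h2 h3].
  apply: integral_ae_eq => //=; first by apply/measurable_EFinP; exact: measurable_normal_pdf.
  by move=> E _ mE; rewrite -h3.
Qed.

Lemma gaussian_law_cos {R : realType} {d} {T : measurableType d} (P : probability T R)
    (Y : T -> R) (m s2 a b : R) : measurable_fun setT Y -> 0 <= s2 ->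
  has_gaussian_law P Y m s2 ->
  Ex P (fun w => cos (a * Y w + b)) = expR (- (a ^+ 2 * s2 / 2)) * cos (a * m + b).
Proof.
move=> mY s20 GY.
pose Y' : {mfun T >-> measurableTypeR R} :=
  HB.pack (Y : T -> measurableTypeR R) (isMeasurableFun.Build _ _ _ (measurableTypeR R) Y mY).
have mc : measurable_fun [set: R] (fun y => (cos (a * y + b))%:E).
  apply/measurable_EFinP; apply: measurable_cosT.
  by apply: measurable_funD => //; exact: measurable_funM.
have E1 : Ex P (fun w => cos (a * Y w + b)) = fine (\int[distribution P Y']_y (cos (a * y + b))%:E)%E.
  rewrite integral_distribution//.
  apply: (@integr_cos _ _ _ P (fun w => a * Y w + b)).
  by apply: measurable_funD => //; exact: measurable_funM.
rewrite E1; have [s0|s0] := eqVneq s2 0.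
  rewrite (@eq_measure_integral _ (measurableTypeR R) R setT (@dirac _ (measurableTypeR R) m R)); last first.
    by move=> A mA _; have := GY A mA; rewrite s0 eqxx.
  by rewrite integral_dirac//= indicT mul1r s0 mulr0 mul0r oppr0 expR0 mul1r.
have q0 : Num.sqrt s2 != 0 by rewrite gt_eqF// sqrtr_gt0 lt_neqAle eq_sym s0.
have E2 : (\int[distribution P Y']_y (cos (a * y + b))%:E =
    \int[normal_prob m (Num.sqrt s2)]_y (cos (a * y + b))%:E)%E.
  by apply: eq_measure_integral => A mA _; have := GY A mA; rewrite (negbTE s0).
rewrite E2.
have := gaussian_fourier m q0 a (a * m + b); rewrite sqr_sqrtr// => <-.
rewrite integral_normal_prob; last first.
  apply: (@integr_cos _ _ _ (normal_prob m (Num.sqrt s2)) (fun x => a * x + b)).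
  by apply: measurable_funD => //; exact: measurable_funM.
congr fine; apply: eq_integral => y _; rewrite -EFinM; congr (cos _ * _)%:E; ring.
Qed.

(** * Trigonometric approximation and Levy's theorem *)

Section BigMin.
Context {R : realType} {I : eqType}.
Implicit Types (s : seq I) (h : I -> R).

Lemma bigmin_lb s h M c : c <= M -> (forall i, i \in s -> c <= h i) ->
  c <= \big[Num.min/M]_(i <- s) h i.
Proof.
move=> cM; elim: s => [|i s ih] hs; first by rewrite big_nil.
rewrite big_cons le_min hs ?mem_head//=; apply: ih => j js.
by rewrite hs// in_cons js orbT.
Qed.

Lemma bigmin_ub s h M i : i \in s -> \big[Num.min/M]_(i <- s) h i <= h i.
Proof.
elim: s => [//|j s ih]; rewrite in_cons big_cons ge_min => /orP[/eqP ->|/ih ->].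
  by rewrite lexx.
by rewrite orbT.
Qed.

Lemma bigmin_idx s h M : \big[Num.min/M]_(i <- s) h i <= M.
Proof. by elim: s => [|j s ih]; rewrite ?big_nil// big_cons ge_min ih orbT. Qed.

End BigMin.

Section TrigApproximation.
Context {R : realType} {K : finType}.
Implicit Types (f g : (K -> R) -> R) (x : K -> R).

Let half0 (e : R) : 0 < e -> 0 < e / 2.
Proof. by move=> e0; rewrite divr_gt0. Qed.

(** Each triple is an amplitude, a frequency vector and a phase; free phases put the sines in the
    class as well. *)
Definition trig_poly f := exists l : seq (R * (K -> R) * R), forall x,
  f x = \sum_(p <- l) p.1.1 * cos (\sum_i p.1.2 i * x i + p.2).

(** The closure is uniform on the whole space (almost periodic functions), so that convergence of
    the cosine transforms alone controls expectations of its members, without tightness. *)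
Definition trig_approx f := forall e : R, 0 < e -> exists2 g, trig_poly g &
  forall x, `|f x - g x| <= e.

Lemma trig_poly_cos (a : K -> R) (b : R) : trig_poly (fun x => cos (\sum_i a i * x i + b)).
Proof. by exists [:: (1, a, b)] => x; rewrite big_seq1 mul1r. Qed.

Lemma trig_poly_cst (c : R) : trig_poly (fun=> c).
Proof.
exists [:: (c, (fun=> 0), 0)] => x; rewrite big_seq1/= big1 ?addr0 ?cos0 ?mulr1// => i _.
by rewrite mul0r.
Qed.

Lemma trig_polyD f g : trig_poly f -> trig_poly g -> trig_poly (fun x => f x + g x).
Proof. by move=> [l fl] [k gk]; exists (l ++ k) => x; rewrite big_cat fl gk. Qed.

Lemma trig_polyM f g : trig_poly f -> trig_poly g -> trig_poly (fun x => f x * g x).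
Proof.
move=> [l fl] [k gk].
pose t (p q : R * (K -> R) * R) := [:: (p.1.1 * q.1.1 / 2, (fun i => p.1.2 i + q.1.2 i), p.2 + q.2);
   (p.1.1 * q.1.1 / 2, (fun i => p.1.2 i - q.1.2 i), p.2 - q.2)].
exists (flatten [seq t p q | p <- l, q <- k]) => x.
rewrite fl gk big_distrlr/= big_flatten/= big_allpairs_dep/=.
apply: eq_bigr => p _; apply: eq_bigr => q _.
rewrite !big_cons big_nil addr0/=.
set A := \sum_i _; set B := \sum_i _; set C := \sum_i _; set D := \sum_i _.
have -> : C = A + B by rewrite -big_split/=; apply: eq_bigr => i _; rewrite mulrDl.
have -> : D = A - B by rewrite -sumrB/=; apply: eq_bigr => i _; rewrite mulrBl.
have -> : A + B + (p.2 + q.2) = (A + p.2) + (B + q.2) by ring.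
have -> : A - B + (p.2 - q.2) = (A + p.2) - (B + q.2) by ring.
by move: (A + p.2) (B + q.2) => u v; rewrite cosD cosB; field.
Qed.

Lemma trig_poly_bounded f : trig_poly f -> exists2 M, 0 <= M & forall x, `|f x| <= M.
Proof.
move=> [l fl]; exists (\sum_(p <- l) `|p.1.1|); first by apply: sumr_ge0.
move=> x; rewrite fl (le_trans (ler_norm_sum _ _ _))//; apply: ler_sum => p _.
by rewrite normrM ler_piMr// cos_max.
Qed.

Lemma trig_approx_poly f : trig_poly f -> trig_approx f.
Proof. by move=> tf e e0; exists f => // x; rewrite subrr normr0 ltW. Qed.

Lemma trig_approx_bounded f : trig_approx f -> exists2 M, 0 <= M & forall x, `|f x| <= M.
Proof.
move=> /(_ 1 ltr01)[g /trig_poly_bounded[M M0 gM] fg]; exists (1 + M); first by rewrite addr_ge0.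
by move=> x; rewrite -[f x](subrK (g x)) (le_trans (ler_normD _ _))// lerD.
Qed.

Lemma trig_approx_lim f : (forall e : R, 0 < e -> exists2 g, trig_approx g &
  forall x, `|f x - g x| <= e) -> trig_approx f.
Proof.
move=> h e e0; have [g ag fg] := h (e / 2) (half0 e0).
have [k tk gk] := ag (e / 2) (half0 e0).
exists k => // x; rewrite -[f x](subrK (g x)) -addrA.
by rewrite (le_trans (ler_normD _ _))// [leRHS](splitr e) lerD.
Qed.

Lemma trig_approxD f g : trig_approx f -> trig_approx g -> trig_approx (fun x => f x + g x).
Proof.
move=> af ag e e0; have [h th fh] := af (e / 2) (half0 e0).
have [k tk gk] := ag (e / 2) (half0 e0).
exists (fun x => h x + k x); first exact: trig_polyD.
by move=> x; rewrite opprD addrACA (le_trans (ler_normD _ _))// [leRHS](splitr e) lerD.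
Qed.

Lemma trig_approxM f g : trig_approx f -> trig_approx g -> trig_approx (fun x => f x * g x).
Proof.
move=> af ag e e0.
have [M M0 fM] := trig_approx_bounded af.
have M1 : 0 < M + 1 by rewrite ltr_wpDl.
have [k tk gk] := ag (e / 2 / (M + 1)) (divr_gt0 (half0 e0) M1).
have [N N0 kN] := trig_poly_bounded tk.
have N1 : 0 < N + 1 by rewrite ltr_wpDl.
have [h th fh] := af (e / 2 / (N + 1)) (divr_gt0 (half0 e0) N1).
exists (fun x => h x * k x); first exact: trig_polyM.
move=> x; have -> : f x * g x - h x * k x = f x * (g x - k x) + (f x - h x) * k x by ring.
rewrite (le_trans (ler_normD _ _))// [leRHS](splitr e) !normrM lerD//.
  have -> : e / 2 = (M + 1) * (e / 2 / (M + 1)) by field; rewrite gt_eqF.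
  by rewrite ler_pM// (le_trans (fM x))// lerDl.
have -> : e / 2 = e / 2 / (N + 1) * (N + 1) by field; rewrite gt_eqF.
by rewrite ler_pM// (le_trans (kN x))// lerDl.
Qed.

Lemma trig_approx_cst c : trig_approx (fun=> c).
Proof. exact/trig_approx_poly/trig_poly_cst. Qed.

(* The classical recursion q <- q + (t^2 - q^2)/2 for |t| on [-1, 1]. *)
Fixpoint sqrt_iter (n : nat) (t : R) : R :=
  if n is n'.+1 then sqrt_iter n' t + (t ^+ 2 - sqrt_iter n' t ^+ 2) / 2 else 0.

(** If [u] is the remaining gap, one step turns it into [u (1 - (|t| + q) / 2) <= u (1 - u / 2)], a
    recursion that decays like [2 / n]. *)
Lemma sqrt_iterP n (t : R) : `|t| <= 1 ->
  0 <= sqrt_iter n t <= `|t| /\ (`|t| - sqrt_iter n t) * n.+1%:R <= 2.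
Proof.
move=> t1.
have h k : sqrt_iter k t = sqrt_iter k `|t| by elim: k => //= k ->; rewrite real_normK ?num_real.
rewrite h; have := normr_ge0 t; move: `|t| t1 => {h}t t1 t0.
elim: n => [|n [/andP[q0 qt] ih]] /=.
  by split; [rewrite lexx|rewrite subr0 mulr1; lra].
set q := sqrt_iter n t in q0 qt ih *.
split; first by apply/andP; split; nra.
have -> : t - (q + (t ^+ 2 - q ^+ 2) / 2) = (t - q) * (1 - (t + q) / 2) by field.
have ub : (t - q) * (1 - (t + q) / 2) <= (t - q) * (1 - (t - q) / 2).
  by rewrite ler_wpM2l ?subr_ge0//; lra.
apply: (@le_trans _ _ ((t - q) * (1 - (t - q) / 2) * n.+2%:R)).
  by rewrite ler_wpM2r.
move: ih; set u := t - q => ih.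
have u0 : 0 <= u by rewrite subr_ge0.
have u1 : u <= 1 by rewrite /u; lra.
rewrite -[n.+2%:R]natr1; have : (1 : R) <= n.+1%:R by rewrite ler1n.
move: (n.+1%:R : R) ih => N ih N1.
have -> : u * (1 - u / 2) * (N + 1) = u * N * (1 - u / 2) + u - u ^+ 2 / 2 by field.
have : 0 <= (2 - u * N) * (1 - u / 2) by rewrite mulr_ge0//; lra.
have := sqr_ge0 u; move: (u * N) => a; lra.
Qed.

(** After rescaling into [[-1, 1]], the absolute value is a uniform limit of the polynomials
    [sqrt_iter n], and the class is a uniformly closed algebra. Minima become available from
    here. *)
Lemma trig_approx_norm f : trig_approx f -> trig_approx (fun x => `|f x|).
Proof.
move=> af; have [M M0 fM] := trig_approx_bounded af.
have M1 : 0 < M + 1 by rewrite ltr_wpDl.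
pose g x := (M + 1)^-1 * f x.
have ag : trig_approx g by apply: trig_approxM => //; exact: trig_approx_cst.
have g1 x : `|g x| <= 1.
  by rewrite normrM gtr0_norm ?invr_gt0// ler_pdivrMl// mulr1 (le_trans (fM x))// lerDl.
suff an : trig_approx (fun x => `|g x|).
  have -> : (fun x => `|f x|) = (fun x => (M + 1) * `|g x|).
    by apply/funext => x; rewrite /g normrM gtr0_norm ?invr_gt0// mulrA divff ?mul1r// gt_eqF.
  by apply: trig_approxM => //; exact: trig_approx_cst.
apply: trig_approx_lim => e e0.
have aq n : trig_approx (fun x => sqrt_iter n (g x)).
  elim: n => [|n ih] /=; first exact: trig_approx_cst.
  apply: trig_approxD => //.
  have -> : (fun x => (g x ^+ 2 - sqrt_iter n (g x) ^+ 2) / 2) =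
     (fun x => 2^-1 * (g x * g x + (-1) * (sqrt_iter n (g x) * sqrt_iter n (g x)))).
    by apply/funext => x; field.
  apply: trig_approxM; first exact: trig_approx_cst.
  apply: trig_approxD; first exact: trig_approxM.
  by apply: trig_approxM; [exact: trig_approx_cst|exact: trig_approxM].
pose n := Num.truncn (2 / e).
exists (fun x => sqrt_iter n (g x)) => // x.
have [/andP[q0 qt] h] := sqrt_iterP n (g1 x).
rewrite ger0_norm ?subr_ge0// -(ler_pM2r (ltr0Sn R n)) (le_trans h)//.
rewrite mulrC -ler_pdivrMr// ltW//; exact: truncnS_gt.
Qed.

Lemma trig_approx_min f g : trig_approx f -> trig_approx g ->
  trig_approx (fun x => Num.min (f x) (g x)).
Proof.
move=> af ag.
have -> : (fun x => Num.min (f x) (g x)) =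
  (fun x => 2^-1 * (f x + g x + (-1) * `|f x + (-1) * g x|)).
  apply/funext => x; by rewrite minr_absE !mulN1r mulrC.
apply: trig_approxM; first exact: trig_approx_cst.
apply: trig_approxD; first exact: trig_approxD.
apply: trig_approxM; first exact: trig_approx_cst.
apply: trig_approx_norm; apply: trig_approxD => //.
by apply: trig_approxM => //; exact: trig_approx_cst.
Qed.

Lemma trig_approx_bigmin (I : Type) (s : seq I) (h : I -> (K -> R) -> R) (M : R) :
  (forall i, trig_approx (h i)) -> trig_approx (fun x => \big[Num.min/M]_(i <- s) h i x).
Proof.
move=> ah; elim: s => [|i s ih].
  by under eq_fun do rewrite big_nil; exact: trig_approx_cst.
by under eq_fun do rewrite big_cons; exact: trig_approx_min.
Qed.

Lemma trig_approx_sum (I : Type) (s : seq I) (h : I -> (K -> R) -> R) :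
  (forall i, trig_approx (h i)) -> trig_approx (fun x => \sum_(i <- s) h i x).
Proof.
move=> ah; elim: s => [|i s ih].
  by under eq_fun do rewrite big_nil; exact: trig_approx_cst.
by under eq_fun do rewrite big_cons; exact: trig_approxD.
Qed.

Lemma trig_approx_sin (i : K) (k c : R) : trig_approx (fun x => `|sin (k * (x i - c))|).
Proof.
apply: trig_approx_norm; apply: trig_approx_poly.
have -> : (fun x : K -> R => sin (k * (x i - c))) =
  (fun x => cos (\sum_j (if j == i then k else 0) * x j + (- (k * c) - pi / 2))).
  apply/funext => x; rewrite (bigD1 i)//= eqxx big1 ?addr0; last first.
    by move=> j /negbTE ->; rewrite mul0r.
  by rewrite addrA cosBpihalf mulrBr.
exact: trig_poly_cos.
Qed.

(** A periodic surrogate for the distance. For points of the cube the argument of the sine stays in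
    [[-1, 1]], where [|t| / 2 <= |sin t| <= |t|]. *)
Lemma sin_dist_bounds (B u v : R) : 0 < B -> `|u| <= B -> `|v| <= B ->
  `|u - v| <= 4 * B * `|sin ((2 * B)^-1 * (u - v))| <= 2 * `|u - v|.
Proof.
move=> B0 uB vB.
have [t tE] : exists t, t = (2 * B)^-1 * (u - v) by eexists.
have uvE : u - v = 2 * B * t by rewrite tE mulrA divff ?mul1r// mulf_neq0// gt_eqF.
have t1 : `|t| <= 1.
  have : `|u - v| <= 2 * B by rewrite (le_trans (ler_normB _ _))// mulr2n mulrDl mul1r lerD.
  by rewrite uvE normrM gtr0_norm ?mulr_gt0// ger_pMr ?mulr_gt0.
rewrite -tE uvE normrM (@gtr0_norm _ (2 * B)) ?mulr_gt0//.
have h : `|t| <= 2 * `|sin t|.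
  wlog t0 : t {tE uvE} t1 / 0 <= t.
    move=> h; have [/h -> //|/ltW] := leP 0 t.
    by rewrite -oppr_ge0 => t0; rewrite -normrN -[X in _ * X]normrN -sinN h ?normrN.
  have := sin_lb t0; have := ler_norm (sin t); rewrite ger0_norm// in t1 *.
  have : t ^+ 3 <= t by rewrite -[leRHS]mulr1 exprS ler_wpM2l// exprn_ile1.
  lra.
have := abs_sin_le t; nra.
Qed.

Lemma grid_point (B : R) (n : nat) (u : R) : 0 < B -> (0 < n)%N -> `|u| <= B ->
  exists k : 'I_n.+1, `|u - (2 * B * k%:R / n%:R - B)| <= 2 * B / n%:R /\
     `|2 * B * k%:R / n%:R - B| <= B.
Proof.
move=> B0 n0; rewrite ler_norml => /andP[u1 u2].
have n0' : 0 < (n%:R : R) by rewrite ltr0n.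
pose y := (u + B) * n%:R / (2 * B).
have B2 : 0 < 2 * B by rewrite mulr_gt0.
have y0 : 0 <= y by apply: divr_ge0; [apply: mulr_ge0; [lra|exact: ltW]|exact: ltW].
have yn : y <= n%:R.
  by rewrite /y ler_pdivrMr// [leRHS]mulrC ler_pM2r//; lra.
have yE : u = 2 * B * y / n%:R - B by rewrite /y; field; rewrite ?gt_eqF.
have /andP[k1 k2] := truncn_itv y0.
have kn : (Num.truncn y < n.+1)%N.
  by rewrite ltnS -(ler_nat R) (le_trans k1).
exists (Ordinal kn) => /=; rewrite [X in `|X - _|]yE.
move: (Num.truncn y) k1 k2 kn => k k1 k2 kn.
have kn' : (k%:R : R) <= n%:R by rewrite ler_nat.
split.
  have -> : 2 * B * y / n%:R - B - (2 * B * k%:R / n%:R - B) = (2 * B / n%:R) * (y - k%:R) by field; rewrite gt_eqF.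
  rewrite normrM gtr0_norm ?divr_gt0// ger_pMr ?divr_gt0// ger0_norm ?subr_ge0//.
  by rewrite -natr1 in k2; lra.
have h : 0 <= 2 * B * k%:R / n%:R <= 2 * B.
  rewrite divr_ge0 ?mulr_ge0// ?(ltW B0)//= ler_pdivrMr// ler_wpM2l// ltW//.
by rewrite ler_norml; lra.
Qed.

(** McShane's construction on a finite grid: [G] is the minimum, capped at [M], of
    [F g + L dist(x, g)] over grid points [g], with the surrogate of [sin_dist_bounds] as distance.
    In the cube the surrogate dominates the distance, so [F <= G]; a close grid point gives the
    reverse up to the mesh. Outside the cube only the bound by [M] survives. *)
Lemma trig_approx_lipschitz (F : (K -> R) -> R) (M L B e : R) : 0 < B -> 0 < e -> 0 <= L ->
  (forall x, 0 <= F x <= M) ->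
  (forall x y, F x - F y <= L * \sum_i `|x i - y i|) ->
  exists G, [/\ trig_approx G, (forall x, `|G x| <= M) &
    forall x, (forall i, `|x i| <= B) -> `|F x - G x| <= e].
Proof.
move=> B0 e0 L0 F0M FL.
pose N : R := #|K|%:R.
(* At a grid point within the mesh [2 B / n], the Lipschitz bound costs [L] and the surrogate [2 L]
   per unit of distance, summed over [N] coordinates: [C / n] in all. *)
pose C := L * N * 6 * B.
have C0 : 0 <= C by rewrite !mulr_ge0// ltW.
pose n := (Num.truncn (C / e)).+1.
have n0 : (0 < n)%N by [].
have n0' : 0 < (n%:R : R) by rewrite ltr0n.
have Cn : C / n%:R <= e.
  by rewrite ler_pdivrMr// -ler_pdivrMl// mulrC ltW//; exact: truncnS_gt.
pose pt (g : {ffun K -> 'I_n.+1}) (i : K) : R := 2 * B * (g i)%:R / n%:R - B.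
pose s := [seq g <- enum [the finType of {ffun K -> 'I_n.+1}] | [forall i, `|pt g i| <= B]].
pose h (g : {ffun K -> 'I_n.+1}) (x : K -> R) := F (pt g) + L * \sum_i 4 * B * `|sin ((2 * B)^-1 * (x i - pt g i))|.
pose G x := \big[Num.min/M]_(g <- s) h g x.
have h0 (g : {ffun K -> 'I_n.+1}) x : 0 <= h g x.
  rewrite /h addr_ge0//; first by have /andP[] := F0M (pt g).
  by rewrite mulr_ge0// sumr_ge0// => i _; rewrite !mulr_ge0// ltW.
have M0 : 0 <= M by have /andP[/le_trans] := F0M (fun=> 0); apply.
have lbG x c : c <= M -> (forall g : {ffun K -> 'I_n.+1}, g \in s -> c <= h g x) -> c <= G x by exact: bigmin_lb.
have ubG x (g : {ffun K -> 'I_n.+1}) : g \in s -> G x <= h g x.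
  exact: (@bigmin_ub _ _ s (h ^~ x)).
have GM x : G x <= M by exact: bigmin_idx.
exists G; split.
- apply: trig_approx_bigmin => g; apply: trig_approxD; first exact: trig_approx_cst.
  apply: trig_approxM; first exact: trig_approx_cst.
  apply: trig_approx_sum => i; apply: trig_approxM; first exact: trig_approx_cst.
  exact: trig_approx_sin.
- by move=> x; rewrite ger0_norm// lbG// => g _; exact: h0.
- move=> x xB.
  have FG : F x <= G x.
    apply: lbG; first by have /andP[] := F0M x.
    move=> g; rewrite mem_filter => /andP[/forallP gB _].
    rewrite -lerBlDl (le_trans (FL _ _))// ler_wpM2l//; apply: ler_sum => i _.
    by have /andP[] := sin_dist_bounds B0 (xB i) (gB i).
  rewrite distrC ger0_norm ?subr_ge0//.
  have [g gP] : exists g : {ffun K -> 'I_n.+1}, forall i, `|x i - pt g i| <= 2 * B / n%:R /\ `|pt g i| <= B.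
    have /choice[g gP] := fun i => grid_point B0 n0 (xB i).
    by exists [ffun i => g i] => i; rewrite /pt ffunE; exact: gP.
  have gs : g \in s.
    by rewrite mem_filter mem_enum andbT; apply/forallP => i; have [] := gP i.
  rewrite lerBlDl (le_trans (ubG _ _ gs))// /h.
  have S : \sum_i `|x i - pt g i| <= N * (2 * B / n%:R).
    apply: (@le_trans _ _ (\sum_(i : K) (2 * B / n%:R))).
      by apply: ler_sum => i _; have [] := gP i.
    by rewrite sumr_const -[leLHS]mulr_natl.
  have S2 : \sum_i 4 * B * `|sin ((2 * B)^-1 * (x i - pt g i))| <= 2 * \sum_i `|x i - pt g i|.
    rewrite mulr_sumr; apply: ler_sum => i _.
    by have [_ giB] := gP i; have /andP[] := sin_dist_bounds B0 (xB i) giB.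
  have S3 := FL (pt g) x.
  have S4 : \sum_i `|pt g i - x i| = \sum_i `|x i - pt g i|.
    by apply: eq_bigr => i _; rewrite distrC.
  rewrite S4 in S3.
  apply: le_trans (_ : F x + L * (3 * \sum_i `|x i - pt g i|) <= _).
    rewrite -lerBlDl.
    have := ler_wpM2l L0 S2; set a := \sum_i _ in S3 *; set b := \sum_i _; move=> ?.
    lra.
  rewrite lerD2l; apply: le_trans Cn.
  have -> : C / n%:R = L * (3 * (N * (2 * B / n%:R))) by rewrite /C; field; rewrite gt_eqF.
  by rewrite !ler_wpM2l.
Qed.

End TrigApproximation.

(** * Convergence of expectations from convergence of cosine transforms *)

Section Levy.
Context {R : realType} {d : measure_display} {T : measurableType d}.
Variable P : probability T R.
Context {K : finType}.
Implicit Types (Y : T -> K -> R).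

Definition coord_measurable Y := forall i, measurable_fun setT (fun w => Y w i).

Definition outside (B : R) (y : K -> R) : R := (~~ [forall i, `|y i| <= B])%:R.

Lemma coord_measurable_sum Y (a : K -> R) (b : R) : coord_measurable Y ->
  measurable_fun setT (fun w => \sum_i a i * Y w i + b).
Proof.
move=> mY; apply: measurable_funD => //; apply: measurable_sum => i.
exact: measurable_funM.
Qed.

Lemma measurable_fun_approx (f : T -> R) : (forall e : R, 0 < e ->
  exists2 g : T -> R, measurable_fun setT g & forall w, `|f w - g w| <= e) -> measurable_fun setT f.
Proof.
move=> h.
have /choice[g gP] : forall n : nat, exists g : T -> R, measurable_fun setT g /\ forall w, `|f w - g w| <= n.+1%:R^-1.
  by move=> n; have [|g mg fg] := h n.+1%:R^-1; [rewrite invr_gt0|exists g].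
apply: (@measurable_fun_cvg _ _ _ _ g); first by move=> n; have [] := gP n.
move=> w _; apply/cvgrPdist_le => e e0.
near=> n; have [_ /(_ w)] := gP n; move=> /le_trans; apply.
apply: ltW; near: n; exact: (near_infty_natSinv_lt (PosNum e0)).
Unshelve. all: by end_near.
Qed.

Lemma measurable_trig_poly (f : (K -> R) -> R) Y : coord_measurable Y ->
  trig_poly f -> measurable_fun setT (fun w => f (Y w)).
Proof.
move=> mY [l fl]; under eq_fun do rewrite fl.
apply: measurable_sum => p; apply: measurable_funM => //.
by apply: measurable_cosT; exact: coord_measurable_sum.
Qed.

Lemma measurable_trig_approx (f : (K -> R) -> R) Y : coord_measurable Y ->
  trig_approx f -> measurable_fun setT (fun w => f (Y w)).
Proof.
move=> mY af; apply: measurable_fun_approx => e e0; have [g tg fg] := af e e0.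
by exists (fun w => g (Y w)); [exact: measurable_trig_poly|move=> w; exact: fg].
Qed.

Lemma measurable_outside (B : R) Y : coord_measurable Y ->
  measurable_fun setT (fun w => outside B (Y w)).
Proof.
move=> mY.
have -> : (fun w => outside B (Y w)) = \1_(~` \bigcap_(i in [set: K]) [set w | `|Y w i| <= B]).
  apply/funext => w; rewrite /outside indicE; congr (nat_of_bool _)%:R.
  apply/idP/idP; first by move=> /forallPn[i /negP iB]; rewrite inE/= => /(_ i Logic.I).
  by rewrite inE/= => h; apply/negP => /forallP h2; apply: h => i _; exact: h2.
apply: measurable_indic; apply: measurableC; apply: fin_bigcap_measurable; first exact: finite_finset.
move=> i _; rewrite -[X in measurable X]setTI.
apply: (measurable_fun_ler _ _) => //; exact: measurableT_comp.
Qed.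

(** Only the coordinates of [Y] are assumed measurable. The approximants of [F] on the cubes of
    radius [n + 1] are measurable along [Y] and converge pointwise, since each outcome eventually
    lies in the cube. *)
Lemma measurable_lipschitz (F : (K -> R) -> R) (M L : R) Y : coord_measurable Y -> 0 <= L ->
  (forall x, 0 <= F x <= M) -> (forall x y, F x - F y <= L * \sum_i `|x i - y i|) ->
  measurable_fun setT (fun w => F (Y w)).
Proof.
move=> mY L0 FM FL.
have /choice[G GP] : forall n : nat, exists G : (K -> R) -> R, [/\ trig_approx G, (forall x, `|G x| <= M) &
    forall x, (forall i, `|x i| <= n.+1%:R) -> `|F x - G x| <= n.+1%:R^-1].
  by move=> n; apply: trig_approx_lipschitz FL; rewrite ?invr_gt0.
apply: (@measurable_fun_cvg _ _ _ _ (fun n w => G n (Y w))).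
  by move=> n; have [aG _ _] := GP n; exact: measurable_trig_approx.
move=> w _; apply/cvgrPdist_le => e e0.
have [B BP] : exists B : R, forall i, `|Y w i| <= B.
  exists (\sum_i `|Y w i|) => i; rewrite (bigD1 i)//= lerDl; exact: sumr_ge0.
near=> n; have [_ _ /(_ (Y w))] := GP n.
have Bn : B <= n.+1%:R.
  by rewrite -natr1 (@le_trans _ _ n%:R) ?lerDl//; near: n; exact: nbhs_infty_ger.
move=> h; apply: le_trans (h _) _; first by move=> i; exact: le_trans (BP i) Bn.
apply: ltW; near: n; exact: (near_infty_natSinv_lt (PosNum e0)).
Unshelve. all: by end_near.
Qed.

Lemma levy_approx (Y : nat -> T -> K -> R) (Z : T -> K -> R) (f : (K -> R) -> R) :
  (forall r, coord_measurable (Y r)) -> coord_measurable Z ->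
  (forall a b, Ex P (fun w => cos (\sum_i a i * Y r w i + b)) @[r --> \oo] -->
     Ex P (fun w => cos (\sum_i a i * Z w i + b))) ->
  trig_approx f -> Ex P (fun w => f (Y r w)) @[r --> \oo] --> Ex P (fun w => f (Z w)).
Proof.
move=> mY mZ YZ af.
have tp g : trig_poly g -> Ex P (fun w => g (Y r w)) @[r --> \oo] --> Ex P (fun w => g (Z w)).
  move=> [l gl].
  have E X : coord_measurable X -> Ex P (fun w => g (X w)) =
      \sum_(p <- l) p.1.1 * Ex P (fun w => cos (\sum_i p.1.2 i * X w i + p.2)).
    move=> mX; under eq_fun do rewrite gl.
    rewrite Ex_sum; last first.
      by move=> p; apply: integrZ; apply: integr_cos; exact: coord_measurable_sum.
    by apply: eq_bigr => p _; rewrite ExZ//; apply: integr_cos; exact: coord_measurable_sum.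
  rewrite E// (_ : (fun r => _) = (fun r => \sum_(p <- l) p.1.1 *
    Ex P (fun w => cos (\sum_i p.1.2 i * Y r w i + p.2)))); last by apply/funext => r; exact: E.
  apply: cvg_big; first exact: add_continuous.
  by move=> p _; apply: cvgM; [exact: cvg_cst|exact: YZ].
apply/cvgrPdist_le => e e0.
have e3 : 0 < e / 3 by rewrite divr_gt0.
have [g tg fg] := af _ e3.
have [M M0 gM] := trig_poly_bounded tg.
have [N N0 fN] := trig_approx_bounded af.
have ig X : coord_measurable X -> integr P (fun w => g (X w)).
  by move=> mX; apply: (@integr_bd _ _ _ P _ M) => //; exact: measurable_trig_poly.
have iF X : coord_measurable X -> integr P (fun w => f (X w)).
  by move=> mX; apply: (@integr_bd _ _ _ P _ N) => //; exact: measurable_trig_approx.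
have D X : coord_measurable X -> `|Ex P (fun w => f (X w)) - Ex P (fun w => g (X w))| <= e / 3.
  by move=> mX; apply: Ex_normB => //; [exact: iF|exact: ig].
have /cvgrPdist_le/(_ _ e3) := tp _ tg.
apply: filterS => r.
have := D _ (mY r); have := D _ mZ.
rewrite !ler_norml => /andP[? ?] /andP[? ?] /andP[? ?]; apply/andP; split; lra.
Qed.

(* Levy's continuity theorem for bounded Lipschitz test functions; tightness is
   assumed, so that trigonometric polynomials suffice on a large cube. *)
Theorem levy_lipschitz (Y : nat -> T -> K -> R) (Z : T -> K -> R) (F : (K -> R) -> R) (M L : R) :
  (forall r, coord_measurable (Y r)) -> coord_measurable Z ->
  (forall a b, Ex P (fun w => cos (\sum_i a i * Y r w i + b)) @[r --> \oo] -->
     Ex P (fun w => cos (\sum_i a i * Z w i + b))) ->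
  (forall e : R, 0 < e -> exists B : R, [/\ 0 < B, Ex P (fun w => outside B (Z w)) <= e &
     \forall r \near \oo, Ex P (fun w => outside B (Y r w)) <= e]) ->
  0 <= L -> (forall x, 0 <= F x <= M) ->
  (forall x y, F x - F y <= L * \sum_i `|x i - y i|) ->
  Ex P (fun w => F (Y r w)) @[r --> \oo] --> Ex P (fun w => F (Z w)).
Proof.
move=> mY mZ YZ tight L0 FM FL.
have M0 : 0 <= M by have /andP[/le_trans] := FM (fun=> 0); apply.
apply/cvgrPdist_le => e e0.
(* Replacing [F] by [G] costs [q + 2 M q] on each side and the limit for [G] costs another [q];
   together at most [e]. *)
pose q := e / (4 * (2 * M + 1) + 1).
have q0 : 0 < q by rewrite divr_gt0// ltr_wpDl// mulr_ge0// addr_ge0// mulr_ge0.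
have qe : (4 * (2 * M + 1) + 1) * q = e.
  rewrite /q mulrC divfK// gt_eqF// ltr_wpDl// mulr_ge0// addr_ge0// mulr_ge0//.
have [B [B0 ZB YB]] := tight q q0.
have [G [aG GM FG]] := trig_approx_lipschitz B0 q0 L0 FM FL.
have mF X : coord_measurable X -> measurable_fun setT (fun w => F (X w)).
  by move=> mX; exact: measurable_lipschitz FM FL.
have FM' x : `|F x| <= M by have /andP[? ?] := FM x; rewrite ger0_norm.
have iF X : coord_measurable X -> integr P (fun w => F (X w)).
  by move=> mX; apply: (@integr_bd _ _ _ P _ M) => //; exact: mF.
have iG X : coord_measurable X -> integr P (fun w => G (X w)).
  by move=> mX; apply: (@integr_bd _ _ _ P _ M) => //; exact: measurable_trig_approx.
have io X : coord_measurable X -> integr P (fun w => outside B (X w)).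
  move=> mX; apply: (@integr_bd _ _ _ P _ 1); first exact: measurable_outside.
  by move=> w; rewrite /outside; case: (~~ _); rewrite ?normr0 ?normr1.
have D X : coord_measurable X -> Ex P (fun w => outside B (X w)) <= q ->
    `|Ex P (fun w => F (X w)) - Ex P (fun w => G (X w))| <= q + 2 * M * q.
  move=> mX Xq; rewrite -ExB; [|exact: iF|exact: iG].
  apply: (@le_trans _ _ (Ex P (fun w => q + 2 * M * outside B (X w)))).
    apply: Ex_norm_le.
    - by apply: integrB; [exact: iF|exact: iG].
    - by apply: integrD; [exact: integr_cst|apply: integrZ; exact: io].
    - move=> w; rewrite /outside; case: (boolP [forall i, _]) => [/forallP h|_] /=.
        by rewrite mulr0 addr0 FG.
      rewrite mulr1 (le_trans (ler_normB _ _))// ler_wpDl ?(ltW q0)// mulr2n mulrDl mul1r.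
      exact: lerD.
  rewrite ExD; [|exact: integr_cst|by apply: integrZ; exact: io].
  rewrite Ex_cst ExZ; last exact: io.
  by rewrite lerD2l ler_wpM2l// mulr_ge0.
have /cvgrPdist_le/(_ _ q0) cG := levy_approx mY mZ YZ aG.
near=> r.
have YrB : Ex P (fun w => outside B (Y r w)) <= q by near: r.
have : `|Ex P (fun w => G (Z w)) - Ex P (fun w => G (Y r w))| <= q by near: r.
have := D _ (mY r) YrB; have := D _ mZ ZB.
rewrite !ler_norml => /andP[? ?] /andP[? ?] /andP[? ?].
have : 0 <= M * q by rewrite mulr_ge0// ltW.
move=> ?; apply/andP; split; lra.
Unshelve. all: by end_near.
Qed.

End Levy.

(** * Oscillations of random walks *)

Section SubSigmaAlgebra.
Context {R : realType} {d : measure_display} {T : measurableType d}.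
Implicit Types (G H : set_system T) (f g : T -> R).

(** The domain is given the generated sigma-algebra as its own structure, so that the usual closure
    properties of measurable functions apply verbatim. *)
Definition gmeas G f := measurable_fun (setT : set (g_sigma_algebraType G))
  (f : g_sigma_algebraType G -> R).

Lemma gmeas_preimage G f B : gmeas G f -> measurable B -> <<s G >> (f @^-1` B).
Proof.
move=> mf mB; have := mf measurableT B mB; rewrite setTI; exact.
Qed.

Lemma gmeas_gen G f : preimage_set_system setT f measurable `<=` G -> gmeas G f.
Proof.
move=> fG _ B mB; apply: sub_sigma_algebra.
by apply: fG; exists B.
Qed.

Lemma gmeasS G H f : <<s G >> `<=` <<s H >> -> gmeas G f -> gmeas H f.
Proof.
move=> GH mf _ B mB; rewrite setTI.
by apply: GH; exact: gmeas_preimage.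
Qed.

Lemma gmeas_measurable G f : G `<=` measurable -> gmeas G f -> measurable_fun setT f.
Proof.
move=> Gm mf _ B mB; rewrite setTI.
have := gmeas_preimage mf mB; apply: smallest_sub => //; exact: sigma_algebra_measurable.
Qed.

Lemma gmeas_cst G (c : R) : gmeas G (fun=> c).
Proof. exact: measurable_cst. Qed.

Lemma gmeasD G f g : gmeas G f -> gmeas G g -> gmeas G (fun w => f w + g w).
Proof. by move=> mf mg; exact: measurable_funD. Qed.

Lemma gmeasM G f g : gmeas G f -> gmeas G g -> gmeas G (fun w => f w * g w).
Proof. by move=> mf mg; exact: measurable_funM. Qed.

Lemma gmeasX G f n : gmeas G f -> gmeas G (fun w => f w ^+ n).
Proof. by move=> mf; exact: measurable_funX. Qed.

Lemma gmeas_comp G f (h : R -> R) : measurable_fun setT h -> gmeas G f -> gmeas G (h \o f).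
Proof. by move=> mh mf; exact: measurableT_comp. Qed.

Lemma gmeas_sum G (I : Type) (s : seq I) (f : I -> T -> R) :
  (forall i, gmeas G (f i)) -> gmeas G (fun w => \sum_(i <- s) f i w).
Proof. by move=> mf; exact: measurable_sum. Qed.

End SubSigmaAlgebra.

Section CenteredWalk.
Context {R : realType} {d : measure_display} {T : measurableType d}.
Variable P : probability T R.

(* An i.i.d. centered sequence, through the properties of it that are used:
   [G n] plays the role of the sigma-algebra of the first n variables. *)
Record centered_walk (x : nat -> T -> R) (G : nat -> set_system T) (s2 M : R) : Prop := CenteredWalk {
  cw_sub : forall n, G n `<=` measurable ;
  cw_meas : forall i n, (i < n)%N -> gmeas (G n) (x i) ;
  cw_indep : forall n f, gmeas (G n) f -> rv_indep P f (x n) ;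
  cw_int : forall n, integr P (fun w => x n w ^+ 4) ;
  cw_mean : forall n, Ex P (x n) = 0 ;
  cw_var : forall n, Ex P (fun w => x n w ^+ 2) = s2 ;
  cw_fourth : forall n, Ex P (fun w => x n w ^+ 4) <= M }.

Lemma centered_walk_shift x G s2 M p : centered_walk x G s2 M ->
  centered_walk (fun n => x (p + n)%N) (fun n => G (p + n)%N) s2 M.
Proof.
move=> [c1 c2 c3 c4 c5 c6 c7].
split=> [n|i n ni|n f|n|n|n|n]; [exact: c1|by apply: c2; rewrite ltn_add2l|exact: c3|exact: c4|exact: c5|exact: c6|exact: c7].
Qed.

Variables (x : nat -> T -> R) (G : nat -> set_system T) (s2 M : R).
Hypothesis cw : centered_walk x G s2 M.
Let S n w := partial_sum (fun k => x k w) n.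

Let SS n w : S n.+1 w = S n w + x n w.
Proof. by rewrite /S /partial_sum big_ord_recr. Qed.

Let SSf n : S n.+1 = fun w => S n w + x n w.
Proof. by apply/funext => w; exact: SS. Qed.

Let S0f : S 0 = fun=> 0.
Proof. by apply/funext => w; rewrite /S /partial_sum big_ord0. Qed.

Let mx n : measurable_fun setT (x n).
Proof. exact: gmeas_measurable (cw_sub cw (n := n.+1)) (cw_meas cw (ltnSn n)). Qed.

Let gS m n : (m <= n)%N -> gmeas (G n) (S m).
Proof.
elim: m => [|m ih] mn.
  by rewrite S0f; exact: gmeas_cst.
rewrite SSf; apply: gmeasD; first by apply: ih; exact: ltnW.
exact: (cw_meas cw mn).
Qed.

Let mS n : measurable_fun setT (S n).
Proof. exact: gmeas_measurable (cw_sub cw (n := n)) (gS (leqnn n)). Qed.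

Let pow4 (y : R) : [/\ `|y| <= 1 + y ^+ 4, y ^+ 2 <= 1 + y ^+ 4, `|y| ^+ 3 <= 1 + y ^+ 4 & 0 <= y ^+ 4].
Proof.
have -> : y ^+ 4 = `|y| ^+ 4 by rewrite -normrX ger0_norm// -[4%N]/(2 * 2)%N exprM sqr_ge0.
rewrite -[y ^+ 2]real_normK ?num_real//; have := normr_ge0 y; move: `|y| => {}y y0.
have h4 := exprn_ge0 4 y0.
have [y1|y1] := leP y 1.
  have h2 := exprn_ile1 2 y0 y1; have h3 := exprn_ile1 3 y0 y1.
  by split; lra.
have h2 : y ^+ 2 <= y ^+ 4 by rewrite ler_weXn2l// ltW.
have h3 : y ^+ 3 <= y ^+ 4 by rewrite ler_weXn2l// ltW.
have h1 : y <= y ^+ 4 by rewrite -[leLHS]expr1 ler_weXn2l// ltW.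
by split; lra.
Qed.

Let int_pow (f : T -> R) : measurable_fun setT f -> integr P (fun w => f w ^+ 4) ->
  [/\ integr P f, integr P (fun w => f w ^+ 2) & integr P (fun w => f w ^+ 3)].
Proof.
move=> mf f4.
have h : integr P (fun w => 1 + f w ^+ 4) by apply: integrD => //; exact: integr_cst.
split; apply: integr_le h => //.
- by move=> w; have [] := pow4 (f w).
- exact: measurable_funX.
- by move=> w; rewrite ger0_norm ?sqr_ge0//; have [] := pow4 (f w).
- exact: measurable_funX.
- by move=> w; rewrite normrX; have [] := pow4 (f w).
Qed.

Let int_x n : [/\ integr P (x n), integr P (fun w => x n w ^+ 2) & integr P (fun w => x n w ^+ 3)].
Proof. by apply: int_pow => //; exact: (cw_int cw n). Qed.

Let s2_ge0 : 0 <= s2.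
Proof. by rewrite -(cw_var cw 0%N); apply: Ex_ge0 => w; exact: sqr_ge0. Qed.

Let M_ge0 : 0 <= M.
Proof.
apply: le_trans (cw_fourth cw 0%N); apply: Ex_ge0 => w.
by have [] := pow4 (x 0%N w).
Qed.

Let rvX (f g : T -> R) (i j : nat) : rv_indep P f g -> rv_indep P (fun w => f w ^+ i) (fun w => g w ^+ j).
Proof. by move=> fg; exact: (rv_indep_comp (exprn_measurable (D:=setT) i) (exprn_measurable (D:=setT) j) fg). Qed.

(** In the expansion of [(S + x)^4] the term in [S^3 x] vanishes because [x] has mean zero and the
    term in [S x^3] because [S] has. What is left adds at most [6 n s2^2 + M] per step, hence
    quadratic growth. *)
Let walk_moments n : [/\ integr P (fun w => S n w ^+ 4), Ex P (S n) = 0,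
  Ex P (fun w => S n w ^+ 2) = n%:R * s2 & Ex P (fun w => S n w ^+ 4) <= (3 * s2 ^+ 2 + M) * n%:R ^+ 2].
Proof.
elim: n => [|n [iS4 ES ES2 ES4]].
  have S0 p : (fun w => S 0 w ^+ p.+1) = fun=> 0 by apply/funext => w; rewrite S0f expr0n.
  rewrite !S0 S0f !Ex_cst mul0r expr0n mulr0; split => //; exact: integr_cst.
have [iS iS2 iS3] := int_pow (mS n) iS4.
have [ix ix2 ix3] := int_x n.
have ix4 := cw_int cw n.
have ind := cw_indep cw (gS (leqnn n)).
have [i11 e11] := Ex_indep iS ix ind.
have [i31 e31] := Ex_indep iS3 ix (rvX 3 1 ind).
have [i22 e22] := Ex_indep iS2 ix2 (rvX 2 2 ind).
have [i13 e13] := Ex_indep iS ix3 (rvX 1 3 ind).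
have E4 w : S n.+1 w ^+ 4 = S n w ^+ 4 + (4 * (S n w ^+ 3 * x n w) + (6 * (S n w ^+ 2 * x n w ^+ 2) +
   (4 * (S n w * x n w ^+ 3) + x n w ^+ 4))) by rewrite SS; ring.
have E2 w : S n.+1 w ^+ 2 = S n w ^+ 2 + (2 * (S n w * x n w) + x n w ^+ 2) by rewrite SS; ring.
have i4 : integr P (fun w => 4 * (S n w * x n w ^+ 3) + x n w ^+ 4) by apply: integrD => //; exact: integrZ.
have i3 : integr P (fun w => 6 * (S n w ^+ 2 * x n w ^+ 2) + (4 * (S n w * x n w ^+ 3) + x n w ^+ 4)).
  by apply: integrD => //; exact: integrZ.
have i2 : integr P (fun w => 4 * (S n w ^+ 3 * x n w) + (6 * (S n w ^+ 2 * x n w ^+ 2) + (4 * (S n w * x n w ^+ 3) + x n w ^+ 4))).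
  by apply: integrD => //; exact: integrZ.
split.
- by under eq_fun do rewrite E4; exact: integrD.
- by rewrite SSf ExD// ES (cw_mean cw) addr0.
- under eq_fun do rewrite E2; rewrite ExD//; last by apply: integrD => //; exact: integrZ.
  rewrite ExD//; last exact: integrZ.
  rewrite ExZ// e11 ES mul0r mulr0 add0r ES2 (cw_var cw) -natr1; ring.
- under eq_fun do rewrite E4; rewrite ExD// ExD//; last exact: integrZ.
  rewrite ExD//; last exact: integrZ.
  rewrite ExD//; last exact: integrZ.
  rewrite !ExZ//.
  rewrite e31 e22 e13 ES ES2 (cw_mean cw) (cw_var cw) mulr0 mul0r !mulr0 !add0r.
  have h4 := cw_fourth cw n.
  rewrite -[n.+1%:R]natr1; have n0 : 0 <= (n%:R : R) by [].
  have := mulr_ge0 n0 M_ge0; have := mulr_ge0 n0 (sqr_ge0 s2); have := sqr_ge0 s2.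
  have -> : 6 * (n%:R * s2 * s2) = 6 * (n%:R * s2 ^+ 2) by ring.
  have -> : (3 * s2 ^+ 2 + M) * (n%:R + 1) ^+ 2 = (3 * s2 ^+ 2 + M) * n%:R ^+ 2 + 6 * (n%:R * s2 ^+ 2)
     + 2 * (n%:R * M) + 3 * s2 ^+ 2 + M by ring.
  lra.
Qed.

(** Running indicator of having reached level [a], built recursively so that it visibly depends on
    the first [n] steps only. Starting from 0 is harmless as the walk starts at 0 and [a] is
    positive. *)
Let exceed (a : R) := fix exceed (n : nat) (w : T) : R :=
  if n is n'.+1 then Num.max (exceed n' w) (a <= `|S n w|)%R%:R else 0.

(** Doob's maximal inequality for the submartingale [S^4]: by induction [a^4 E[exceed n] <=
    E[S_n^4 exceed n]], since fresh exceedances contribute at least [a^4] and earlier ones do not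
    lose mass on average. *)
Lemma doob_fourth (a : R) (L : nat) : 0 < a ->
  exists D : T -> R, [/\ measurable_fun setT D, forall w, (D w == 0) || (D w == 1),
    (forall w n, (n <= L)%N -> a <= `|partial_sum (fun k => x k w) n| -> D w = 1) &
    a ^+ 4 * Ex P D <= (3 * s2 ^+ 2 + M) * L%:R ^+ 2].
Proof.
move=> a0; exists (exceed a L).
have gE m n : (m <= n)%N -> gmeas (G n) (exceed a m).
  elim: m => [|m ih] mn; first exact: gmeas_cst.
  apply: (@measurable_maxr _ (g_sigma_algebraType (G n))); first by apply: ih; exact: ltnW.
  have -> : (fun w => (a <= `|S m.+1 w|)%R%:R : R) = (fun u : R => (a <= `|u|)%R%:R) \o S m.+1 by [].
  apply: gmeas_comp; last exact: gS.
  have -> : (fun u : R => (a <= `|u|)%R%:R : R) = \1_[set u | a <= `|u|].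
    by apply/funext => u; rewrite indicE; congr (nat_of_bool _)%:R; apply/idP/idP; rewrite inE.
  apply: measurable_indic; rewrite -[X in measurable X]setTI.
  by apply: measurable_fun_ler => //; exact: measurableT_comp.
have E01 n w : (exceed a n w == 0) || (exceed a n w == 1).
  elim: n => [|n ih] /=; first by rewrite eqxx.
  by rewrite maxEle; case: ifP => // _; case: (a <= _)%R; rewrite /= eqxx ?orbT.
have E0 n w : 0 <= exceed a n w by case/orP: (E01 n w) => /eqP ->.
have E1 n w : exceed a n w <= 1 by case/orP: (E01 n w) => /eqP ->.
have mE n : measurable_fun setT (exceed a n).
  exact: gmeas_measurable (cw_sub cw (n := n)) (gE n n (leqnn n)).
split => //.
- move=> w n nL an; suff h m : (n <= m)%N -> exceed a m w = 1 by exact: h.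
  elim: m => [|m ih]; first by rewrite leqn0 => /eqP n0; move: an; rewrite n0 /partial_sum big_ord0 normr0 leNgt a0.
  rewrite leq_eqVlt => /predU1P[nm|]; last first.
    by rewrite ltnS => /ih /= ->; rewrite maxEle; case: (a <= _)%R; rewrite /= ?lexx ?ler10.
  by rewrite /= -nm an (max_idPr _)//; exact: E1.
- have [i4 _ _] := walk_moments L; move=> /(le_trans _); apply.
  have iE n : integr P (fun w => S n w ^+ 4 * exceed a n w).
    have [i4n _ _ _] := walk_moments n.
    apply: integr_le i4n; first by apply: measurable_funM => //; exact: measurable_funX.
    by move=> w; rewrite normrM (ger0_norm (E0 _ _)) ger0_norm ?ler_piMr//; have [] := pow4 (S n w).
  have iD n : integr P (exceed a n).
    by apply: (@integr_bd _ _ _ P _ 1) => // w; rewrite ger0_norm.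
  apply: (@le_trans _ _ (Ex P (fun w => S L w ^+ 4 * exceed a L w))); last first.
    apply: Ex_le => // w; rewrite ler_piMr//; by have [] := pow4 (S L w).
  elim: L {i4} => [|n ih].
    rewrite /= Ex_cst mulr0; apply: Ex_ge0 => w; by rewrite mulr0.
  have [i4n _ _ _] := walk_moments n.
  have [iS iS2 iS3] := int_pow (mS n) i4n.
  have [ix ix2 ix3] := int_x n.
  have i3E : integr P (fun w => S n w ^+ 3 * exceed a n w).
    apply: integr_le (integr_norm iS3); first by apply: measurable_funM => //; exact: measurable_funX.
    by move=> w; rewrite normrM (ger0_norm (E0 _ _)) ler_piMr.
  have ind : rv_indep P (fun w => S n w ^+ 3 * exceed a n w) (x n).
    apply: (cw_indep cw); apply: gmeasM; last exact: gE.
    by apply: gmeasX; exact: gS.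
  have [ic ec] := Ex_indep i3E ix ind.
  have iZ := integrZ 4 ic.
  have iEd : integr P (fun w => a ^+ 4 * (exceed a n.+1 w - exceed a n w)).
    by apply: integrZ; apply: integrB.
  have key : Ex P (fun w => S n w ^+ 4 * exceed a n w + (4 * (S n w ^+ 3 * exceed a n w * x n w) +
      a ^+ 4 * (exceed a n.+1 w - exceed a n w))) <= Ex P (fun w => S n.+1 w ^+ 4 * exceed a n.+1 w).
    apply: Ex_le => //.
      by apply: integrD => //; exact: integrD.
    move=> w; have h := E0 n w; rewrite [exceed a n.+1 w]/=.
    (* Tangent inequality for the convex fourth power. On paths that have already exceeded, the
       linear term integrates to zero because the next step is independent of the past. *)
    have conv : S n w ^+ 4 + 4 * S n w ^+ 3 * x n w <= S n.+1 w ^+ 4.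
      rewrite SS; move: (S n w) (x n w) => u v.
      have -> : (u + v) ^+ 4 = u ^+ 4 + 4 * u ^+ 3 * v + v ^+ 2 * (v + 2 * u) ^+ 2 + 2 * (u * v) ^+ 2 by ring.
      by rewrite -[leRHS]addrA lerDl; apply: addr_ge0; rewrite mulr_ge0 ?sqr_ge0.
    have [_ _ _ S0] := pow4 (S n.+1 w).
    case/orP: (E01 n w) => /eqP ->.
      rewrite !mulr0 mul0r mulr0 !add0r subr0.
      have [aS|aS] := boolP (a <= `|S n.+1 w|); last by rewrite maxxx !mulr0.
      rewrite (max_idPr _)//= !mulr1.
      have -> : S n.+1 w ^+ 4 = `|S n.+1 w| ^+ 4.
        by rewrite -normrX ger0_norm.
      by apply: lerXn2r => //; rewrite nnegrE ltW.
    have -> : Num.max 1 (a <= `|S n.+1 w|)%R%:R = 1 :> R.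
      by rewrite maxEle; case: (a <= _)%R; rewrite /= ?lexx ?ler10.
    by rewrite subrr mulr0 addr0 !mulr1 mulrA.
  apply: le_trans key.
  rewrite ExD//; last exact: integrD.
  rewrite ExD// ExZ// ec (cw_mean cw) mulr0 mulr0 add0r ExZ; last exact: integrB.
  rewrite ExB//.
  have -> : a ^+ 4 * Ex P (exceed a n.+1) = a ^+ 4 * Ex P (exceed a n) + a ^+ 4 * (Ex P (exceed a n.+1) - Ex P (exceed a n)) by ring.
  by rewrite lerD2r.
Qed.

End CenteredWalk.

(** * Moduli of continuity of partial sums over windows *)

Section Oscillation.
Context {R : realType}.

Lemma partial_sum_shift (x : nat -> R) p n :
  partial_sum (fun k => x (p + k)%N) n = partial_sum x (p + n) - partial_sum x p.
Proof. by rewrite /partial_sum [in RHS]big_split_ord/= addrAC subrr add0r. Qed.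

Lemma partial_sum0 (x : nat -> R) : partial_sum x 0 = 0.
Proof. by rewrite /partial_sum big_ord0. Qed.

Lemma partial_sumS (x : nat -> R) n : partial_sum x n.+1 = partial_sum x n + x n.
Proof. by rewrite /partial_sum big_ord_recr. Qed.

Definition osc_le (x : nat -> R) (N L : nat) (a : R) : bool :=
  [forall n : 'I_N.+1, forall m : 'I_N.+1, (n <= m <= n + L)%N ==>
    (`|partial_sum x m - partial_sum x n| <= a)%R].

Lemma osc_leP (x : nat -> R) N L a : osc_le x N L a -> forall n m : nat, (n <= N)%N -> (m <= N)%N ->
  (n <= m + L)%N -> (m <= n + L)%N -> `|partial_sum x m - partial_sum x n| <= a.
Proof.
move=> /forallP h n m nN mN nm mn.
wlog le_nm : n m nN mN nm mn / (n <= m)%N.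
  by move=> w; case/orP: (leq_total n m) => ?; [exact: w|rewrite distrC; exact: w].
have := h (Ordinal (nN : (n < N.+1)%N)) => /forallP/(_ (Ordinal (mN : (m < N.+1)%N)))/=.
by rewrite le_nm mn.
Qed.

(** Two indices at most [L] apart lie in the same block of length [L] or in neighbouring ones, so
    their difference is made of at most three increments counted from the start of a block. *)
Lemma osc_le_blocks (x : nat -> R) (N L : nat) (a : R) : (0 < L)%N ->
  (forall j n, (j <= N %/ L)%N -> (n <= L)%N ->
     `|partial_sum (fun k => x (j * L + k)%N) n| < a) ->
  osc_le x N L (3 * a).
Proof.
move=> L0 h; apply/forallP => n; apply/forallP => m; apply/implyP => /andP[nm mn].
have nE := divn_eq n L; have nL := ltn_pmod n L0.
have jN : (n %/ L <= N %/ L)%N by apply: leq_div2r; rewrite -ltnS ltn_ord.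
have hn := h (n %/ L)%N (n %% L)%N jN (ltnW nL).
have hL := h (n %/ L)%N L jN (leqnn L).
rewrite !partial_sum_shift in hn hL.
rewrite -nE in hn.
have a0 : 0 < a by apply: le_lt_trans hn.
have [mL|mL] := leqP (m - (n %/ L) * L) L.
  have hm := h (n %/ L)%N _ jN mL.
  rewrite partial_sum_shift subnKC in hm; last by rewrite (leq_trans _ nm)// {2}nE leq_addr.
  move: hn hm; rewrite !ltr_norml ler_norml => /andP[? ?] /andP[? ?]; apply/andP; split; lra.
have mj : (m - (n %/ L).+1 * L <= L)%N by rewrite mulSn; lia.
have jm : ((n %/ L).+1 * L <= m)%N by rewrite mulSn; lia.
have jN' : ((n %/ L).+1 <= N %/ L)%N.
  by rewrite leq_divRL// (leq_trans jm)// -ltnS ltn_ord.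
have hm := h _ _ jN' mj; rewrite partial_sum_shift subnKC// in hm.
move: hm; rewrite mulSn addnC => hm.
move: hn hm hL; rewrite !ltr_norml ler_norml => /andP[? ?] /andP[? ?] /andP[? ?]; apply/andP; split; lra.
Qed.

Context {d : measure_display} {T : measurableType d}.
Variable P : probability T R.

Lemma measurable_osc (x : nat -> T -> R) N L a : (forall n, measurable_fun setT (x n)) ->
  measurable_fun setT (fun w => (~~ osc_le (x ^~ w) N L a)%:R : R).
Proof.
move=> mx.
pose B (p : 'I_N.+1 * 'I_N.+1) := [set w | (p.1 <= p.2 <= p.1 + L)%N ->
   `|partial_sum (x ^~ w) p.2 - partial_sum (x ^~ w) p.1| <= a].
have -> : (fun w => (~~ osc_le (x ^~ w) N L a)%:R : R) = \1_(~` \bigcap_(p in [set: 'I_N.+1 * 'I_N.+1]) B p).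
  apply/funext => w; rewrite indicE; congr (nat_of_bool _)%:R.
  apply/idP/idP.
    move=> h; rewrite inE/= => h2; move/negP: h; apply.
    apply/forallP => n; apply/forallP => m; apply/implyP; exact: (h2 (n, m)).
  rewrite inE/= => h; apply/negP => h2; apply: h => -[n m] _ /= nm.
  by move/forallP : h2 => /(_ n)/forallP/(_ m)/implyP; apply.
apply: measurable_indic; apply: measurableC; apply: fin_bigcap_measurable; first exact: finite_finset.
move=> [n m] _; rewrite /B/=; case: (n <= m <= n + L)%N; last first.
  by rewrite (_ : [set _ | _] = setT)//; apply/seteqP; split.
rewrite (_ : [set _ | _] = [set w | `|partial_sum (x ^~ w) m - partial_sum (x ^~ w) n| <= a]); last first.
  by apply/seteqP; split => w /=; [exact|].
have mS k : measurable_fun setT (fun w => partial_sum (x ^~ w) k).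
  by rewrite /partial_sum; exact: measurable_sum.
rewrite -[X in measurable X]setTI; apply: measurable_fun_ler => //.
by apply: measurableT_comp => //; exact: measurable_funB.
Qed.

Lemma osc_prob (x : nat -> T -> R) G s2 M N L a : centered_walk P x G s2 M ->
  (0 < L)%N -> 0 < a ->
  Ex P (fun w => (~~ osc_le (x ^~ w) N L (3 * a))%:R) <=
    (N %/ L).+1%:R * ((3 * s2 ^+ 2 + M) * L%:R ^+ 2 / a ^+ 4).
Proof.
move=> cw L0 a0.
have mx n : measurable_fun setT (x n).
  exact: gmeas_measurable (cw_sub cw (n := n.+1)) (cw_meas cw (ltnSn n)).
have /choice[D DP] := fun j => doob_fourth (centered_walk_shift (j * L) cw) L a0.
have iD j : integr P (D j).
  have [mD D01 _ _] := DP j; apply: (@integr_bd _ _ _ P _ 1) => // w.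
  by case/orP: (D01 w) => /eqP ->; rewrite ?normr0 ?normr1.
apply: (@le_trans _ _ (Ex P (fun w => \sum_(j <- iota 0 (N %/ L).+1) D j w))).
  apply: Ex_le.
  - apply: (@integr_bd _ _ _ P _ 1); first exact: measurable_osc.
    by move=> w; case: (~~ _); rewrite ?normr0 ?normr1.
  - exact: integr_sum.
  - move=> w.
    have D0 j : 0 <= D j w by have [_ /(_ w)/orP[|] /eqP -> _ _] := DP j.
    have [//|] := boolP (osc_le _ _ _ _); first by move=> _; exact: sumr_ge0.
    move=> bad; suff [j jN Dj] : exists2 j, (j <= N %/ L)%N & D j w = 1.
      rewrite (bigD1_seq j) ?iota_uniq ?mem_iota//= Dj lerDl; exact: sumr_ge0.
    apply: contrapT => nD; move/negP: bad; apply; apply: osc_le_blocks => // j n jN nL.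
    rewrite ltNge; apply/negP => an; apply: nD; exists j => //.
    by have [_ _ h _] := DP j; exact: h nL an.
rewrite Ex_sum//.
apply: (@le_trans _ _ (\sum_(j <- iota 0 (N %/ L).+1) ((3 * s2 ^+ 2 + M) * L%:R ^+ 2 / a ^+ 4))).
  apply: ler_sum => j _; have [_ _ _ h] := DP j.
  by rewrite ler_pdivlMr ?exprn_gt0// mulrC.
by rewrite big_const_seq count_predT size_iota iter_addr addr0 [leRHS]mulr_natl.
Qed.

(** About [C / k] blocks fail with probability of order [(k r^2)^2 / (eta r)^4 = k^2 / eta^4] each,
    which leaves a bound linear in [k] and free of [r]. *)
Lemma osc_small (x : nat -> T -> R) G s2 M (C eta e : R) : centered_walk P x G s2 M ->
  0 <= C -> 0 < eta -> 0 < e -> exists k0 : R, 0 < k0 /\ forall k : R, 0 < k -> k <= k0 ->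
  \forall r \near \oo, Ex P (fun w => (~~ osc_le (x ^~ w) (Num.truncn (C * r%:R ^+ 2)).+1
     (Num.truncn (k * r%:R ^+ 2)).+1 (eta * r%:R))%:R) <= e.
Proof.
move=> cw C0 eta0 e0.
have M0 : 0 <= M.
  apply: le_trans (cw_fourth cw 0%N); apply: Ex_ge0 => w.
  by rewrite -[4%N]/(2 * 2)%N exprM sqr_ge0.
pose A := 3 * s2 ^+ 2 + M; have A0 : 0 <= A by rewrite addr_ge0// mulr_ge0// sqr_ge0.
(* [C + 3] bounds [k] times the number of blocks; [324 = 2^2 3^4] collects [L <= 2 k r^2], squared,
   and the level [eta r / 3], to the fourth power. *)
pose B := (C + 3) * A * 324 / eta ^+ 4.
have B0 : 0 <= B by rewrite divr_ge0 ?exprn_ge0 ?(ltW eta0)// !mulr_ge0// addr_ge0.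
exists (Num.min 1 (e / (B + 1))); split.
  by rewrite lt_min ltr01 divr_gt0// ltr_wpDl.
move=> k k0; rewrite le_min => /andP[k1 ke].
have Bk : B * k <= e.
  apply: (@le_trans _ _ ((B + 1) * k)); first by rewrite ler_wpM2r ?(ltW k0)// lerDl.
  by rewrite mulrC -ler_pdivlMr// ltr_wpDl.
near=> r.
have r0 : 0 < (r%:R : R) by near: r; exact: nbhs_infty_gtr.
have rk : 1 <= k * r%:R ^+ 2.
  have : k^-1 <= r%:R by near: r; exact: nbhs_infty_ger.
  have : 1 <= (r%:R : R) by near: r; exact: nbhs_infty_ger.
  move=> r1 kr; rewrite mulrC -ler_pdivrMr// div1r (le_trans kr)// expr2 ler_peMl// ltW//.
have r2 : 0 < (r%:R : R) ^+ 2 by rewrite exprn_gt0.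
set N := (Num.truncn (C * _)).+1; set L := (Num.truncn _).+1.
have -> : eta * r%:R = 3 * (eta * r%:R / 3) by field.
have a0 : 0 < eta * r%:R / 3 by rewrite divr_gt0// mulr_gt0.
apply: le_trans (osc_prob N cw (isT : (0 < L)%N) a0) _.
have kr0 : 0 <= k * r%:R ^+ 2 by rewrite mulr_ge0// ltW.
have Cr0 : 0 <= C * r%:R ^+ 2 by rewrite mulr_ge0// ltW.
have /andP[L1 L2] := truncn_itv kr0.
have /andP[N1 N2] := truncn_itv Cr0.
have LE : (L%:R : R) = (Num.truncn (k * r%:R ^+ 2))%:R + 1 by rewrite natr1.
have NE : (N%:R : R) = (Num.truncn (C * r%:R ^+ 2))%:R + 1 by rewrite natr1.
have Lub : (L%:R : R) <= 2 * (k * r%:R ^+ 2) by rewrite LE; lra.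
have Llb : k * r%:R ^+ 2 <= (L%:R : R) by exact: ltW.
have L0 : 0 < (L%:R : R) by rewrite ltr0n.
have NL : ((N %/ L).+1%:R : R) <= (C + 3) / k.
  have h : ((N %/ L)%:R : R) * L%:R <= N%:R by rewrite -natrM ler_nat leq_divM.
  have h1 : ((N %/ L)%:R : R) * (k * r%:R ^+ 2) <= C * r%:R ^+ 2 + 1.
    by apply: (@le_trans _ _ ((N %/ L)%:R * L%:R)); [exact: ler_wpM2l|rewrite (le_trans h)// NE lerD2r].
  rewrite ler_pdivlMr// -natr1 mulrDl mul1r.
  have h2 : 1 <= r%:R ^+ 2 :> R by rewrite (le_trans rk)// ger_pMl.
  have h3 : ((N %/ L)%:R * k) * r%:R ^+ 2 <= (C + 1) * r%:R ^+ 2 by lra.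
  by rewrite ler_pM2r// in h3; lra.
apply: (@le_trans _ _ ((C + 3) / k * (A * (2 * (k * r%:R ^+ 2)) ^+ 2 / (eta * r%:R / 3) ^+ 4))).
  apply: ler_pM => //; first by rewrite divr_ge0 ?exprn_ge0 ?(ltW a0)// mulr_ge0// sqr_ge0.
  rewrite ler_pM2r ?invr_gt0 ?exprn_gt0// ler_wpM2l// lerXn2r ?nnegrE// ?ltW// mulr_gt0// mulr_gt0//.
apply: le_trans Bk; rewrite le_eqVlt; apply/orP; left; apply/eqP; rewrite /B; field.
by rewrite ?gt_eqF// ?gt_eqF.
Unshelve. all: by end_near.
Qed.

End Oscillation.

(** * Renewal counts as bracketing indices *)

Section RenewalCount.
Context {R : realType}.
Implicit Types (x : nat -> R) (t : R).

Lemma partial_sum_le x n m : (forall k, 0 < x k) -> (n <= m)%N -> partial_sum x n <= partial_sum x m.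
Proof.
move=> x0 /subnKC <-; elim: (m - n)%N => [|k ih]; first by rewrite addn0.
by rewrite addnS partial_sumS (le_trans ih)// lerDl ltW.
Qed.

Lemma renewal_countE x t n : (forall k, 0 < x k) ->
  partial_sum x n <= t < partial_sum x n.+1 -> renewal_count x t = n.
Proof.
move=> x0 /andP[nt tn]; rewrite /renewal_count /supremum.
set A := [set n | _].
have An : A n by [].
have -> : (A == set0) = false by apply/negP => /eqP A0; rewrite A0 in An.
have supn : supremums A n.
  split; last by move=> k /(_ n An).
  move=> k /= Ak; rewrite leEnat leqNgt; apply/negP => nk.
  have := lt_le_trans tn (partial_sum_le x0 nk).
  by rewrite ltNge Ak.
by apply: xget_unique => // y yA; exact: (is_subset1_supremums yA supn).
Qed.

(** A partial sum beyond [t] bounds the set of indices, which excludes the default value of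
    [supremum]. *)
Lemma renewal_count_lt x t N : (forall k, 0 < x k) -> 0 <= t -> t < partial_sum x N ->
  (renewal_count x t < N)%N /\
  partial_sum x (renewal_count x t) <= t < partial_sum x (renewal_count x t).+1.
Proof.
move=> x0 t0 tN.
suff [n nN nt] : exists2 n, (n < N)%N & partial_sum x n <= t < partial_sum x n.+1.
  by rewrite (renewal_countE x0 nt).
elim: N tN => [|N ih] tN; first by move: tN; rewrite partial_sum0 ltNge t0.
have [Nt|Nt] := leP (partial_sum x N) t; first by exists N => //; rewrite Nt.
by have [n nN h] := ih Nt; exists n => //; exact: ltnW.
Qed.

End RenewalCount.

(** * Minimality in the one-dimensional reflection problem *)

Section OneDimReflection.
Context {R : realType}.
Implicit Types (f : R -> R).

Lemma within_continuousP f : {within `[0, +oo[, continuous f} ->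
  forall s e : R, 0 <= s -> 0 < e -> exists2 del : R, 0 < del &
    forall u, 0 <= u -> `|s - u| < del -> `|f s - f u| < e.
Proof.
move=> /subspace_continuousP cf s e s0 e0.
have := cf s; rewrite /= in_itv/= andbT => /(_ s0)/cvgrPdist_lt/(_ e e0).
rewrite near_withinE => /nbhs_ballP[del /= del0 h].
by exists del => // u u0 su; apply: h => //=; rewrite in_itv/= u0.
Qed.

(** If [f] ended above [m], take the last time at which it equals a level [m'] strictly between [m]
    and [f t]. That time is a point of right increase, so [X + f <= 0] there, against
    [X >= - m > - m']. *)
Lemma reflection_upper f X t m : {within `[0, +oo[, continuous f} ->
  {in `[0, +oo[ &, {homo f : s t / s <= t}} -> f 0 = 0 -> 0 <= t -> 0 <= m ->
  (forall s, 0 <= s <= t -> - X s <= m) ->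
  (forall s, 0 <= s <= t -> (forall u, s < u -> f s < f u) -> X s + f s <= 0) ->
  f t <= m.
Proof.
move=> cf hf f0 t0 m0 Xm fX; rewrite leNgt; apply/negP => mt.
pose m' := (m + f t) / 2.
have m'1 : m < m' by rewrite /m'; lra.
have m'2 : m' < f t by rewrite /m'; lra.
pose A := [set s | 0 <= s <= t /\ f s <= m'].
have A0 : A 0 by split; rewrite ?lexx// f0; lra.
have hA : has_sup A by split; [exists 0|exists t => s [/andP[]]].
pose s := sup A.
have s0 : 0 <= s by apply: ub_le_sup => //; exact: hA.2.
have st : s <= t by apply: ge_sup; [exists 0|move=> u [/andP[]]].
have up u : s < u -> m' < f u.
  move=> su; rewrite ltNge; apply/negP => um.
  have [ut|tu] := leP u t.
    have : u <= s by apply: ub_le_sup; [exact: hA.2|split => //; rewrite (le_trans s0 (ltW su))].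
    by rewrite leNgt su.
  have : f t <= f u by apply: hf; rewrite ?in_itv/= ?andbT ?(le_trans t0)// ltW.
  by lra.
have fs : f s <= m'.
  rewrite leNgt; apply/negP => ms.
  have fsm : 0 < f s - m' by rewrite subr_gt0.
  have [del del0 h] := within_continuousP cf s0 fsm.
  have [u Au us] := sup_adherent del0 hA.
  have uls : u <= s by apply: ub_le_sup => //; exact: hA.2.
  have [/andP[u0 ut] um] := Au.
  have su : `|s - u| < del by rewrite ger0_norm ?subr_ge0// -/s in us *; lra.
  have := h u u0 su; rewrite ltr_norml => /andP[? ?]; lra.
have sm : m' <= f s.
  rewrite leNgt; apply/negP => ms.
  have fsm : 0 < m' - f s by rewrite subr_gt0.
  have [del del0 h] := within_continuousP cf s0 fsm.
  have u0 : 0 <= s + del / 2 by lra.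
  have su : `|s - (s + del / 2)| < del by rewrite opprD addNKr normrN ger0_norm; lra.
  have su' : s < s + del / 2 by lra.
  have := h _ u0 su; have := up _ su'; rewrite ltr_norml => ? /andP[? ?]; lra.
have s1 : 0 <= s <= t by rewrite s0.
have := fX s s1 _; have := Xm s s1 => Xs h.
have : X s + f s <= 0 by apply: h => u su; apply: (le_lt_trans fs); exact: up.
lra.
Qed.

End OneDimReflection.

Definition grid_reflection {R : realType} (m : nat) (y : 'I_m.+1 -> R) : R :=
  y ord_max + \big[Num.max/0]_(k < m.+1) (- y k).

(** * Workloads as reflections *)

Section PathBound.
Context {R : realType} {nI nJ : nat}.
Variables (Ji : {set 'I_nJ}) (mu lamr lam : 'I_nJ -> R).
Variables (q0 : 'I_nJ -> nat) (ub v : 'I_nJ -> nat -> R) (T : 'I_nJ -> R -> R).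
Variables (theta rho t b B H : R) (N L m : nat).
Let u (j : 'I_nJ) (n : nat) : R := ub j n / lamr j.
Let tau := rho ^+ 2 * t.
Let xs (j : 'I_nJ) (n : nat) : R := v j n - (mu j)^-1.
Let xu (j : 'I_nJ) (n : nat) : R := ub j n - 1.
Let Idle (s : R) : R := s - \sum_(j in Ji) T j s.
Let Q j s := queue (q0 j) (u j) (v j) (T j) s.
(** Deterministic clock: the arrivals of type [j] expected by the [k]-th grid time at the limiting
    rate. It replaces the random count, so that [Y] is a linear form in the primitives with fixed
    coefficients. *)
Let nk (j : 'I_nJ) (k : 'I_m.+1) := Num.truncn (lam j * (rho ^+ 2 * (t * k%:R / m%:R))).
Let Y (k : 'I_m.+1) : R := \sum_(j in Ji) ((q0 j)%:R / mu j + partial_sum (xs j) (nk j k)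
  - partial_sum (xu j) (nk j k) / mu j) + theta * rho * (t * k%:R / m%:R).
(** Error budget in units of [b]: [2 + 3 / mu j] covers every discrepancy caused by job type [j],
    and the leading 1 pays for the drift through [Hload]. *)
Let C1 : R := 1 + \sum_j (2 + 3 / mu j).

Hypotheses (mu_gt0 : forall j, 0 < mu j) (lamr_gt0 : forall j, 0 < lamr j) (lam_ge0 : forall j, 0 <= lam j).
Hypotheses (rho_gt0 : 0 < rho) (t_gt0 : 0 < t) (m_gt0 : (0 < m)%N).
Hypotheses (ub_gt0 : forall j n, 0 < ub j n) (v_gt0 : forall j n, 0 < v j n).
Hypothesis (Q_ge0 : forall j s, 0 <= s -> 0 <= Q j s).
Hypothesis (hol : forall j s, 0 <= s ->
  partial_sum (v j) (renewal_count (v j) (T j s)) <= T j s <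
  partial_sum (v j) (renewal_count (v j) (T j s)).+1).
Hypothesis (idle_cnd : cnd0 Idle).
Hypothesis (work : forall s, 0 <= s -> ((forall s', s < s' -> Idle s < Idle s') <-> \sum_(j in Ji) Q j s = 0)).
Hypotheses (oscs : forall j, osc_le (xs j) N L b) (oscu : forall j, osc_le (xu j) N L b).
Hypotheses (rangs : forall j n, (n <= N)%N -> `|partial_sum (xs j) n| <= B)
           (rangu : forall j n, (n <= N)%N -> `|partial_sum (xu j) n| <= B).
Hypotheses (b1 : 1 <= b) (L_gt0 : (0 < L)%N).
Hypothesis (HN : forall j, (q0 j)%:R + lamr j * tau + B + 2 <= N%:R).
Hypothesis (HNl : forall j, lam j * tau <= N%:R).
Hypothesis (HL : forall j, (q0 j)%:R + `|lamr j - lam j| * tau + B + 2 + lam j * tau / m%:R <= L%:R).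
Hypothesis (Hload : `|rho * (\sum_(j in Ji) lamr j / mu j - 1) - theta| * (rho * t)
   + `|theta| * (rho * t / m%:R) <= b).
Hypothesis (HY : forall k, `|Y k| <= H).
Hypothesis (HQ : forall j, mu j * (2 * H + 5 * C1 * b + 2 * B) + 1 <= L%:R).

Let tau_gt0 : 0 < tau. Proof. by rewrite mulr_gt0// exprn_gt0. Qed.
Let b_gt0 : 0 < b. Proof. exact: lt_le_trans b1. Qed.
Let m0 : 0 < (m%:R : R). Proof. by rewrite ltr0n. Qed.
Let Vn j n : partial_sum (v j) n = n%:R / mu j + partial_sum (xs j) n.
Proof.
elim: n => [|n ih]; first by rewrite !partial_sum0 mul0r add0r.
by rewrite !partial_sumS ih /xs -[n.+1%:R]natr1 mulrDl mul1r; ring.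
Qed.

Let Un j n : partial_sum (u j) n = (n%:R + partial_sum (xu j) n) / lamr j.
Proof.
elim: n => [|n ih]; first by rewrite !partial_sum0 addr0 mul0r.
rewrite !partial_sumS ih /xu /u -[n.+1%:R]natr1 -mulrDl; congr (_ / _); ring.
Qed.

Let E j s := renewal_count (u j) s.
Let Nj j s := (q0 j + E j s)%N.
Let Sj j s := renewal_count (v j) (T j s).

Let QE j s : Q j s = (Nj j s)%:R - (Sj j s)%:R.
Proof. by rewrite /Q /queue /Nj natrD. Qed.

(** [HN] and the range bound keep the count below [N]: it is then a true bracketing index, and the
    oscillation hypotheses, which stop at [N], apply to it. *)
Let arrivals j s : 0 <= s <= tau -> [/\ (E j s < N)%N, (E j s)%:R + partial_sum (xu j) (E j s) <= lamr j * s,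
  lamr j * s < (E j s)%:R + 1 + partial_sum (xu j) (E j s).+1 & `|(E j s)%:R - lamr j * s| <= B + 1].
Proof.
move=> /andP[s0 st].
have lst : lamr j * s <= lamr j * tau by rewrite ler_wpM2l// ltW.
have u_gt0 n : 0 < u j n by rewrite divr_gt0.
have [|EN] := @renewal_count_lt _ (u j) s N u_gt0 s0.
  rewrite Un ltr_pdivlMr// mulrC; apply: (le_lt_trans lst).
  have := HN j; have := rangu j (leqnn N); rewrite ler_norml => /andP[? ?].
  have := ler0n R (q0 j); lra.
rewrite -/(E j s) !Un ler_pdivrMr// ltr_pdivlMr// mulrC => /andP[h1 h2].
have h3 := rangu j (ltnW EN); have h4 := rangu j EN.
rewrite -[(E j s).+1%:R]natr1 in h2.
split => //; move: h3 h4; rewrite !ler_norml => /andP[? ?] /andP[? ?]; apply/andP; split; lra.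
Qed.

Let Nj_lt j s : 0 <= s <= tau -> (Nj j s < N)%N.
Proof.
move=> sP; have [_ h _ _] := arrivals j sP; rewrite -(ltr_nat R) natrD.
have [EN _ _ _] := arrivals j sP.
have := rangu j (ltnW EN); rewrite ler_norml => /andP[? ?].
have lst : lamr j * s <= lamr j * tau by rewrite ler_wpM2l ?(ltW (lamr_gt0 j))//; case/andP: sP.
have := HN j; lra.
Qed.

Let gridpt (k : 'I_m.+1) : R := rho ^+ 2 * (t * k%:R / m%:R).

(** [HL] sizes the window to cover all that separates the random clock from the deterministic one:
    initial jobs, rate error, arrival fluctuation and one mesh of the grid. *)
Let nk_near j s (k : 'I_m.+1) : 0 <= s <= tau -> `|s - gridpt k| <= tau / m%:R -> gridpt k <= tau ->
  [/\ (nk j k <= N)%N, (Nj j s <= nk j k + L)%N, (nk j k <= Nj j s + L)%N,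
      (E j s <= nk j k + L)%N & (nk j k <= E j s + L)%N].
Proof.
move=> sP sk kt.
have g0 : 0 <= gridpt k by rewrite !mulr_ge0 ?invr_ge0// ?exprn_ge0// ltW.
have lg0 : 0 <= lam j * gridpt k by rewrite mulr_ge0.
have /andP[n1 n2] := truncn_itv lg0; rewrite -/(nk j k) in n1 n2.
rewrite -[X in _ < X]natr1 in n2.
have [EN _ _ e1] := arrivals j sP.
have l1 : `|lamr j * s - lam j * s| <= `|lamr j - lam j| * tau.
  rewrite -mulrBl normrM ler_wpM2l//; case/andP: sP => ? ?; rewrite ger0_norm//.
have l2 : `|lam j * s - lam j * gridpt k| <= lam j * tau / m%:R.
  by rewrite -mulrBr normrM (ger0_norm (lam_ge0 j)) -mulrA ler_wpM2l.
have := HL j; have lk : lam j * gridpt k <= lam j * tau by rewrite ler_wpM2l.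
have := ler0n R (q0 j); have := HNl j.
move: l1 l2 e1; rewrite !ler_norml => /andP[? ?] /andP[? ?] /andP[? ?] ? ? ?.
by split; rewrite -(ler_nat R) ?natrD; lra.
Qed.

Let C1_job j : 2 + 3 / mu j <= C1.
Proof.
rewrite /C1 (bigD1 j)//= addrCA lerDl addr_ge0// sumr_ge0// => i _.
by rewrite addr_ge0// divr_ge0// ltW.
Qed.

Let sum_C1 (F : 'I_nJ -> R) : (forall j, `|F j| <= (2 + 3 / mu j) * b) ->
  `|\sum_(j in Ji) F j| <= (C1 - 1) * b.
Proof.
move=> hF; rewrite (le_trans (ler_norm_sum _ _ _))// /C1 addrAC subrr add0r mulr_suml.
rewrite big_mkcond/=; apply: ler_sum => j _; case: ifP => // _.
by rewrite mulr_ge0 ?(ltW b_gt0)// addr_ge0// divr_ge0// ltW.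
Qed.

(** The netput: work carried by all jobs that were present or have arrived, minus elapsed time. It
    does not involve the policy, and [X + Idle] is the remaining work. *)
Let X (s : R) := \sum_(j in Ji) partial_sum (v j) (Nj j s) - s.

(** The service walk is moved from the random to the deterministic clock at the price of one
    oscillation; the count itself is replaced by its mean minus the interarrival walk; the drift
    error is [Hload]. *)
Let X_near s (k : 'I_m.+1) : 0 <= s <= tau -> `|s - gridpt k| <= tau / m%:R -> gridpt k <= tau ->
  `|X s - Y k| <= C1 * b.
Proof.
move=> sP sk kt.
pose D j := (partial_sum (xs j) (Nj j s) - partial_sum (xs j) (nk j k))
  + (((E j s)%:R - lamr j * s) + partial_sum (xu j) (nk j k)) / mu j.
have XYE : X s - Y k = \sum_(j in Ji) D j + ((\sum_(j in Ji) lamr j / mu j - 1) * s - theta * rho * (t * k%:R / m%:R)).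
  pose A2 := \sum_(j in Ji) ((q0 j)%:R / mu j + partial_sum (xs j) (nk j k) - partial_sum (xu j) (nk j k) / mu j).
  have S : \sum_(j in Ji) partial_sum (v j) (Nj j s) - A2 =
      \sum_(j in Ji) D j + (\sum_(j in Ji) lamr j / mu j) * s.
    rewrite mulr_suml /A2 -sumrB -big_split/=; apply: eq_bigr => j _.
    by rewrite Vn /D /Nj natrD; field; rewrite gt_eqF.
  rewrite /X /Y -/A2; move: S.
  set V := \sum_(j in Ji) partial_sum _ _; set DD := \sum_(j in Ji) D j; set Z := \sum_(j in Ji) _ / _.
  move=> S; have -> : V = DD + Z * s + A2 by rewrite -S subrK.
  ring.
have DB j : `|D j| <= (2 + 3 / mu j) * b.
  have [n1 n2 n3 n4 n5] := nk_near j sP sk kt.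
  have [EN e1 e2 _] := arrivals j sP.
  have o1 : `|partial_sum (xs j) (Nj j s) - partial_sum (xs j) (nk j k)| <= b.
    by apply: (osc_leP (oscs j)) => //; exact: ltnW (Nj_lt j sP).
  have o2 : `|partial_sum (xu j) (E j s) - partial_sum (xu j) (nk j k)| <= b.
    by apply: (osc_leP (oscu j)) => //; exact: ltnW.
  have o3 : `|partial_sum (xu j) (E j s).+1 - partial_sum (xu j) (E j s)| <= b.
    apply: (osc_leP (oscu j)) => //; first exact: ltnW.
    by rewrite (leq_trans (leqnSn _))// leq_addr.
    by rewrite -addn1 leq_add2l.
  have b0 : 0 < b by exact: b_gt0.
  (* The renewal bracket says that the count error is minus the interarrival walk up to one step;
     oscillations move that walk to [nk], and [1 <= b] absorbs the rounding. *)
  have o4 : `|(E j s)%:R - lamr j * s + partial_sum (xu j) (nk j k)| <= 3 * b.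
    clear XYE; move: o2 o3 (b1) e1 e2; rewrite !ler_norml.
    move: (partial_sum _ (nk j k)) (partial_sum _ (E j s).+1) (partial_sum _ (E j s)) => p1 p2 p3.
    move: (E j s)%:R (lamr j * s) => e l /andP[? ?] /andP[? ?] ? ? ?; apply/andP; split; lra.
  rewrite /D; apply: (le_trans (ler_normD _ _)); rewrite [leRHS]mulrDl; apply: lerD.
    by apply: (le_trans o1); lra.
  rewrite normrM (ger0_norm (_ : 0 <= (mu j)^-1)) ?invr_ge0 ?(ltW (mu_gt0 j))//.
  by rewrite mulrAC ler_pM2r ?invr_gt0.
rewrite XYE; apply: (le_trans (ler_normD _ _)).
have -> : C1 * b = (C1 - 1) * b + b by ring.
apply: lerD; first exact: sum_C1.
apply: le_trans Hload; set z := \sum_(j in Ji) _ - 1.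
have -> : z * s - theta * rho * (t * k%:R / m%:R) = (rho * z - theta) * (s / rho) + theta * ((s - gridpt k) / rho).
  by rewrite /gridpt; field; rewrite ?(gt_eqF rho_gt0) ?(gt_eqF m0).
case/andP: sP => s0 s1.
have sr : s / rho <= rho * t by rewrite ler_pdivrMr// mulrAC -expr2.
have sr0 : 0 <= s / rho by rewrite divr_ge0// ltW.
apply: (le_trans (ler_normD _ _)); apply: lerD.
  by rewrite normrM ler_wpM2l// ger0_norm.
rewrite normrM ler_wpM2l// normrM (gtr0_norm (_ : 0 < rho^-1)) ?invr_gt0//.
rewrite ler_pdivrMr//; apply: (le_trans sk).
have -> : rho * t / m%:R * rho = tau / m%:R by rewrite /tau; ring.
by [].
Qed.

Let service j n : (n < N)%N -> v j n <= (1 + (mu j)^-1) * b.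
Proof.
move=> nN.
have := osc_leP (oscs j) (ltnW nN) nN; rewrite partial_sumS addrAC subrr add0r => h.
have {}h : `|xs j n| <= b by apply: h; lia.
move: h; rewrite ler_norml /xs => /andP[_ h].
have : (mu j)^-1 <= (mu j)^-1 * b by rewrite ler_peMr// invr_ge0 ltW.
lra.
Qed.

(** Head-of-the-line service leaves at most one started job per type, and its entire length is small
    because a single step of the service walk is itself an oscillation. *)
Let job_work j s : 0 <= s <= tau -> [/\ (Sj j s <= Nj j s)%N,
  - ((1 + (mu j)^-1) * b) <= partial_sum (v j) (Nj j s) - T j s,
  partial_sum (v j) (Sj j s) <= T j s &
  T j s < partial_sum (v j) (Sj j s) + (1 + (mu j)^-1) * b].
Proof.
move=> sP; case/andP: (sP) => s0 _.
have SN : (Sj j s <= Nj j s)%N by have := Q_ge0 j s0; rewrite QE subr_ge0 ler_nat.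
have /andP[h1 h2] := hol j s0; rewrite -/(Sj j s) in h1 h2.
have vS : v j (Sj j s) <= (1 + (mu j)^-1) * b.
  by apply: service; exact: leq_ltn_trans SN (Nj_lt j sP).
have h3 : T j s < partial_sum (v j) (Sj j s) + (1 + (mu j)^-1) * b.
  by apply: (lt_le_trans h2); rewrite partial_sumS lerD2l.
split => //.
have := partial_sum_le (v_gt0 j) SN; lra.
Qed.

Let frac_small j : (1 + (mu j)^-1) * b <= (2 + 3 / mu j) * b.
Proof.
rewrite ler_pM2r// lerD// ?ler1n// ler_peMl ?ler1n// invr_ge0 ltW//.
Qed.

Let XI s : X s + Idle s = \sum_(j in Ji) (partial_sum (v j) (Nj j s) - T j s).
Proof. by rewrite /X /Idle sumrB; ring. Qed.

Let grid_le (k : 'I_m.+1) : gridpt k <= tau.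
Proof.
rewrite /gridpt /tau ler_pM2l ?exprn_gt0// ler_pdivrMr// ler_pM2l// ler_nat -ltnS ltn_ord//.
Qed.

Let grid_ge0 (k : 'I_m.+1) : 0 <= gridpt k.
Proof. by rewrite !mulr_ge0 ?invr_ge0// ?exprn_ge0// ltW. Qed.

Let near_grid s : 0 <= s <= tau -> exists k : 'I_m.+1, `|s - gridpt k| <= tau / m%:R.
Proof.
move=> /andP[s0 s1].
pose y := s * m%:R / tau.
have y0 : 0 <= y by rewrite divr_ge0 ?mulr_ge0// ltW.
have ym : y <= m%:R by rewrite ler_pdivrMr// mulrC ler_pM2l.
have /andP[k1 k2] := truncn_itv y0.
have km : (Num.truncn y < m.+1)%N by rewrite ltnS -(ler_nat R) (le_trans k1).
exists (Ordinal km) => /=; rewrite /gridpt/=.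
have -> : s - rho ^+ 2 * (t * (Num.truncn y)%:R / m%:R) = (y - (Num.truncn y)%:R) * (tau / m%:R).
  by rewrite /y /tau; field; rewrite !gt_eqF.
rewrite normrM (ger0_norm (_ : 0 <= tau / m%:R)); last by rewrite divr_ge0// ltW.
rewrite ler_piMl ?divr_ge0 ?(ltW tau_gt0)// ger0_norm ?subr_ge0//.
by rewrite -natr1 in k2; lra.
Qed.

(** [Idle] exceeds the grid maximum of [- Y] by at most [C1 b] (minimality of reflection) and falls
    short of it by at most [2 C1 b]; with one more [C1 b] for [X], the remaining work is within
    [3 C1 b] of the grid reflection. Passing from remaining work to queue lengths divided by [mu]
    costs less than another [C1 b]. *)
Lemma path_bound : `|\sum_(j in Ji) Q j tau / mu j - grid_reflection Y| <= 5 * C1 * b.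
Proof.
have tauP : 0 <= tau <= tau by rewrite lexx ltW.
have C1b : 0 <= C1 * b.
  rewrite mulr_ge0 ?(ltW b_gt0)// /C1 addr_ge0// sumr_ge0// => i _.
  by rewrite addr_ge0// divr_ge0// ltW.
have [Ic Ih I0] := idle_cnd.
pose mx := \big[Num.max/0]_(k < m.+1) (- Y k).
have mx0 : 0 <= mx by exact: bigmax_ge_id.
have mxk k : - Y k <= mx by exact: le_bigmax.
have I_ge0 : 0 <= Idle tau by rewrite -I0; apply: Ih; rewrite ?in_itv/= ?lexx// ltW.
have Iub : Idle tau <= mx + C1 * b.
  apply: (reflection_upper (X := X) Ic Ih I0 (ltW tau_gt0)).
  - by rewrite addr_ge0.
  - move=> s sP; have [k sk] := near_grid sP.
    have := X_near sP sk (grid_le k); rewrite ler_norml => /andP[? ?].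
    by have := mxk k; lra.
  (* At a point of increase all queues of the resource are empty, so every arrived job is completed
     and its work is contained in [T j s]: this is [X + Idle <= 0]. *)
  - move=> s sP up; case/andP: (sP) => s0 _.
    have /work := up; move=> /(_ s0) Q0.
    have Qj j : j \in Ji -> Q j s = 0.
      move=> jJ; apply/eqP; move/eqP: Q0; rewrite psumr_eq0 => [|i _]; last exact: Q_ge0.
      by move=> /allP/(_ j (mem_index_enum _)); rewrite jJ.
    rewrite XI; apply: sumr_le0 => j jJ; rewrite subr_le0.
    have [_ _ h _] := job_work j sP; move: (Qj j jJ); rewrite QE => /eqP.
    by rewrite subr_eq0 eqr_nat => /eqP ->.
(* Remaining work is never much below zero, so at each grid point the idle time has already made up
   for [- Y k]; monotonicity carries this to [tau]. *)
have Ilb : mx - 2 * (C1 * b) <= Idle tau.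
  rewrite lerBlDr; apply: bigmax_le; first by rewrite addr_ge0// mulr_ge0.
  move=> k _; have kP : 0 <= gridpt k <= tau by rewrite grid_ge0 grid_le.
  have sk : `|gridpt k - gridpt k| <= tau / m%:R by rewrite subrr normr0 divr_ge0// ltW.
  have := X_near kP sk (grid_le k); rewrite ler_norml => /andP[h1 h2].
  have h3 : Idle (gridpt k) <= Idle tau.
    by apply: Ih; rewrite ?in_itv/= ?andbT ?grid_ge0 ?grid_le// ltW.
  have h4 : - (C1 * b) <= X (gridpt k) + Idle (gridpt k).
    rewrite XI lerNl -sumrN.
    apply: (@le_trans _ _ (\sum_(j in Ji) (2 + 3 / mu j) * b)).
      apply: ler_sum => j _; have [_ h _ _] := job_work j kP; have := frac_small j; lra.
    rewrite -mulr_suml ler_pM2r// /C1 ler_wpDl// [leRHS](bigID (mem Ji))/= lerDl sumr_ge0// => i _.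
    by rewrite addr_ge0// divr_ge0// ltW.
  lra.
have km : gridpt ord_max = tau.
  by rewrite /gridpt /tau/=; field; rewrite gt_eqF.
have sk : `|tau - gridpt ord_max| <= tau / m%:R by rewrite km subrr normr0 divr_ge0// ltW.
have XY := X_near tauP sk (grid_le _).
have WY : `|X tau + Idle tau - grid_reflection Y| <= 3 * (C1 * b).
  rewrite /grid_reflection -/mx; move: XY; rewrite !ler_norml => /andP[? ?]; apply/andP; split; lra.
have gH : grid_reflection Y <= 2 * H.
  have : mx <= H.
    apply: bigmax_le; first exact: le_trans (normr_ge0 _) (HY ord0).
    by move=> k _; have := HY k; rewrite ler_norml => /andP[? ?]; lra.
  rewrite /grid_reflection -/mx; have := HY ord_max; rewrite ler_norml => /andP[? ?]; lra.
(* The other types hold at least [- C1 b] of work, so the bound on the total passes to a single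
   type. *)
have jobW j : j \in Ji -> partial_sum (v j) (Nj j tau) - T j tau <= 2 * H + 4 * C1 * b.
  move=> jJ.
  have : \sum_(i in Ji | i != j) (partial_sum (v i) (Nj i tau) - T i tau) >= - (C1 * b).
    rewrite lerNl -sumrN.
    apply: (@le_trans _ _ (\sum_(i in Ji | i != j) (2 + 3 / mu i) * b)).
      apply: ler_sum => i _; have [_ h _ _] := job_work i tauP; have := frac_small i; lra.
    rewrite -mulr_suml ler_pM2r// /C1 ler_wpDl// [leRHS](bigID (fun i => (i \in Ji) && (i != j)))/= lerDl.
    by rewrite sumr_ge0// => i _; rewrite addr_ge0// divr_ge0// ltW.
  move: WY; rewrite XI (bigD1 j)//= ler_norml => /andP[? ?]; lra.
have close j : j \in Ji -> `|Q j tau / mu j - (partial_sum (v j) (Nj j tau) - T j tau)| <= (2 + 3 / mu j) * b.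
  move=> jJ; have [SN _ h1 h2] := job_work j tauP.
  have NN := ltnW (Nj_lt j tauP).
  (* The waiting jobs must fit in one window before oscillations can compare their work with their
     number; the crude range bound [B] and [HQ] provide this. *)
  have NL : (Nj j tau <= Sj j tau + L)%N.
    have := jobW j jJ; rewrite !Vn => jW.
    have r1 := rangs j NN; have r2 := rangs j (leq_trans SN NN).
    move: r1 r2; rewrite !ler_norml => /andP[r1 r1'] /andP[r2 r2'].
    rewrite Vn in h2.
    have vb : (1 + (mu j)^-1) * b <= C1 * b.
      by apply: le_trans (frac_small j) _; rewrite ler_pM2r// C1_job.
    have h3 : ((Nj j tau)%:R - (Sj j tau)%:R) / mu j <= 2 * H + 5 * C1 * b + 2 * B.
      rewrite mulrBl; lra.
    rewrite ler_pdivrMr// mulrC in h3.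
    by rewrite -(ler_nat R) natrD; have := HQ j; lra.
  have o1 := osc_leP (oscs j) (leq_trans SN NN) NN (leq_trans SN (leq_addr _ _)) NL.
  rewrite !Vn in h1 h2; rewrite Vn QE mulrBl.
  have e : (2 + 3 / mu j) * b = (1 + (mu j)^-1) * b + b + 2 / mu j * b by ring.
  have : 0 <= 2 / mu j * b by rewrite mulr_ge0 ?divr_ge0// ltW.
  move: o1; rewrite e !ler_norml => /andP[? ?] ?; apply/andP; split; lra.
have cl : `|\sum_(j in Ji) Q j tau / mu j - (X tau + Idle tau)| <= (C1 - 1) * b.
  rewrite XI -sumrB.
  have -> : \sum_(j in Ji) (Q j tau / mu j - (partial_sum (v j) (Nj j tau) - T j tau)) =
     \sum_(j in Ji) (if j \in Ji then Q j tau / mu j - (partial_sum (v j) (Nj j tau) - T j tau) else 0).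
    by apply: eq_bigr => j ->.
  apply: sum_C1 => j; case: ifP => [/close//|_].
  by rewrite normr0 mulr_ge0 ?(ltW b_gt0)// addr_ge0// divr_ge0// ltW.
move: cl WY; rewrite !ler_norml => /andP[? ?] /andP[? ?]; have := b_gt0 => ?; apply/andP; split; lra.
Qed.

End PathBound.

(** * The linear program *)

Section LinearProgram.
Context {R : realType} {nI nJ : nat}.
Variables (res : 'I_nJ -> {set 'I_nI}) (theta : 'I_nI -> \bar R) (h mu : 'I_nJ -> R).
Hypotheses (net : network res) (hier : hierarchical res).
Hypotheses (h_gt0 : forall j, 0 < h j) (mu_gt0 : forall j, 0 < mu j).

(** Take a type using [i] with fewest resources. By hierarchy every type using [i] contains its
    resource set, so a second resource [k] in that set would be used by all of them, and the types
    of [i] would be among those of [k]. *)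
Lemma single_job (i : 'I_nI) : exists j, res j = [set i]%SET.
Proof.
have [_ jobs_neq0 jobs_sub] := net.
have /finset.set0Pn[j0 ij0] := jobs_neq0 i.
pose j := [arg min_(j < j0 in jobs_of res i) #|res j|].
have [ij jmin] : j \in jobs_of res i /\ forall l, l \in jobs_of res i -> (#|res j| <= #|res l|)%N.
  by rewrite /j; case: arg_minnP => // l il lmin; split.
exists j; apply/eqP; rewrite finset.eqEsubset finset.sub1set; move: (ij); rewrite inE => ->; rewrite andbT.
apply/fintype.subsetP => k kj; rewrite inE; apply/negPn/negP => ki.
have ik : i != k by rewrite eq_sym.
have /negP := jobs_sub i k ik; apply.
apply/fintype.subsetP => l il; rewrite inE.
have := @hier j l; move: (il) (ij); rewrite !inE => il' ij'.
have -> : (res j :&: res l)%SET != finset.set0 by apply/finset.set0Pn; exists i; rewrite inE ij' il'.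
move=> /(_ isT)/orP[/fintype.subsetP/(_ k kj)//|lj].
have lj2 : (#|res j| <= #|res l|)%N by apply: jmin; rewrite inE.
have /eqP -> // : res l == res j by rewrite finset.eqEcard lj.
Qed.

Local Notation heavy := (heavy theta).

Lemma heavy_job (i : heavy) j : j \in jobs_of res (val i) -> j \in heavy_jobs res theta.
Proof.
rewrite !inE => ij; apply/finset.set0Pn; exists (val i).
by rewrite inE ij/= (valP i).
Qed.

Local Notation lp := (lp_value res h mu).

Lemma lp_value_le (w : heavy -> R) (q : 'I_nJ -> R) :
  (forall i : heavy, \sum_(j in jobs_of res (val i)) q j / mu j = w i) ->
  (forall j, j \in heavy_jobs res theta -> 0 <= q j) ->
  (lp w <= (\sum_(j in heavy_jobs res theta) h j * q j)%:E)%E.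
Proof. by move=> qw q0; apply: ereal_inf_lbound; exists q. Qed.

Lemma lp_value_ge0 (w : heavy -> R) : (0 <= lp w)%E.
Proof.
apply: le_ereal_inf_tmp => _ [q [_ q0] <-]; rewrite lee_fin; apply: sumr_ge0 => j jH.
by rewrite mulr_ge0 ?q0// ltW.
Qed.

Let s_ (i : 'I_nI) : 'I_nJ := projT1 (cid (single_job i)).
Let sP i : res (s_ i) = [set i]%SET. Proof. exact: (projT2 (cid (single_job i))). Qed.

(** Cost of one unit of work on each heavy resource, bought with its dedicated type [s_], times the
    factor [1 + nJ] by which the deficit can exceed the perturbation. *)
Let Clp := \sum_(k : heavy) h (s_ (val k)) * mu (s_ (val k)) * (1 + nJ%:R).

Let Ck_ge0 (k : heavy) : 0 <= h (s_ (val k)) * mu (s_ (val k)) * (1 + nJ%:R).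
Proof.
apply: mulr_ge0; last exact: addr_ge0.
by apply: mulr_ge0; exact: ltW.
Qed.

(** From a plan for [w'], lower every work content by [e] and clip at zero, so that no resource
    carries more than [w]; then fill the deficits [g], at most [(1 + nJ) e], with jobs that use a
    single resource and so disturb no other constraint. *)
Lemma lp_value_perturb (w w' : heavy -> R) (q' : 'I_nJ -> R) (e : R) : 0 <= e ->
  (forall i, 0 <= w i) -> (forall i, `|w i - w' i| <= e) ->
  (forall i : heavy, \sum_(j in jobs_of res (val i)) q' j / mu j = w' i) ->
  (forall j, j \in heavy_jobs res theta -> 0 <= q' j) ->
  (lp w <= (\sum_(j in heavy_jobs res theta) h j * q' j + Clp * e)%:E)%E.
Proof.
move=> e0 w0 ww' qw' q'0.
pose p j := Num.max (q' j / mu j - e) 0.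
have p0 j : 0 <= p j by rewrite le_max lexx orbT.
pose g (k : heavy) := w k - \sum_(j in jobs_of res (val k)) p j.
have g0 k : 0 <= g k.
  rewrite subr_ge0.
  (* If one clipped term survives, it alone pays the full shift [e], which covers the gap between
     [w'] and [w]; otherwise the whole sum is zero. *)
  have [[j [jk pj]]|np] := pselect (exists j, j \in jobs_of res (val k) /\ p j != 0).
    have pjE : p j = q' j / mu j - e.
      by move: pj; rewrite /p maxEle; case: ifP => // _; rewrite eqxx.
    have : \sum_(l in jobs_of res (val k)) p l <= w' k - e.
      rewrite -qw' (bigD1 j)//= [in leRHS](bigD1 j)//= pjE [leRHS]addrAC lerD2l.
      apply: ler_sum => l /andP[lk _]; rewrite ge_max.
      have l0 : 0 <= q' l / mu l by rewrite divr_ge0 ?(ltW (mu_gt0 l))// q'0// (heavy_job lk).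
      by rewrite l0 andbT lerBlDr lerDl.
    have := ww' k; rewrite ler_norml => /andP[? ?]; lra.
  rewrite big1// => j jk; apply/eqP/negPn/negP => pj; apply: np; exists j; split => //.
have ge k : g k <= (1 + nJ%:R) * e.
  have : w' k - nJ%:R * e <= \sum_(j in jobs_of res (val k)) p j.
    rewrite -qw' lerBlDr.
    apply: (@le_trans _ _ (\sum_(j in jobs_of res (val k)) (p j + e))).
      by apply: ler_sum => j _; rewrite -lerBlDr le_max lexx.
    rewrite big_split/= lerD2l.
    apply: (@le_trans _ _ (\sum_(j < nJ) e)).
      by rewrite big_mkcond/=; apply: ler_sum => j _; case: ifP.
    by rewrite sumr_const card_ord -[leLHS]mulr_natl.
  have := ww' k; rewrite ler_norml /g => /andP[? ?]; lra.
pose q j := mu j * p j + \sum_(k : heavy | s_ (val k) == j) mu j * g k.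
apply: (@le_trans _ _ (\sum_(j in heavy_jobs res theta) h j * q j)%:E).
  apply: lp_value_le.
    move=> i.
    have -> : \sum_(j in jobs_of res (val i)) q j / mu j =
        \sum_(j in jobs_of res (val i)) p j + \sum_(j in jobs_of res (val i)) \sum_(k : heavy | s_ (val k) == j) g k.
      rewrite -big_split/=; apply: eq_bigr => j _; rewrite /q mulrDl mulrAC divff ?mul1r ?gt_eqF//.
      by congr (_ + _); rewrite -mulr_sumr mulrAC divff ?mul1r// gt_eqF.
    have is_ : s_ (val i) \in jobs_of res (val i) by rewrite inE sP finset.set11.
    suff -> : \sum_(j in jobs_of res (val i)) \sum_(k : heavy | s_ (val k) == j) g k = g i.
      by rewrite /g subrKC.
    rewrite (bigD1 (s_ (val i)) is_)/= [X in _ + X]big1 ?addr0; last first.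
      move=> j /andP[ji js]; rewrite big_pred0// => k; apply/negP => /eqP kj.
      move: ji js; rewrite -kj => kji; have : sval i \in res (s_ (sval k)) 
        by have : s_ (sval k) \in jobs_of res (sval i) by []; rewrite inE.
      by rewrite (sP (val k)) finset.in_set1 => /eqP ->; rewrite eqxx.
    rewrite (big_pred1 i)// => k /=; apply/eqP/eqP => [|->//] ski.
    apply: val_inj; apply/eqP.
    by have := finset.set11 (val k); rewrite -(sP (val k)) ski sP finset.in_set1.
  move=> j _; rewrite addr_ge0 ?mulr_ge0 ?(ltW (mu_gt0 _))// sumr_ge0// => k _.
  by rewrite mulr_ge0// ltW.
rewrite lee_fin.
apply: (@le_trans _ _ (\sum_(j in heavy_jobs res theta) (h j * q' j +
    \sum_(k : heavy | s_ (val k) == j) h (s_ (val k)) * mu (s_ (val k)) * ((1 + nJ%:R) * e)))).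
  apply: ler_sum => j jH; rewrite /q mulrDr lerD//.
    rewrite ler_wpM2l ?(ltW (h_gt0 j))// /p mulrC -ler_pdivlMr// ge_max.
    by rewrite divr_ge0 ?(ltW (mu_gt0 j)) ?q'0// andbT lerBlDr lerDl.
  rewrite mulr_sumr; apply: ler_sum => k /eqP ->.
  by rewrite mulrA ler_wpM2l// mulr_ge0 ?ltW.
rewrite big_split/= lerD2l /Clp mulr_suml.
rewrite [leRHS](_ : _ = \sum_(j < nJ) \sum_(k : heavy | s_ (val k) == j) h (s_ (val k)) * mu (s_ (val k)) * ((1 + nJ%:R) * e)).
  rewrite [leRHS](bigID (mem (heavy_jobs res theta)))/= lerDl sumr_ge0// => j _.
  by apply: sumr_ge0 => k _; rewrite mulrA; apply: mulr_ge0 => //; exact: Ck_ge0.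
rewrite (partition_big (fun k : heavy => s_ (val k)) xpredT)//=.
by apply: eq_bigr => j _; apply: eq_bigr => k _; rewrite mulrA.
Qed.

Lemma lp_value_fin (w : heavy -> R) : (forall i, 0 <= w i) -> lp w \is a fin_num.
Proof.
move=> w0; rewrite ge0_fin_numE ?lp_value_ge0//.
have e0 : 0 <= \sum_i w i by apply: sumr_ge0.
apply: le_lt_trans (ltry _); apply: (lp_value_perturb (w' := fun=> 0) (q' := fun=> 0) e0 w0).
- move=> i; rewrite subr0 ger0_norm// (bigD1 i)//= lerDl; exact: sumr_ge0.
- by move=> i; rewrite big1// => j _; rewrite mul0r.
- by [].
Qed.

(** Clipping the workloads at zero makes the value finite on the whole space, so that its Lipschitz
    property needs no sign conditions; on the orthant it is [lp_value]. *)
Definition lp_real (w : heavy -> R) : R := fine (lp (fun i => Num.max (w i) 0)).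

Lemma lp_real_ge0 w : 0 <= lp_real w.
Proof. by rewrite fine_ge0// lp_value_ge0. Qed.

Lemma lp_realE w : (forall i, 0 <= w i) -> lp w = (lp_real w)%:E.
Proof.
move=> w0; rewrite /lp_real (_ : (fun i => Num.max (w i) 0) = w).
  by rewrite fineK// lp_value_fin.
by apply/funext => i; apply/max_idPl.
Qed.

Lemma lp_real_le w q : (forall i : heavy, \sum_(j in jobs_of res (val i)) q j / mu j = w i) ->
  (forall j, 0 <= q j) -> lp_real w <= \sum_j h j * q j.
Proof.
move=> qw q0.
have w0 i : 0 <= w i by rewrite -qw sumr_ge0// => j _; rewrite divr_ge0// ltW.
rewrite -lee_fin -lp_realE//; apply: (le_trans (lp_value_le qw _)) => //.
rewrite lee_fin [leRHS](bigID (mem (heavy_jobs res theta)))/= lerDl sumr_ge0// => j _.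
by rewrite mulr_ge0// ltW.
Qed.

(** No optimal plan has to exist: [lp_value_perturb] is applied to a plan that is optimal up to [d],
    and [d] tends to 0. *)
Lemma lp_real_lipschitz : exists2 C : R, 0 <= C &
  forall w w', lp_real w - lp_real w' <= C * \sum_i `|w i - w' i|.
Proof.
exists Clp.
  by apply: sumr_ge0 => k _; exact: Ck_ge0.
move=> w w'; rewrite lerBlDl.
pose pw i := Num.max (w i) 0; pose pw' i := Num.max (w' i) 0.
have pw0 i : 0 <= pw i by rewrite le_max lexx orbT.
have pw'0 i : 0 <= pw' i by rewrite le_max lexx orbT.
set e := \sum_i _.
have e0 : 0 <= e by apply: sumr_ge0.
have ee i : `|pw i - pw' i| <= e.
  apply: (@le_trans _ _ `|w i - w' i|); last by rewrite /e (bigD1 i)//= lerDl sumr_ge0.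
  rewrite /pw /pw' !maxEle; case: ifPn; case: ifPn; rewrite -?ltNge => h1 h2; rewrite ?subrr ?normr0//.
  - by rewrite sub0r normrN gtr0_norm// ler_normr; apply/orP; right; lra.
  - by rewrite subr0 gtr0_norm// ler_normr; apply/orP; left; lra.
rewrite -lee_fin /lp_real fineK ?lp_value_fin// -/pw -/pw'.
have f' : lp pw' \is a fin_num by exact: lp_value_fin.
apply/lee_addgt0Pr => d d0.
have [_ [q [qw q0] <-] qd] := lb_ereal_inf_adherent d0 f'.
apply: (le_trans (lp_value_perturb e0 pw0 ee qw q0)).
rewrite -EFinD lee_fin; move: qd; rewrite -/(lp pw') -(fineK f') -EFinD lte_fin /=.
by move=> qd; lra.
Qed.

End LinearProgram.

(** * Exchanging expectation and time *)

Section JointMeasurability.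
Context {R : realType} {d : measure_display} {T : measurableType d}.
Variable P : probability T R.
Notation leb := (@lebesgue_measure R).

Definition right_cont (f : R -> R) := forall t e : R, 0 <= t -> 0 < e -> exists2 del : R, 0 < del &
  forall u, t <= u < t + del -> `|f u - f t| <= e.

Variable y : R -> T -> R.
Hypothesis my : forall t, 0 <= t -> measurable_fun setT (y t).
Hypothesis ry : forall w, right_cont (y ^~ w).
Hypothesis y_ge0 : forall t w, 0 <= t -> 0 <= y t w.

Let cell (n k : nat) : set R := [set t | k%:R / n.+1%:R <= t < k.+1%:R / n.+1%:R].

Let mcell n k : measurable (cell n k).
Proof.
have -> : cell n k = `[k%:R / n.+1%:R, k.+1%:R / n.+1%:R[%classic by apply/seteqP; split => t; rewrite /= in_itv.
exact: measurable_itv.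
Qed.

(** The path is sampled at the right end of the cell of length [1 / (n + 1)] containing the time;
    right continuity makes these jointly measurable functions converge. *)
Let step (n : nat) (z : T * R) : R :=
  if 0 <= z.2 then y ((Num.truncn (z.2 * n.+1%:R)).+1%:R / n.+1%:R) z.1 else 0.

Let cellE n k (t : R) : 0 <= t -> (t \in cell n k) = (Num.truncn (t * n.+1%:R) == k).
Proof.
move=> t0; have tn0 : 0 <= t * n.+1%:R by rewrite mulr_ge0.
have /andP[h1 h2] := truncn_itv tn0.
apply/idP/eqP.
  rewrite inE /cell/= ler_pdivrMr// ltr_pdivlMr// => /andP[h3 h4].
  have := le_lt_trans h1 h4; have := le_lt_trans h3 h2; rewrite !ltr_nat; lia.
by move=> <-; rewrite inE /cell/= ler_pdivrMr// ltr_pdivlMr// h1.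
Qed.

Let mstep n : measurable_fun setT (step n).
Proof.
apply: (@measurable_fun_cvg _ _ _ _ (fun K z => \sum_(k < K) \1_(cell n k) z.2 * y (k.+1%:R / n.+1%:R) z.1)).
- move=> K; apply: measurable_sum => k; apply: measurable_funM.
    have mi : measurable_fun setT (\1_(cell n k) : R -> R) by exact: measurable_indic.
    exact: (measurableT_comp mi measurable_snd).
  have t0 : 0 <= k.+1%:R / n.+1%:R :> R by rewrite divr_ge0.
  exact: (measurableT_comp (my t0) measurable_fst).
- move=> [w t] _; rewrite /step/=; case: ifPn => [t0|t0].
    apply: cvg_near_cst; near=> K.
    have kK : (Num.truncn (t * n.+1%:R) < K)%N by near: K; exact: nbhs_infty_gt.
    rewrite (bigD1 (Ordinal kK))//= indicE (cellE _ _ t0) eqxx mul1r big1 ?addr0// => k kk.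
    rewrite indicE (cellE _ _ t0); case: eqP => [e|]; last by rewrite mul0r.
    by move/eqP : kk; case; apply: val_inj.
  rewrite (_ : (fun K => _) = fun=> 0); first exact: cvg_cst.
  apply/funext => K; apply: big1 => k _; rewrite indicE memNset ?mul0r// /cell/= => /andP[h _].
  by move: t0; rewrite (le_trans _ h)// divr_ge0.
Unshelve. all: by end_near.
Qed.

Lemma measurable_right_cont : measurable_fun setT (fun z : T * R => if 0 <= z.2 then y z.2 z.1 else 0).
Proof.
apply: (@measurable_fun_cvg _ _ _ _ step) => // -[w t] _; rewrite /step/=.
case: ifPn => [t0|t0]; last exact: cvg_cst.
apply/cvgrPdist_le => e e0.
have [del del0 h] := ry w t0 e0.
near=> n; rewrite distrC; apply: h.
have tn0 : 0 <= t * n.+1%:R by rewrite mulr_ge0.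
have /andP[h1 h2] := truncn_itv tn0.
have nd : n.+1%:R^-1 < del by near: n; exact: (near_infty_natSinv_lt (PosNum del0)).
rewrite ler_pdivlMr// (ltW h2)/= ltr_pdivrMr// mulrDl.
have : 1 < del * n.+1%:R by rewrite -ltr_pdivrMr// div1r.
have -> : ((Num.truncn (t * n.+1%:R)).+1%:R : R) = (Num.truncn (t * n.+1%:R))%:R + 1 by rewrite natr1.
lra.
Unshelve. all: by end_near.
Qed.

Variable delta : R.

Definition disc_fun (t : R) (w : T) : R := if 0 <= t then expR (- delta * t) * y t w else 0.

Lemma disc_fun_ge0 t w : 0 <= disc_fun t w.
Proof. by rewrite /disc_fun; case: ifP => // t0; rewrite mulr_ge0 ?expR_ge0// y_ge0. Qed.

Let mdisc : measurable_fun setT (fun z : T * R => (disc_fun z.2 z.1)%:E).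
Proof.
apply/measurable_EFinP.
rewrite (_ : (fun z => _) = (fun z : T * R => expR (- delta * z.2) * (if 0 <= z.2 then y z.2 z.1 else 0))).
  apply: measurable_funM; last exact: measurable_right_cont.
  apply: measurableT_comp => //; apply: measurable_funM => //; exact: measurable_snd.
by apply/funext => z; rewrite /disc_fun; case: ifP => //; rewrite mulr0.
Qed.

Lemma measurable_disc : measurable_fun setT (fun t => \int[P]_w (disc_fun t w)%:E)%E.
Proof.
apply: (@measurable_fun_fubini_tonelli_G _ _ T _ R P (fun z : T * R => (disc_fun z.2 z.1)%:E)) => //.
by move=> z; rewrite lee_fin disc_fun_ge0.
Qed.

(** Tonelli applies to the version [y]. The time integral of [Y] agrees with a measurable function
    only almost surely, and completeness of [P] is what makes it measurable. *)
Lemma discounted_swap (Y : R -> T -> \bar R) : measure_is_complete P ->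
  {ae P, forall w, forall t, 0 <= t -> Y t w = (y t w)%:E} ->
  discounted P delta Y = (\int[leb]_t \int[P]_w (disc_fun t w)%:E)%E.
Proof.
move=> cP aeY.
have f0 : forall z : T * R, (0 <= (disc_fun z.2 z.1)%:E)%E by move=> z; rewrite lee_fin disc_fun_ge0.
have := @fubini_tonelli _ _ T _ R P leb (fun z : T * R => (disc_fun z.2 z.1)%:E) mdisc f0.
rewrite /fubini_F /fubini_G /= => <-.
rewrite /discounted.
pose F w := (\int[leb]_t (disc_fun t w)%:E)%E.
have mF : measurable_fun setT F.
  exact: (@measurable_fun_fubini_tonelli_F _ _ T _ R leb (fun z : T * R => (disc_fun z.2 z.1)%:E)).
have aeF : ae_eq P setT F (fun w => \int[leb]_(t in `[0%R, +oo[) ((expR (- delta * t))%:E * Y t w))%E.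
  apply: filterS aeY => w Yw _; rewrite /F [RHS]integral_mkcond; apply: eq_integral => t _.
  rewrite /disc_fun patchE; case: ifPn => t0.
    by rewrite mem_set ?Yw//= in_itv/= t0.
  by rewrite memNset//= in_itv/= (negbTE t0).
apply: ae_eq_integral => //; last exact: ae_eq_sym.
exact: (ae_measurable_fun cP aeF mF).
Qed.

End JointMeasurability.

(** * Characteristic functions of the netput and of the Brownian motion *)

Section IndependentFamilies.
Context {R : realType} {d : measure_display} {T : measurableType d}.
Variable P : probability T R.

Lemma mutual_indep_family (K : eqType) (I : finType) (F : K -> set_system T) (g : I -> K) :
  injective g -> mutually_independent P F -> indep_family P (fun i => F (g i)).
Proof.
move=> gi mF A FA.
pose A' k := if [pick i | g i == k] is Some i then A i else setT.
have A'g i : A' (g i) = A i.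
  rewrite /A'; case: pickP => [j /eqP/gi -> //|/(_ i)]; by rewrite eqxx.
transitivity (P (\bigcap_(k in [set` [seq g i | i <- enum I]]) A' k)); last first.
  rewrite mF; [|by rewrite map_inj_uniq// enum_uniq|]; last by move=> k /mapP[i _ ->]; rewrite A'g; exact: FA.
  by rewrite big_map big_enum; apply: eq_bigr => i _; rewrite A'g.
suff -> : \bigcap_i A i = \bigcap_(k in [set` [seq g i | i <- enum I]]) A' k by [].
apply/seteqP; split => w /= Aw.
  by move=> k /mapP[i _ ->]; rewrite A'g; exact: Aw.
by move=> i _; rewrite -A'g; apply: Aw; rewrite /= map_f// mem_enum.
Qed.

Lemma indep_familyS (I : finType) (F G : I -> set_system T) :
  (forall i, F i `<=` G i) -> indep_family P G -> indep_family P F.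
Proof. by move=> FG h A FA; apply: h => i; exact/FG/FA. Qed.

Lemma indep_family_rv (I : finType) (x : I -> T -> R) (F : I -> set_system T) (i0 : I) (f : T -> R) :
  (forall i, F i `<=` measurable) -> (forall i, F i setT) -> (forall i, setI_closed (F i)) ->
  indep_family P F -> preimage_set_system setT (x i0) measurable `<=` F i0 ->
  gmeas (\bigcup_(i in [set i | i != i0]) F i) f -> rv_indep P f (x i0).
Proof.
move=> Fm FT FI iF xF mf A B mA mB.
apply: (indep_group (i0 := i0) Fm FT FI iF); first exact: (gmeas_preimage mf mA).
by apply: xF; exists B => //; rewrite setTI.
Qed.

Lemma preimage_system_measurable (x : T -> R) : measurable_fun setT x ->
  preimage_set_system setT x measurable `<=` @measurable _ T.
Proof. by move=> mx _ [B mB <-]; exact: mx. Qed.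

Lemma preimage_systemT (x : T -> R) : preimage_set_system setT x measurable setT.
Proof. by exists setT => //; rewrite setTI preimage_setT. Qed.

Lemma preimage_systemI (x : T -> R) : setI_closed (preimage_set_system setT x measurable).
Proof.
move=> _ _ [A mA <-] [B mB <-]; exists (A `&` B); first exact: measurableI.
by rewrite !setTI preimage_setI.
Qed.

Lemma preimage_system_comp (x : T -> R) (h : R -> R) : measurable_fun setT h ->
  preimage_set_system setT (h \o x) measurable `<=` preimage_set_system setT x measurable.
Proof.
move=> mh _ [B mB <-]; exists (h @^-1` B) => //.
by rewrite -[X in measurable X]setTI; exact: mh.
Qed.

Lemma integr_meas_ident (X Y : T -> R) (f : R -> R) : measurable_fun setT X -> measurable_fun setT Y ->
  measurable_fun setT f -> (forall B, measurable B -> P (X @^-1` B) = P (Y @^-1` B)) ->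
  integr P (fun w => f (Y w)) ->
  integr P (fun w => f (X w)) /\ Ex P (fun w => f (X w)) = Ex P (fun w => f (Y w)).
Proof.
move=> mX mY mf XY fY.
pose X' : {mfun T >-> R} := HB.pack X (isMeasurableFun.Build _ _ _ _ X mX).
pose Y' : {mfun T >-> R} := HB.pack Y (isMeasurableFun.Build _ _ _ _ Y mY).
have E (g : R -> \bar R) : (\int[distribution P X']_z g z = \int[distribution P Y']_z g z)%E.
  by apply: eq_measure_integral => B mB _; exact: XY.
have fX : integr P (fun w => f (X w)).
  move/integrableP : fY => [mfY fY]; apply/integrableP; split.
    by apply/measurable_EFinP; exact: measurableT_comp.
  have mg : measurable_fun [set: R] (fun z => `|(f z)%:E|)%E.
    by apply: measurableT_comp => //; exact/measurable_EFinP.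
  have := @ge0_integral_distribution _ _ _ _ _ P X' (fun z => `|(f z)%:E|)%E mg (fun=> abse_ge0 _).
  by move=> /= <-; rewrite E ge0_integral_distribution.
split=> //; rewrite /Ex /Rintegral; congr fine.
have mg : measurable_fun [set: R] (fun z => (f z)%:E) by exact/measurable_EFinP.
have := @integral_distribution _ _ _ _ _ P X' _ mg fX.
move=> /= <-; rewrite E.
exact: (@integral_distribution _ _ _ _ _ P Y' _ mg fY).
Qed.

(** The filtration is generated by the first [n] variables; independence of the next one is
    [indep_family_rv] on ['I_n.+1] with [ord_max] singled out. Moments are known at index 0 and
    transported by equality of laws. *)
Lemma iid_centered_walk (X : nat -> T -> R) (m s2 : R) : (forall n, measurable_fun setT (X n)) ->
  iid P X -> integr P (fun w => (X 0%N w - m) ^+ 4) -> Ex P (fun w => X 0%N w - m) = 0 ->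
  Ex P (fun w => (X 0%N w - m) ^+ 2) = s2 ->
  integr P (fun w => X 0%N w - m) -> integr P (fun w => (X 0%N w - m) ^+ 2) ->
  centered_walk P (fun n w => X n w - m)
    (fun n => \bigcup_(k in [set k | (k < n)%N]) preimage_set_system setT (fun w => X k w - m) measurable)
    s2 (Ex P (fun w => (X 0%N w - m) ^+ 4)).
Proof.
move=> mX [iX dX] i4 e1 e2 i1 i2.
have mXm n : measurable_fun setT (fun w => X n w - m) by exact: measurable_funB.
have mp (p : nat) : measurable_fun setT (fun z : R => (z - m) ^+ p).
  by apply: measurable_funX; exact: measurable_funB.
have id n p := fun h => integr_meas_ident (mX n) (mX 0%N) (mp p) (fun B mB => dX n B mB) h.
split.
- by move=> n A [k _ xA]; exact: (preimage_system_measurable (mXm k) xA).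
- by move=> k n kn; apply: gmeas_gen => A xA; exists k.
- move=> n f mf.
  apply: (@indep_family_rv 'I_n.+1 (fun k w => X k w - m)
     (fun k => preimage_set_system setT (fun w => X k w - m) measurable) ord_max).
  + by move=> k; exact: preimage_system_measurable.
  + by move=> k; exact: preimage_systemT.
  + by move=> k; exact: preimage_systemI.
  + apply: (indep_familyS _ (mutual_indep_family (@ord_inj n.+1) iX)) => k A xA.
    apply: sub_sigma_algebra; exists (k : nat) => //.
    have mh : measurable_fun setT (fun z : R => z - m) by exact: measurable_funB.
    exact: (preimage_system_comp mh xA).
  + by [].
  + apply: gmeasS mf; apply: sub_sigma_algebra2 => A [k /= kn xA].
    have kn' : (k < n.+1)%N by exact: ltnW.
    exists (Ordinal kn') => //=; apply/eqP => e; move: kn.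
    by rewrite -[k]/(nat_of_ord (Ordinal kn')) e ltnn.
- by move=> n; have [] := id n 4%N i4.
- by move=> n; have [] := id n 1%N i1; rewrite /= => _ e; rewrite -e1; exact: e.
- by move=> n; have [_ ->] := id n 2%N i2.
- by move=> n; have [_ ->] := id n 4%N i4.
Qed.

End IndependentFamilies.

(** * Moments from the moment generating function *)

Section Moments.
Context {R : realType} {d : measure_display} {T : measurableType d}.
Variable P : probability T R.

(** The bound [exp (z / 4) >= z / 4] gives [z^4 <= 256 (exp z + exp (- z))]; at [z = a X] with
    [a = abar / 2] both exponentials are integrable. The factor 8 comes from
    [(x - m)^4 <= 8 x^4 + 8 m^4]. *)
Lemma mgf_moments (X : {RV P >-> R}) (m abar : R) : 0 < abar ->
  (forall a, - abar < a < abar -> ('M_P X a < +oo)%E) ->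
  ('E_P[X] = m%:E)%E ->
  [/\ integr P (fun w => X w - m), integr P (fun w => (X w - m) ^+ 2),
    integr P (fun w => (X w - m) ^+ 4) & Ex P (fun w => X w - m) = 0].
Proof.
move=> a0 Xa Xm.
pose a := abar / 2.
have ap : 0 < a by rewrite divr_gt0.
have iexp c : - abar < c < abar -> integr P (fun w => expR (c * X w)).
  move=> cP; have := Xa c cP; rewrite /mmt_gen_fun unlock => h; apply/integrableP; split.
    by apply/measurable_EFinP; apply: measurableT_comp => //; exact: measurable_funM.
  apply: le_lt_trans h; apply: ge0_le_integral => //.
  - by apply/measurable_EFinP; do 2 apply: measurableT_comp => //; exact: measurable_funM.
  - by apply/measurable_EFinP; apply: measurableT_comp => //; exact: measurable_funM.
  - by move=> w _; rewrite lee_fin /= ger0_norm ?expR_ge0// mulrC.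
have exp4 (z : R) : z ^+ 4 <= 256 * (expR z + expR (- z)).
  wlog z0 : z / 0 <= z.
    move=> h; have [/h //|/ltW] := leP 0 z.
    by rewrite -oppr_ge0 => /h; rewrite opprK exprNn -signr_odd/= expr0 mul1r addrC.
  have e1 : 0 <= expR (- z) by exact: expR_ge0.
  have : (z / 4) ^+ 4 <= expR z.
    have -> : expR z = expR (z / 4) ^+ 4 by rewrite -expRM_natl; congr expR; field.
    have z4 : 0 <= z / 4 by rewrite divr_ge0.
    rewrite lerXn2r ?nnegrE ?expR_ge0//; have := expR_ge1Dx (z / 4); lra.
  have -> : (z / 4) ^+ 4 = z ^+ 4 / 256 by field.
  lra.
have i4 : integr P (fun w => (X w - m) ^+ 4).
  pose C := 8 * (256 / a ^+ 4).
  apply: (@integr_le _ _ _ P _ (fun w => C * (expR (a * X w) + expR (- a * X w)) + 8 * m ^+ 4)).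
  - by apply: measurable_funX; exact: measurable_funB.
  - move=> w; rewrite ger0_norm; last by rewrite -[4%N]/(2 * 2)%N exprM sqr_ge0.
    have h := exp4 (a * X w); rewrite exprMn in h.
    have h1 : X w ^+ 4 <= 256 / a ^+ 4 * (expR (a * X w) + expR (- a * X w)).
      by rewrite -mulrA [(a ^+ 4)^-1 * _]mulrC mulrA ler_pdivlMr ?exprn_gt0// [leLHS]mulrC mulNr.
    have h2 : (X w - m) ^+ 4 <= 8 * X w ^+ 4 + 8 * m ^+ 4.
      move: (X w) => x; have q : (x - m) ^+ 2 <= 2 * (x ^+ 2 + m ^+ 2).
        by have := sqr_ge0 (x + m); rewrite sqrrD sqrrB; lra.
      have q' : 0 <= (x - m) ^+ 2 by exact: sqr_ge0.
      have -> : (x - m) ^+ 4 = ((x - m) ^+ 2) ^+ 2 by rewrite -exprM.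
      have : ((x - m) ^+ 2) ^+ 2 <= (2 * (x ^+ 2 + m ^+ 2)) ^+ 2.
        by rewrite lerXn2r ?nnegrE//; exact: le_trans q.
      have := sqr_ge0 (x ^+ 2 - m ^+ 2).
      have -> : (x ^+ 2 - m ^+ 2) ^+ 2 = x ^+ 4 + m ^+ 4 - 2 * (x ^+ 2 * m ^+ 2) by ring.
      have -> : (2 * (x ^+ 2 + m ^+ 2)) ^+ 2 = 4 * (x ^+ 4 + m ^+ 4) + 8 * (x ^+ 2 * m ^+ 2) by ring.
      lra.
    rewrite /C; lra.
  - apply: integrD; last exact: integr_cst.
    apply: integrZ; apply: integrD; apply: iexp; rewrite /a; lra.
have mXm : measurable_fun setT (fun w => X w - m) by exact: measurable_funB.
have le4 (z : R) : `|z| <= 1 + z ^+ 4 /\ z ^+ 2 <= 1 + z ^+ 4.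
  have h := sqr_ge0 (z ^+ 2 - 1); have h' := sqr_ge0 (z ^+ 2 - 1 / 2).
  have e : (z ^+ 2) ^+ 2 = z ^+ 4 by rewrite -exprM.
  have := sqr_ge0 (`|z| - 1 / 2); rewrite !sqrrB real_normK ?num_real// in h h' *.
  rewrite !expr1n e in h h' *; split; lra.
have i1 : integr P (fun w => X w - m).
  apply: (@integr_le _ _ _ P _ (fun w => 1 + (X w - m) ^+ 4)) => //.
    by move=> w; have [] := le4 (X w - m).
  by apply: integrD => //; exact: integr_cst.
have iX : integr P (fun w => X w).
  have -> : (fun w => X w) = (fun w => (X w - m) + m) by apply/funext => w; rewrite subrK.
  by apply: integrD => //; exact: integr_cst.
split => //.
  apply: (@integr_le _ _ _ P _ (fun w => 1 + (X w - m) ^+ 4)) => //.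
  - exact: measurable_funX.
  - by move=> w; rewrite ger0_norm ?sqr_ge0//; have [] := le4 (X w - m).
  - by apply: integrD => //; exact: integr_cst.
rewrite ExB//; last exact: integr_cst.
rewrite Ex_cst; apply/eqP; rewrite subr_eq0; apply/eqP.
by move: Xm; rewrite /Ex /Rintegral unlock => ->.
Qed.

Lemma variance_second_moment (X : {RV P >-> R}) (m s2 : R) : integr P (fun w => (X w - m) ^+ 2) ->
  ('E_P[X] = m%:E)%E -> ('V_P[X] = s2%:E)%E -> Ex P (fun w => (X w - m) ^+ 2) = s2.
Proof.
move=> i2 Xm; rewrite /variance unlock Xm /= unlock => h.
by rewrite /Ex /Rintegral -[RHS]/(fine s2%:E) -h; congr fine; apply: eq_integral => w _; rewrite /= expr2.
Qed.

End Moments.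

(** * All walks and the initial state as one independent family *)

Section WalkFamily.
Context {R : realType} {d : measure_display} {T : measurableType d}.
Variable P : probability T R.

Lemma sigma_fin_bigcap (I : finType) (G : set_system T) (A : I -> set T) :
  (forall i, <<s G >> (A i)) -> <<s G >> (\bigcap_i A i).
Proof.
move=> GA; have := @fin_bigcap_measurable _ (g_sigma_algebraType G) I setT A.
by apply; [exact: finite_finset|move=> i _; exact: GA].
Qed.

(** Three layers are flattened into one: initial state against primitives, sequences against each
    other, and variables within a sequence. The index [None] stands for the initial state. *)
Lemma indep_family_walks (A : finType) (x : A -> nat -> T -> R) (F0 : set_system T) (N : nat) :
  (forall a n, measurable_fun setT (x a n)) ->
  independent P F0 (sigma_of (fun p : A * nat => x p.1 p.2) setT) ->
  mutually_independent P (fun a => sigma_of (x a) setT) ->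
  (forall a, mutually_independent P (fun n => sigma_of (x a) [set n])) ->
  F0 `<=` measurable ->
  indep_family P (fun o : option (A * 'I_N) =>
    if o is Some p then preimage_set_system setT (x p.1 p.2) measurable else F0).
Proof.
move=> mx i0 iA iN F0m B FB.
have BS a (n : 'I_N) := FB (Some (a, n)).
have BN := FB None; rewrite /= in BN.
have xa a : sigma_of (x a) setT (\bigcap_n B (Some (a, n))).
  apply: sigma_fin_bigcap => n; apply: sub_sigma_algebra; exists (n : nat) => //; exact: BS.
have all : sigma_of (fun p : A * nat => x p.1 p.2) setT (\bigcap_a \bigcap_n B (Some (a, n))).
  apply: sigma_fin_bigcap => a; apply: sigma_fin_bigcap => n; apply: sub_sigma_algebra.
  by exists (a, n : nat) => //; exact: BS.
rewrite (_ : \bigcap_o B o = B None `&` \bigcap_a \bigcap_n B (Some (a, n))); last first.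
  apply/seteqP; split => w /=; first by move=> h; split => [|a _ n _]; exact: h.
  by move=> [h1 h2] [[a n]|] _; [exact: h2|].
rewrite i0// (bigD1 None)//=; congr (_ * _)%E.
have eA : P (\bigcap_a \bigcap_n B (Some (a, n))) = (\prod_a P (\bigcap_n B (Some (a, n))))%E.
  exact: (mutual_indep_family (g := id) (fun _ _ e => e) iA).
rewrite eA (_ : \prod_(a : A) _ = \prod_(a : A) \prod_(n : 'I_N) P (B (Some (a, n))))%E; last first.
  apply: eq_bigr => a _.
  apply: (mutual_indep_family (@ord_inj N) (iN a)) => n.
  by apply: sub_sigma_algebra; exists (n : nat) => //; exact: BS.
rewrite pair_big/= [RHS](reindex_omap (Some : A * 'I_N -> option _) id)//=; last by case.
by apply: eq_big => [p|[a n] _]//=; rewrite eqxx.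
Qed.

Lemma cos_walks (A : finType) (x : A -> nat -> T -> R) (F0 : set_system T) (N : nat) (s2 : A -> R)
    (C : R) (Z : T -> R) (c : A * 'I_N -> R) (b : R) :
  (forall a n, [/\ integr P (x a n), integr P (fun w => x a n w ^+ 2),
     integr P (fun w => x a n w ^+ 4), Ex P (x a n) = 0 & Ex P (fun w => x a n w ^+ 2) = s2 a]) ->
  (forall a n, 2 * (1 + Ex P (fun w => x a n w ^+ 4)) + s2 a ^+ 2 <= C) ->
  F0 `<=` measurable -> F0 setT -> setI_closed F0 -> preimage_set_system setT Z measurable `<=` F0 ->
  indep_family P (fun o : option (A * 'I_N) =>
    if o is Some p then preimage_set_system setT (x p.1 p.2) measurable else F0) ->
  (forall p, `|c p| <= 1) ->
  `|Ex P (fun w => cos (Z w + \sum_p c p * x p.1 p.2 w + b))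
    - expR (- (\sum_p c p ^+ 2 * s2 p.1 / 2)) * Ex P (fun w => cos (Z w + b))|
  <= \sum_p C * `|c p| ^+ 3.
Proof.
move=> xP xC F0m F0T F0I ZF iF c1.
have mx a n : measurable_fun setT (x a n) by have [ix _ _ _ _] := xP a n; exact: integr_measurable ix.
have mZ : measurable_fun setT Z by move=> _ B mB; apply: F0m; apply: (ZF (setT `&` Z @^-1` B)); exists B.
apply: (@cos_sum_approx _ _ _ P _ (fun p : A * 'I_N => x p.1 p.2) Z (fun p => s2 p.1) c (fun=> C) b) => //.
- move=> k s' /= /andP[ks _].
  apply: (@indep_family_rv _ _ _ P _ (fun o : option (A * 'I_N) => if o is Some p then x p.1 p.2 else Z)
    (fun o => if o is Some p then preimage_set_system setT (x p.1 p.2) measurable else F0) (Some k)) => //.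
  + by move=> [p|] //; exact: preimage_system_measurable.
  + by move=> [p|] //; exact: preimage_systemT.
  + by move=> [p|] //; exact: preimage_systemI.
  + apply: gmeasD; first by apply: gmeas_gen => B /ZF ZB; exists None.
    suff h s1 : k \notin s1 -> gmeas (\bigcup_(i in [set i | i != Some k])
        (if i is Some p then preimage_set_system setT (x p.1 p.2) measurable else F0))
        (fun w => \sum_(i <- s1) c i * x i.1 i.2 w) by exact: h.
    elim: s1 => [_|p s1 ih].
      rewrite (_ : (fun w => _) = (fun=> 0)); last by apply/funext => w; rewrite big_nil.
      exact: gmeas_cst.
    rewrite in_cons negb_or => /andP[kp ks1].
    rewrite (_ : (fun w => _) = (fun w => c p * x p.1 p.2 w + \sum_(i <- s1) c i * x i.1 i.2 w)); last first.
      by apply/funext => w; rewrite big_cons.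
    apply: gmeasD; last exact: ih.
    apply: gmeasM; first exact: gmeas_cst.
    by apply: gmeas_gen => B xB; exists (Some p) => //=; rewrite eq_sym; apply: contra kp => /eqP[->].
- exact: index_enum_uniq.
Qed.

End WalkFamily.

(** * Limit of the cosine transform of the scaled walks *)

Section Prelimit.
Context {R : realType}.

Lemma sum_indicator (n N : nat) (f : nat -> R) : (n <= N)%N ->
  \sum_(i < N) (i < n)%N%:R * f i = \sum_(i < n) f i.
Proof.
move=> nN; rewrite (big_ord_widen N f nN) [RHS]big_mkcond/=.
by apply: eq_bigr => i _; case: ifP; rewrite ?mul1r ?mul0r.
Qed.

(** The indices below both clocks number [n (minn k l)], the covariance kernel of Brownian motion.
    The clocks themselves give the prelimit variance, and [n = id] rewrites the limit over grid
    increments. *)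
Lemma min_gram (m N : nat) (al : 'I_m.+1 -> R) (n : nat -> nat) : {homo n : k l / (k <= l)%N} ->
  (n m <= N)%N ->
  \sum_(q < N) (\sum_k al k * (q < n k)%N%:R) ^+ 2 = \sum_k \sum_l al k * al l * (n (minn k l))%:R.
Proof.
move=> nm nN; under eq_bigr do rewrite expr2 big_distrlr/=.
rewrite exchange_big; apply: eq_bigr => k _; rewrite exchange_big; apply: eq_bigr => l _ /=.
have h : (n (minn k l) <= N)%N.
  by apply: leq_trans nN; apply: nm; rewrite geq_min -ltnS ltn_ord.
have -> : al k * al l * (n (minn k l))%:R = \sum_(q < N) (q < n (minn k l))%N%:R * (al k * al l).
  by rewrite (sum_indicator (fun=> al k * al l) h) sumr_const card_ord mulr_natr.
apply: eq_bigr => q _; rewrite mulrACA mulrC; congr (_ * _); rewrite -natrM mulnb; congr (_%:R).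
congr nat_of_bool; case: (leqP k l) => kl.
  by apply/andP/idP => [[]//|h1]; split => //; apply: (leq_trans h1); exact: nm.
by apply/andP/idP => [[]//|h1]; split => //; apply: (leq_trans h1); apply: nm; exact: ltnW.
Qed.

Lemma cvg_invn : (r%:R^-1 : R) @[r --> \oo] --> 0.
Proof.
rewrite gtr0_cvgV0; first exact: cvgr_idn.
by near=> r; rewrite ltr0n; near: r; exact: nbhs_infty_gt.
Unshelve. all: by end_near.
Qed.

Lemma truncn_scaled_cvg (c : R) : 0 <= c ->
  (Num.truncn (c * r%:R ^+ 2))%:R / r%:R ^+ 2 @[r --> \oo] --> c.
Proof.
move=> c0; apply/cvgrPdist_le => e e0; near=> r.
have r0 : (0 < r)%N by near: r; exact: nbhs_infty_gt.
have r1 : 1 <= (r%:R : R) by rewrite ler1n.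
have rp : 0 < (r%:R : R) by lra.
have re : r%:R^-1 <= e.
  by near: r; have := near_infty_natSinv_lt (PosNum e0); move=> [N _ h]; exists N.+1 => // -[|k]//= /h /ltW.
have r2 : 0 < (r%:R : R) ^+ 2 by rewrite exprn_gt0.
have /andP[h1 h2] := truncn_itv (mulr_ge0 c0 (ltW r2)).
rewrite -[X in _ < X]natr1 in h2.
apply: le_trans re; rewrite -[c in `|c - _|](mulfK (lt0r_neq0 r2)) -mulrBl normrM.
rewrite ger0_norm ?subr_ge0// gtr0_norm ?invr_gt0//.
apply: (@le_trans _ _ ((r%:R ^+ 2)^-1)); first by rewrite ler_piMl ?invr_ge0 ?(ltW r2)//; lra.
by rewrite lef_pV2 ?posrE// expr2 ler_peMl// ltW.
Unshelve. all: by end_near.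
Qed.

Context {d : measure_display} {T : measurableType d}.
Variable P : probability T R.
Variables (A : finType) (x : A -> nat -> T -> R) (s2 la : A -> R) (C0 t : R) (m : nat).
Variables (F0 : nat -> set_system T) (Z : nat -> T -> R) (Zl : T -> R).
Hypothesis xP : forall a n, [/\ integr P (x a n), integr P (fun w => x a n w ^+ 2),
     integr P (fun w => x a n w ^+ 4), Ex P (x a n) = 0 & Ex P (fun w => x a n w ^+ 2) = s2 a].
Hypothesis xC : forall a n, 2 * (1 + Ex P (fun w => x a n w ^+ 4)) + s2 a ^+ 2 <= C0.
Hypotheses (F0m : forall r, (0 < r)%N -> F0 r `<=` measurable) (F0T : forall r, F0 r setT)
  (F0I : forall r, setI_closed (F0 r))
  (ZF : forall r, (0 < r)%N -> preimage_set_system setT (Z r) measurable `<=` F0 r).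
Hypothesis iF : forall r N, (0 < r)%N -> indep_family P (fun o : option (A * 'I_N) =>
    if o is Some p then preimage_set_system setT (x p.1 p.2) measurable else F0 r).
Hypotheses (la_ge0 : forall a, 0 <= la a) (t_ge0 : 0 <= t) (m_gt0 : (0 < m)%N).
Hypothesis Zcvg : forall b, Ex P (fun w => cos (Z r w + b)) @[r --> \oo] --> Ex P (fun w => cos (Zl w + b)).
Let nk (a : A) (r k : nat) : nat := Num.truncn (la a * (r%:R ^+ 2 * (t * k%:R / m%:R))).

Let tk_ge0 k : 0 <= t * k%:R / m%:R. Proof. by rewrite !mulr_ge0. Qed.

Let nk_homo a r : {homo nk a r : k l / (k <= l)%N}.
Proof.
move=> k l kl; apply: le_truncn; rewrite ler_wpM2l// ler_wpM2l// ?exprn_ge0//.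
by rewrite ler_wpM2r ?invr_ge0// ler_wpM2l// ler_nat.
Qed.

Variable al : A -> 'I_m.+1 -> R.
(** Half the variance of the scaled linear form; [vl] is its limit, summed over grid intervals in
    the shape that [brownian_grid_cos] produces. *)
Let vr (r : nat) := \sum_a s2 a / 2 * \sum_k \sum_l al a k * al a l * ((nk a r (minn k l))%:R / r%:R ^+ 2).
Let vl := \sum_a s2 a / 2 * (la a * t / m%:R) * \sum_(p < m) (\sum_(k < m.+1 | (p < k)%N) al a k) ^+ 2.

Let vr_cvg : vr r @[r --> \oo] --> vl.
Proof.
rewrite (_ : vl = \sum_a s2 a / 2 * \sum_k \sum_l al a k * al a l * (la a * (t * (minn k l)%:R / m%:R))).
  apply: cvg_big; first exact: add_continuous.
  move=> a _; apply: cvgM; first exact: cvg_cst.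
  apply: cvg_big; first exact: add_continuous.
  move=> k _; apply: cvg_big; first exact: add_continuous.
  move=> l _; apply: cvgM; first exact: cvg_cst.
  have := @truncn_scaled_cvg (la a * (t * (minn k l)%:R / m%:R)) (mulr_ge0 (la_ge0 a) (tk_ge0 _)).
  by apply: cvg_trans; apply: near_eq_cvg; near=> r; congr (_ / _); congr (_%:R); congr Num.truncn; rewrite mulrAC; ring.
apply: eq_bigr => a _; rewrite -mulrA; congr (_ * _).
have := @min_gram m m (al a) id (fun k l e => e) (leqnn m).
rewrite (_ : \sum_(q < m) _ = \sum_(p < m) (\sum_(k < m.+1 | (p < k)%N) al a k) ^+ 2); last first.
  apply: eq_bigr => p _; congr (_ ^+ 2); rewrite [RHS]big_mkcond; apply: eq_bigr => k _.
  by case: ifP; rewrite ?mulr1 ?mulr0.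
move=> ->; rewrite mulr_sumr; apply: eq_bigr => k _; rewrite mulr_sumr; apply: eq_bigr => l _; ring.
Unshelve. all: by end_near.
Qed.

Let D : R := 1 + \sum_a \sum_k `|al a k|.
Let La : R := \sum_a la a * t.
Let C0_ge0 : (A -> 0 <= C0).
Proof.
move=> a; apply: le_trans (xC a 0%N); rewrite addr_ge0 ?sqr_ge0// mulr_ge0// addr_ge0//.
by apply: Ex_ge0 => w; rewrite -[4%N]/(2 * 2)%N exprM sqr_ge0.
Qed.

(** Per walk about [La r^2] variables enter, each with coefficient at most [D / r], so the cubic
    Lindeberg errors total [O(1 / r)]. The condition [D <= r] keeps the coefficients below 1. *)
Lemma prelimit_approx r (b : R) : (0 < r)%N -> D <= r%:R ->
  `|Ex P (fun w => cos (Z r w + r%:R^-1 * (\sum_a \sum_k al a k * partial_sum (x a ^~ w) (nk a r k)) + b))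
   - expR (- vr r) * Ex P (fun w => cos (Z r w + b))| <= \sum_(a : A) C0 * La * D ^+ 3 / r%:R.
Proof.
move=> r0 Dr; have rp : 0 < (r%:R : R) by rewrite ltr0n.
have D1 a : \sum_k `|al a k| <= D.
  rewrite /D (bigD1 a)//= addrCA lerDl addr_ge0// sumr_ge0// => i _; exact: sumr_ge0.
have D0 : 0 <= D by rewrite addr_ge0// sumr_ge0// => a _; exact: sumr_ge0.
pose N := Num.truncn (La * r%:R ^+ 2).
have La0 : 0 <= La by apply: sumr_ge0 => a _; rewrite mulr_ge0.
have nkN a k : (k <= m)%N -> (nk a r k <= N)%N.
  move=> km; apply: le_truncn; rewrite mulrCA mulrC ler_wpM2r ?exprn_ge0//.
  apply: (@le_trans _ _ (la a * t)).
    rewrite ler_wpM2l// -mulrA ler_piMr// ler_pdivrMr ?ltr0n// mul1r ler_nat//.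
  by rewrite /La (bigD1 a)//= lerDl sumr_ge0// => i _; rewrite mulr_ge0.
(* A variable enters every partial sum whose clock exceeds its index; this collects its total
   coefficient. *)
pose c (p : A * 'I_N) := r%:R^-1 * \sum_k al p.1 k * (p.2 < nk p.1 r k)%N%:R.
have cD p : `|c p| <= D / r%:R.
  rewrite /c normrM gtr0_norm ?invr_gt0// [leRHS]mulrC ler_wpM2l ?invr_ge0 ?(ltW rp)//.
  apply: le_trans (D1 p.1); apply: (le_trans (ler_norm_sum _ _ _)); apply: ler_sum => k _.
  by rewrite normrM; case: (_ < _)%N; rewrite ?normr1 ?normr0 ?mulr1 ?mulr0.
have c1 p : `|c p| <= 1 by apply: (le_trans (cD p)); rewrite ler_pdivrMr// mul1r.
have := cos_walks b xP xC (F0m r0) (F0T r) (@F0I r) (ZF r0) (@iF r N r0) c1.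
rewrite (_ : (fun w => cos (Z r w + \sum_p c p * x p.1 p.2 w + b)) =
  (fun w => cos (Z r w + r%:R^-1 * (\sum_a \sum_k al a k * partial_sum (x a ^~ w) (nk a r k)) + b))); last first.
  apply/funext => w; congr (cos (_ + _ + _)).
  rewrite -(pair_bigA _ (fun a n => c (a, n) * x a n w))/= mulr_sumr; apply: eq_bigr => a _.
  rewrite /c/=; under eq_bigr do rewrite -mulrA mulr_suml.
  rewrite -mulr_sumr exchange_big/=; congr (_ * _); apply: eq_bigr => k _.
  rewrite /partial_sum -(sum_indicator (fun n => x a n w) (@nkN a k _)) -1?ltnS//.
  by rewrite mulr_sumr; apply: eq_bigr => n _; rewrite mulrA.
rewrite (_ : \sum_p c p ^+ 2 * s2 p.1 / 2 = vr r); last first.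
  rewrite -(pair_bigA _ (fun a n => c (a, n) ^+ 2 * s2 a / 2))/=; apply: eq_bigr => a _.
  have H := min_gram (al a) (@nk_homo a r) (nkN a m (leqnn m)).
  transitivity (s2 a / 2 * (r%:R ^- 2 * \sum_(n < N) (\sum_k al a k * (n < nk a r k)%N%:R) ^+ 2)).
    rewrite !mulr_sumr; apply: eq_bigr => n _; rewrite /c/= exprMn exprVn; ring.
  rewrite H; congr (_ * _); rewrite mulr_sumr; apply: eq_bigr => k _; rewrite mulr_sumr.
  by apply: eq_bigr => l _; rewrite mulrCA; congr (_ * _); rewrite mulrC.
move=> /le_trans; apply.
rewrite -(pair_bigA _ (fun a n => C0 * `|c (a, n)| ^+ 3))/=; apply: ler_sum => a _.
apply: (@le_trans _ _ (\sum_(n < N) C0 * (D / r%:R) ^+ 3)).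
  apply: ler_sum => n _; rewrite ler_wpM2l ?C0_ge0// lerXn2r ?nnegrE// divr_ge0// ltW.
rewrite sumr_const card_ord -[_ *+ N]mulr_natr -[leLHS]mulrA.
rewrite (_ : C0 * La * D ^+ 3 / r%:R = C0 * ((D / r%:R) ^+ 3 * (La * r%:R ^+ 2))); last by field; rewrite gt_eqF.
apply: ler_wpM2l; first exact: C0_ge0.
have NL : N%:R <= La * r%:R ^+ 2 by rewrite /N truncn_le mulr_ge0// exprn_ge0// ltW.
by rewrite ler_wpM2l// exprn_ge0// divr_ge0// ltW.
Qed.

Lemma prelimit_cvg (b : R) :
  Ex P (fun w => cos (Z r w + r%:R^-1 * (\sum_a \sum_k al a k * partial_sum (x a ^~ w) (nk a r k)) + b))
    @[r --> \oo] --> expR (- vl) * Ex P (fun w => cos (Zl w + b)).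
Proof.
have h1 : (fun r => expR (- vr r) * Ex P (fun w => cos (Z r w + b))) @ \oo -->
    expR (- vl) * Ex P (fun w => cos (Zl w + b)).
  apply: cvgM; last exact: Zcvg.
  by apply: (@cvg_comp _ _ _ (fun r => - vr r) expR); [apply: cvgN; exact: vr_cvg|exact: continuous_expR].
have h2 : (fun r : nat => \sum_(a : A) C0 * La * D ^+ 3 / r%:R) @ \oo --> (0 : R).
  rewrite (_ : (fun r : nat => _) = (fun r => (C0 * La * D ^+ 3 *+ #|A|) * r%:R^-1)); last first.
    by apply/funext => r; rewrite sumr_const mulrnAl.
  rewrite -[X in _ --> X](mulr0 (C0 * La * D ^+ 3 *+ #|A|)); apply: cvgM; first exact: cvg_cst.
  exact: cvg_invn.
apply/cvgrPdist_le => e e0.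
have e2 : 0 < e / 2 by rewrite divr_gt0.
have /cvgrPdist_le/(_ _ e2) n1 := h1; have /cvgrPdist_le/(_ _ e2) n2 := h2.
near=> r.
have r0 : (0 < r)%N by near: r; exact: nbhs_infty_gt.
have Dr : D <= r%:R by near: r; exact: nbhs_infty_ger.
have := prelimit_approx b r0 Dr.
have a1 : `|0 - \sum_(a : A) C0 * La * D ^+ 3 / r%:R| <= e / 2 by near: r.
have a2 : `|expR (- vl) * Ex P (fun w => cos (Zl w + b)) - expR (- vr r) * Ex P (fun w => cos (Z r w + b))| <= e / 2 by near: r.
rewrite sub0r normrN in a1; have {}a1 := le_trans (ler_norm _) a1.
move: a2; rewrite !ler_norml => /andP[? ?] /andP[? ?]; apply/andP; split; lra.
Unshelve. all: by end_near.
Qed.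
End Prelimit.

(** * Cosine transform of Brownian motion on a grid *)

Section BrownianFourier.
Context {R : realType} {d : measure_display} {T : measurableType d}.
Variable P : probability T R.

(** The addition formula and independence reduce this to the cosine and sine transforms of [D]; the
    sine is the cosine with phase [- pi / 2]. *)
Lemma Ex_cos_indep_gaussian (U D : T -> R) (mean s2 b : R) :
  measurable_fun setT U -> measurable_fun setT D -> rv_indep P U D -> 0 <= s2 ->
  has_gaussian_law P D mean s2 ->
  Ex P (fun w => cos (U w + D w + b)) = expR (- (s2 / 2)) * Ex P (fun w => cos (U w + (mean + b))).
Proof.
move=> mU mD UD s20 gD.
have mUb : measurable_fun setT (fun w => U w + b) by exact: measurable_funD.
have EC : Ex P (fun w => cos (D w)) = expR (- (s2 / 2)) * cos mean.
  have := gaussian_law_cos 1 0 mD s20 gD; rewrite expr1n !mul1r addr0 => <-.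
  by congr Ex; apply/funext => w; rewrite mul1r addr0.
have ES : Ex P (fun w => sin (D w)) = expR (- (s2 / 2)) * sin mean.
  have := gaussian_law_cos 1 (- (pi / 2)) mD s20 gD; rewrite expr1n !mul1r cosBpihalf => <-.
  by congr Ex; apply/funext => w; rewrite mul1r cosBpihalf.
have mc (c : R) : measurable_fun setT (fun z : R => cos (z + c)).
  by apply: measurable_cosT; exact: measurable_funD.
have ms (c : R) : measurable_fun setT (fun z : R => sin (z + c)).
  by apply: measurable_sinT; exact: measurable_funD.
have mc0 : measurable_fun setT (@cos R) by apply: measurable_cosT.
have ms0 : measurable_fun setT (@sin R) by apply: measurable_sinT.
have [i1 e1] := Ex_indep (integr_cos P mUb) (integr_cos P mD) (rv_indep_comp (mc b) mc0 UD).
have [i2 e2] := Ex_indep (integr_sin P mUb) (integr_sin P mD) (rv_indep_comp (ms b) ms0 UD).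
rewrite (_ : (fun w => cos (U w + D w + b)) =
  (fun w => cos (U w + b) * cos (D w) - sin (U w + b) * sin (D w))); last first.
  by apply/funext => w; rewrite -cosD; congr cos; ring.
rewrite ExB// e1 e2 EC ES.
rewrite (_ : (fun w => cos (U w + (mean + b))) =
  (fun w => cos mean * cos (U w + b) - sin mean * sin (U w + b))); last first.
  by apply/funext => w; rewrite [cos mean * _]mulrC [sin mean * _]mulrC -cosD; congr cos; ring.
rewrite ExB ?ExZ//; try (by apply: integrZ); try exact: integr_cos; try exact: integr_sin; first ring.
- by apply: integrZ; exact: integr_cos.
- by apply: integrZ; exact: integr_sin.
Qed.

Variables (K : finType) (drift : K -> R) (cov : K -> K -> R) (X : R -> T -> K -> R).
Hypothesis bX : brownian P drift cov X.
Hypothesis cov_psd : forall b : K -> R, 0 <= \sum_k \sum_l b k * b l * cov k l.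
Variables (t : R) (m : nat) (a : K -> 'I_m.+1 -> R).
Hypotheses (t_gt0 : 0 < t) (m_gt0 : (0 < m)%N).
Let tk (k : nat) : R := t * k%:R / m%:R.
Let be (p : nat) (i : K) : R := \sum_(k < m.+1 | (p < k)%N) a i k.

Let mR : 0 < (m%:R : R). Proof. by rewrite ltr0n. Qed.
Let tk0 k : 0 <= tk k. Proof. by rewrite /tk !mulr_ge0// ?invr_ge0// ltW. Qed.
Let tkS k : tk k.+1 - tk k = t / m%:R.
Proof. by rewrite /tk -[k.+1%:R]natr1; ring. Qed.
Let tk_lt k : tk k < tk k.+1. Proof. by rewrite -subr_gt0 tkS divr_gt0. Qed.
Let tk_le k l : (k <= l)%N -> tk k <= tk l.
Proof. by move=> kl; rewrite /tk ler_wpM2r ?invr_ge0// ler_wpM2l ?ler_nat// ltW. Qed.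

(** Summation by parts: the tail sum [be p] is the coefficient of the [p]-th increment. Stopping at
    [q] keeps [U q] measurable for the past of [tk q], so increments split off one by one. *)
Let U (q : nat) (w : T) : R := \sum_i (\sum_k a i k) * X 0 w i +
  \sum_(p < q) \sum_i be p i * (X (tk p.+1) w i - X (tk p) w i).

Let UE w : U m w = \sum_i \sum_k a i k * X (tk k) w i.
Proof.
rewrite /U exchange_big -big_split; apply: eq_bigr => i _ /=.
transitivity (\sum_k a i k * (X 0 w i + \sum_(p < m) (p < k)%N%:R * (X (tk p.+1) w i - X (tk p) w i))).
  under [RHS]eq_bigr do rewrite mulrDr.
  rewrite big_split/= mulr_suml; congr (_ + _).
  under [RHS]eq_bigr do rewrite mulr_sumr.
  rewrite exchange_big/=; apply: eq_bigr => p _; rewrite /be mulr_suml big_mkcond/=.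
  by apply: eq_bigr => k _; case: ifP; rewrite ?mul1r ?mul0r ?mulr0.
apply: eq_bigr => k _; congr (_ * _).
have km : (k <= m)%N by rewrite -ltnS ltn_ord.
rewrite (@sum_indicator R k m (fun p => X (tk p.+1) w i - X (tk p) w i) km).
rewrite -(big_mkord xpredT (fun p => X (tk p.+1) w i - X (tk p) w i)) telescope_sumr//.
by rewrite [tk 0]/tk mulr0 mul0r addrC subrK.
Qed.

Let past q := \bigcup_(z in [set z : R * K | 0 <= z.1 <= tk q])
  preimage_set_system setT (fun w => X z.1 w z.2) measurable.

Let X_past q s i : 0 <= s <= tk q -> gmeas (past q) (fun w => X s w i).
Proof. by move=> sq; apply: gmeas_gen => B XB; exists (s, i). Qed.

Let U_past q : gmeas (past q) (U q).
Proof.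
apply: gmeasD.
  apply: gmeas_sum => i; apply: gmeasM; first exact: gmeas_cst.
  by apply: X_past; rewrite lexx tk0.
apply: gmeas_sum => p; apply: gmeas_sum => i; apply: gmeasM; first exact: gmeas_cst.
under eq_fun do rewrite -mulN1r.
apply: gmeasD; first by apply: X_past; rewrite tk0/= tk_le.
apply: gmeasM; first exact: gmeas_cst.
by apply: X_past; rewrite tk0/= tk_le// ltnW.
Qed.

Let mX q i : measurable_fun setT (fun w => X (tk q) w i).
Proof. exact: bm_measurable bX _ _ (tk0 q). Qed.

Let mD q : measurable_fun setT (fun w => \sum_i be q i * (X (tk q.+1) w i - X (tk q) w i)).
Proof. by apply: measurable_sum => i; apply: measurable_funM => //; exact: measurable_funB. Qed.

Let mU q : measurable_fun setT (U q).
Proof.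
have h : past q `<=` @measurable _ T.
  by move=> B [[s i] /= /andP[s0 _] [C mC <-]]; exact: (bm_measurable bX i s0 measurableT mC).
exact: (gmeas_measurable h (@U_past q)).
Qed.

Let U_indep q : rv_indep P (U q) (fun w => \sum_i be q i * (X (tk q.+1) w i - X (tk q) w i)).
Proof.
move=> A B mA mB; rewrite setIC muleC.
have st : 0 <= tk q < tk q.+1 by rewrite tk0 tk_lt.
apply: (bm_independent bX st); last exact: gmeas_preimage (@U_past q) mA.
apply: gmeas_preimage mB; apply: gmeas_sum => i; apply: gmeasM; first exact: gmeas_cst.
by apply: gmeas_gen => C XC; exists i.
Qed.

Let mean p := \sum_i be p i * (drift i * (t / m%:R)).
Let var p := \sum_i \sum_l be p i * be p l * (cov i l * (t / m%:R)).

Let U_cos q (b : R) : Ex P (fun w => cos (U q w + b)) =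
  expR (- \sum_(p < q) var p / 2) * Ex P (fun w => cos (U 0 w + (\sum_(p < q) mean p + b))).
Proof.
elim: q b => [|q ih] b; first by rewrite !big_ord0 oppr0 expR0 mul1r add0r.
pose D w := \sum_i be q i * (X (tk q.+1) w i - X (tk q) w i).
have UD w : U q.+1 w = U q w + D w by rewrite /U big_ord_recr/= addrA.
have st : 0 <= tk q < tk q.+1 by rewrite tk0 tk_lt.
have gD : has_gaussian_law P D (mean q) (var q).
  by have := bm_law bX st (be q); rewrite tkS.
have v0 : 0 <= var q.
  rewrite /var (_ : \sum_i _ = (\sum_k \sum_l be q k * be q l * cov k l) * (t / m%:R)).
    by rewrite mulr_ge0// ltW// divr_gt0.
  rewrite mulr_suml; apply: eq_bigr => i _; rewrite mulr_suml; apply: eq_bigr => l _; ring.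
rewrite (_ : (fun w => cos (U q.+1 w + b)) = (fun w => cos (U q w + D w + b))); last first.
  by apply/funext => w; rewrite UD.
rewrite (Ex_cos_indep_gaussian b (mU q) (mD q) (U_indep q) v0 gD) ih mulrA -expRD !big_ord_recr/=.
congr (expR _ * Ex P _); first by rewrite opprD addrC.
by apply/funext => w; rewrite -[_ + mean q + b]addrA.
Qed.

Lemma brownian_grid_cos (b : R) : Ex P (fun w => cos (\sum_i \sum_k a i k * X (tk k) w i + b)) =
  expR (- \sum_(p < m) var p / 2) *
  Ex P (fun w => cos (\sum_i (\sum_k a i k) * X 0 w i + (\sum_(p < m) mean p + b))).
Proof.
have := U_cos m b; under eq_fun do rewrite UE.
by move=> ->; congr (_ * Ex _ _); apply/funext => w; rewrite /U big_ord0 addr0.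
Qed.

End BrownianFourier.

(** * Reflection on a grid *)

Section GridReflection.
Context {R : realType}.

Lemma grid_reflectionZ (m : nat) (c : R) (y : 'I_m.+1 -> R) : 0 <= c ->
  grid_reflection (fun k => c * y k) = c * grid_reflection y.
Proof.
move=> c0; rewrite /grid_reflection mulrDr; congr (_ + _).
apply: (big_ind2 (fun a b => a = c * b)); first by rewrite mulr0.
  by move=> a1 b1 a2 b2 -> ->; rewrite maxr_pMr.
by move=> k _; rewrite mulrN.
Qed.

Lemma grid_reflection_lip (m : nat) (y z : 'I_m.+1 -> R) :
  `|grid_reflection y - grid_reflection z| <= 2 * \sum_k `|y k - z k|.
Proof.
wlog suff h : y z / grid_reflection y - grid_reflection z <= 2 * \sum_k `|y k - z k|.
  rewrite ler_norml h// andbT lerNl opprB.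
  by under eq_bigr do rewrite distrC; exact: h.
have yk k : `|y k - z k| <= \sum_k `|y k - z k| by rewrite (bigD1 k)//= lerDl sumr_ge0.
suff : \big[Num.max/0]_(k < m.+1) (- y k) <= \big[Num.max/0]_(k < m.+1) (- z k) + \sum_k `|y k - z k|.
  rewrite /grid_reflection; have := yk ord_max; rewrite ler_norml => /andP[_ ?] ?; lra.
apply: bigmax_le => [|k _]; first by rewrite addr_ge0 ?sumr_ge0// bigmax_ge_id.
have h1 : - z k <= \big[Num.max/0]_(k < m.+1) (- z k) by exact: le_bigmax.
have := yk k; rewrite ler_norml => /andP[? _]; lra.
Qed.

Lemma osc_range (y : nat -> R) (N L : nat) (a : R) : (0 < L)%N -> osc_le y N L a -> 0 <= a ->
  forall n, (n <= N)%N -> `|partial_sum y n| <= (n %/ L).+1%:R * a.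
Proof.
move=> L0 osc a0 n nN.
suff h q : forall n, (n <= q * L)%N -> (n <= N)%N -> `|partial_sum y n| <= q%:R * a.
  by apply: h => //; rewrite ltnW// ltn_ceil.
elim: q => [|q ih] {}n nq {}nN.
  by move: nq; rewrite mul0n leqn0 => /eqP ->; rewrite partial_sum0 normr0 mul0r.
have [nqL|qLn] := leqP n (q * L).
  by apply: (le_trans (ih _ nqL nN)); rewrite ler_wpM2r// ler_nat.
have h1 := ih (q * L)%N (leqnn _) (leq_trans (ltnW qLn) nN).
have h2 : `|partial_sum y n - partial_sum y (q * L)| <= a.
  apply: (osc_leP osc) => //; first exact: leq_trans (ltnW qLn) nN.
    by apply: leq_trans (ltnW qLn) _; rewrite leq_addr.
  by move: nq; rewrite mulSn addnC.
rewrite -[q.+1%:R]natr1 mulrDl mul1r -[partial_sum y n](subrK (partial_sum y (q * L))).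
by apply: (le_trans (ler_normD _ _)); rewrite addrC lerD.
Qed.

(** Chaining through about [(C + 1) / kap] windows: the oscillation event by itself bounds the range
    of the walk by a constant times [rho], so no separate event is needed for ranges. *)
Lemma osc_range_scaled (y : nat -> R) (C kap eta rho : R) : 0 <= C -> 0 < kap -> 0 < eta -> 1 <= rho ->
  osc_le y (Num.truncn (C * rho ^+ 2)).+1 (Num.truncn (kap * rho ^+ 2)).+1 (eta * rho) ->
  forall n, (n <= (Num.truncn (C * rho ^+ 2)).+1)%N ->
  `|partial_sum y n| <= ((C + 1) / kap + 1) * eta * rho.
Proof.
move=> C0 k0 e0 r1 osc n nN.
have rp : 0 < rho by lra.
have r2 : 1 <= rho ^+ 2 by rewrite exprn_ege1.
have r2p : 0 < rho ^+ 2 by lra.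
have er0 : 0 <= eta * rho by rewrite mulr_ge0// ltW.
apply: (le_trans (osc_range (ltn0Sn _) osc er0 nN)).
rewrite -mulrA ler_wpM2r// -natr1 lerD2r.
set L := (Num.truncn (kap * rho ^+ 2)).+1.
have /andP[_ kL] := truncn_itv (mulr_ge0 (ltW k0) (ltW r2p)); rewrite -/L in kL.
have /andP[NC _] := truncn_itv (mulr_ge0 C0 (ltW r2p)).
have n1 : (n%:R : R) <= C * rho ^+ 2 + 1.
  apply: (@le_trans _ _ (Num.truncn (C * rho ^+ 2)).+1%:R); first by rewrite ler_nat.
  by rewrite -natr1 lerD2r.
have L0 : 0 < (L%:R : R) by rewrite ltr0n.
apply: (@le_trans _ _ (n%:R / L%:R)).
  by rewrite ler_pdivlMr// -natrM ler_nat leq_divM.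
rewrite ler_pdivrMr// (le_trans n1)// (@le_trans _ _ ((C + 1) / kap * (kap * rho ^+ 2)))//.
  rewrite mulrA divfK ?gt_eqF// mulrDl mul1r; lra.
by rewrite ler_wpM2l ?divr_ge0 ?(ltW k0)// ?addr_ge0// ltW.
Qed.

End GridReflection.

(** * Limits of expectations, null sets and lower limits *)

Section Convergence.
Context {R : realType} {d : measure_display} {T : measurableType d}.
Variable P : probability T R.

Lemma Ex_ae (f g : T -> R) : measurable_fun setT f -> measurable_fun setT g ->
  {ae P, forall w, f w = g w} -> Ex P f = Ex P g.
Proof.
move=> mf mg fg; rewrite /Ex /Rintegral; congr fine; apply: ae_eq_integral => //; try exact/measurable_EFinP.
by apply: filterS fg => w /= -> _.
Qed.

Lemma measurable_sum_cond (I : finType) (A : pred I) (f : I -> T -> R) :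
  (forall i, measurable_fun setT (f i)) -> measurable_fun setT (fun w => \sum_(i | A i) f i w).
Proof.
move=> mf; under eq_fun do rewrite big_mkcond.
by apply: measurable_sum => i; case: (A i).
Qed.

Lemma Ex_cvg (f_ : nat -> T -> R) (f : T -> R) (M : R) : (forall n, measurable_fun setT (f_ n)) ->
  measurable_fun setT f -> (forall n w, `|f_ n w| <= M) -> (forall w, f_ n w @[n --> \oo] --> f w) ->
  Ex P (f_ n) @[n --> \oo] --> Ex P f.
Proof.
move=> mf_ mf fM ff.
have cv : {ae P, forall w, [set: T] w -> (fun n => (f_ n w)%:E) @ \oo --> (f w)%:E}.
  by apply: aeW => w _; apply: cvg_EFin; [exact: nearW|exact: ff].
have [i1 _ h] := @dominated_convergence _ T R P setT measurableT (fun n w => (f_ n w)%:E)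
  (fun w => (f w)%:E) (fun=> M%:E) (fun n => (measurable_EFinP _ _).2 (mf_ n)) ((measurable_EFinP _ _).2 mf)
  cv (integr_cst P M) (aeW _ (fun w n _ => fM n w)).
have fi : (\int[P]_w (f w)%:E)%E \is a fin_num by exact: integrable_fin_num.
by rewrite /Ex /Rintegral; apply: fine_cvg; rewrite fineK.
Qed.

Lemma ae_set (Q : T -> Prop) : {ae P, forall w, Q w} ->
  exists A : set T, [/\ measurable A, P (~` A) = 0 & forall w, A w -> Q w].
Proof.
move=> [N [mN N0 QN]]; exists (~` N); split => [||w Nw]; [exact: measurableC|by rewrite setCK|].
by apply: contrapT => nQ; apply: Nw; exact: QN.
Qed.

Lemma ae_of_set (A : set T) : measurable A -> P (~` A) = 0 -> {ae P, forall w, A w}.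
Proof. by move=> mA A0; exists (~` A); split => //; exact: measurableC. Qed.

Lemma limn_einf_near_le (u v : nat -> \bar R) : (\forall n \near \oo, (u n <= v n)%E) ->
  (limn_einf u <= limn_einf v)%E.
Proof.
move=> [N _ uv]; rewrite !limn_einf_lim; apply: lee_lim; [exact: is_cvg_einfs|exact: is_cvg_einfs|].
exists N => // n /= Nn; rewrite /einfs; apply: le_ereal_inf_tmp => _ [k /= nk <-].
apply: (@le_trans _ _ (u k)); last by apply: uv => /=; exact: leq_trans nk.
by apply: ereal_inf_lbound; exists k.
Qed.

Lemma limn_einf_near_ge (a : \bar R) (u : nat -> \bar R) : (\forall n \near \oo, (a <= u n)%E) ->
  (a <= limn_einf u)%E.
Proof.
move=> /limn_einf_near_le; apply: le_trans.
by have [-> _] := @cvg_limn_einf_sup R (fun=> a) a (cvg_cst a).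
Qed.

End Convergence.

(** * From the discrete reflection to the continuous one *)

Section ReflectionLimit.
Context {R : realType}.

Lemma reflection_argmax (f : R -> R) (t : R) : 0 <= t -> {within `[0, +oo[, continuous f} ->
  exists c, [/\ 0 <= c <= t, forall s, 0 <= s <= t -> - f s <= - f c &
    reflection f t = f t + Num.max (- f c) 0].
Proof.
move=> t0 cf.
have cf' : {within `[0, t], continuous (fun s => - f s)}.
  have h : {within `[0, t], continuous f}.
    by apply: continuous_subspaceW cf => s /=; rewrite !in_itv/= => /andP[-> _].
  by move=> s; apply: continuousN; exact: h.
have [c ct cmax] := EVT_max t0 cf'.
have c0t : 0 <= c <= t by move: ct; rewrite in_itv.
have cm s : 0 <= s <= t -> - f s <= - f c by move=> st; apply: cmax; rewrite in_itv.
exists c; split => //; rewrite /reflection; congr (_ + _).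
have ub : ubound [set Num.max (- f s) 0 | s in `[0, t]] (Num.max (- f c) 0).
  move=> _ [s /= st <-]; rewrite ge_max !le_max lexx orbT andbT cm//.
apply/le_anti/andP; split.
  by apply: ge_sup => //; exists (Num.max (- f c) 0), c => //=; rewrite in_itv.
by apply: ub_le_sup; [exists (Num.max (- f c) 0)|exists c => //=; rewrite in_itv].
Qed.

Lemma reflection_ge0 (f : R -> R) (t : R) : 0 <= t -> {within `[0, +oo[, continuous f} ->
  0 <= reflection f t.
Proof.
move=> t0 cf; have [c [_ cm ->]] := reflection_argmax t0 cf.
have : - f t <= - f c by apply: cm; rewrite t0 lexx.
have : - f c <= Num.max (- f c) 0 by rewrite le_max lexx.
lra.
Qed.

Lemma grid_reflection_cvg (f : R -> R) (t : R) : 0 < t -> {within `[0, +oo[, continuous f} ->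
  grid_reflection (fun k : 'I_m.+2 => f (t * k%:R / m.+1%:R)) @[m --> \oo] --> reflection f t.
Proof.
move=> t0 cf; have [c [c0t cm ->]] := reflection_argmax (ltW t0) cf.
case/andP: (c0t) => c0 ct.
apply/cvgrPdist_le => e e0.
have [del del0 fdel] := within_continuousP cf c0 e0.
have d0 : 0 < del / t by rewrite divr_gt0.
near=> m.
have md : m.+1%:R^-1 < del / t by near: m; exact: (near_infty_natSinv_lt (PosNum d0)).
have m0 : 0 < (m.+1%:R : R) by rewrite ltr0n.
have tm : t / m.+1%:R < del by rewrite mulrC -ltr_pdivlMr.
have E : t * (@ord_max m.+1)%:R / m.+1%:R = t by rewrite mulfK// gt_eqF.
rewrite /grid_reflection E.
set mx := \big[Num.max/0]_(k < _) _.
have tk (k : 'I_m.+2) : 0 <= t * k%:R / m.+1%:R <= t.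
  rewrite !mulr_ge0 ?invr_ge0 ?(ltW t0) ?(ltW m0)//= -mulrA ler_piMr ?(ltW t0)//.
  by rewrite ler_pdivrMr// mul1r ler_nat -ltnS ltn_ord.
have up : mx <= Num.max (- f c) 0.
  apply: bigmax_le => [|k _]; first by rewrite le_max lexx orbT.
  by rewrite le_max cm.
have lo : Num.max (- f c) 0 - e <= mx.
  have mx0 : 0 <= mx by exact: bigmax_ge_id.
  (* Index of the last grid point not beyond the maximizer [c] of [- f]; continuity at [c] makes its
     value nearly maximal. *)
  pose q := Num.truncn (c * m.+1%:R / t).
  have q0 : 0 <= c * m.+1%:R / t by rewrite mulr_ge0 ?invr_ge0 ?(ltW t0)// mulr_ge0// ltW.
  have /andP[q1 q2] := truncn_itv q0; rewrite -/q in q1 q2.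
  have qm : (q < m.+2)%N.
    rewrite ltnS -(ler_nat R); apply: (le_trans q1).
    by rewrite ler_pdivrMr// mulrC ler_wpM2l// ltW.
  pose k := Ordinal qm.
  have tkc : t * q%:R / m.+1%:R <= c by rewrite ler_pdivrMr// mulrC -ler_pdivlMr.
  have ctk : c - t * q%:R / m.+1%:R < del.
    apply: lt_trans tm; rewrite ltrBlDr -mulrDl -[X in X + _]mulr1 -mulrDr addrC natr1.
    by rewrite ltr_pdivlMr// [ltRHS]mulrC -ltr_pdivrMr.
  have := fdel (t * q%:R / m.+1%:R); rewrite ger0_norm ?subr_ge0// => h.
  have {}h := h _ ctk.
  have fk : - f (t * q%:R / m.+1%:R) <= mx by exact: (@le_bigmax _ _ _ 0 (fun k : 'I_m.+2 => - f (t * k%:R / m.+1%:R)) k).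
  have := h _; have /andP[tk0 _] := tk k; move=> /(_ tk0); rewrite ltr_norml => /andP[? ?].
  by rewrite lerBlDr ge_max; apply/andP; split; lra.
rewrite ler_norml; apply/andP; split; lra.
Unshelve. all: by end_near.
Qed.

End ReflectionLimit.

(** * Measurability and right continuity of renewal counts *)

Section RenewalMeasurability.
Context {R : realType} {d : measure_display} {T : measurableType d}.

(** Without a bracketing index the partial sums either start above [s] or never pass it; the set is
    empty or unbounded, and [supremum] returns its default. *)
Lemma renewal_count_out (x : nat -> R) (s : R) : (forall k, 0 < x k) ->
  (forall n, ~~ (partial_sum x n <= s < partial_sum x n.+1)) -> renewal_count x s = 0%N.
Proof.
move=> xp nx; apply: supremum_out => -[[n /= ns] [b bP]].
have s0 : partial_sum x 0 <= s by apply: le_trans ns; exact: partial_sum_le.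
suff h k : partial_sum x k <= s by have /= := bP b.+1 (h b.+1); rewrite leEnat ltnn.
elim: k => // k ih; have := nx k; rewrite ih/= -leNgt; exact.
Qed.

(** At most one bracket holds, so the sums are eventually constant. This presents the count as a
    limit of visibly measurable functions of the partial sums. *)
Lemma renewal_count_series (x : nat -> R) (s : R) : (forall k, 0 < x k) ->
  \sum_(n < N) n%:R * (partial_sum x n <= s < partial_sum x n.+1)%R%:R @[N --> \oo] -->
  ((renewal_count x s)%:R : R).
Proof.
move=> xp; have [[n ns]|nx] := pselect (exists n, partial_sum x n <= s < partial_sum x n.+1).
  rewrite (renewal_countE xp ns); apply: cvg_near_cst; exists n.+1 => // N /= nN.
  rewrite (bigD1 (Ordinal nN))//= ns mulr1 big1 ?addr0// => k /eqP kn.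
  have [ks|_] := boolP (partial_sum x k <= s < partial_sum x k.+1); last by rewrite mulr0.
  by case: kn; apply/val_inj; rewrite /= -(renewal_countE xp ks) (renewal_countE xp ns).
rewrite renewal_count_out//; last by move=> n; apply/negP => ns; apply: nx; exists n.
apply: cvg_near_cst; apply: nearW => N; rewrite big1// => k _.
by rewrite (_ : _ && _ = false) ?mulr0//; apply/negP => ks; apply: nx; exists k.
Qed.

Lemma measurable_renewal (A : set T) (x : nat -> T -> R) (S : T -> R) : measurable A ->
  (forall n, measurable_fun setT (x n)) -> measurable_fun setT S -> (forall w, A w -> forall n, 0 < x n w) ->
  measurable_fun setT (fun w => \1_A w * (renewal_count (x ^~ w) (S w))%:R : R).
Proof.
move=> mA mx mS xA.
have mU n : measurable_fun setT (fun w => partial_sum (x ^~ w) n) by exact: measurable_sum.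
apply: (@measurable_fun_cvg _ _ _ _ (fun N w => \1_A w *
  \sum_(n < N) n%:R * (partial_sum (x ^~ w) n <= S w < partial_sum (x ^~ w) n.+1)%R%:R)).
  move=> N; apply: measurable_funM; first exact: measurable_indic.
  apply: measurable_sum => n; apply: measurable_funM => //.
  rewrite (_ : (fun w => _) = \1_([set w | partial_sum (x ^~ w) n <= S w] `&`
      [set w | S w < partial_sum (x ^~ w) n.+1])).
    apply: measurable_indic; apply: measurableI; rewrite -[X in measurable X]setTI.
      exact: measurable_fun_ler.
    exact: measurable_fun_ltr.
  apply/funext => w; rewrite indicE; congr (nat_of_bool _)%:R.
  by apply/idP/idP => [/andP[a b]|]; rewrite inE//= => -[-> ->].
move=> w _; have [Aw|nA] := pselect (A w).
  by apply: cvgM; [exact: cvg_cst|exact: renewal_count_series (xA w Aw)].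
have e : \1_A w = 0 :> R by rewrite indicE memNset.
by rewrite e mul0r; under eq_fun do rewrite mul0r; exact: cvg_cst.
Qed.

End RenewalMeasurability.

Section RenewalRightContinuity.
Context {R : realType}.

Definition right_const (f : R -> nat) := forall t : R, 0 <= t -> exists2 del : R, 0 < del &
  forall u, t <= u < t + del -> f u = f t.

Lemma right_const_renewal (x : nat -> R) (c : R) : (forall k, 0 < x k) -> 0 < c ->
  right_const (fun t => renewal_count x (c * t)).
Proof.
move=> xp c0 t t0; have [[n ns]|nx] := pselect (exists n, partial_sum x n <= c * t < partial_sum x n.+1).
  case/andP: (ns) => n1 n2; exists (partial_sum x n.+1 / c - t); first by rewrite subr_gt0 ltr_pdivlMr// mulrC.
  move=> u /andP[tu]; rewrite addrC subrK ltr_pdivlMr// mulrC => ul.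
  rewrite (renewal_countE xp ns); apply: (renewal_countE xp); rewrite ul andbT (le_trans n1)//.
  by rewrite ler_pM2l.
have all k : partial_sum x k <= c * t.
  elim: k => [|k ih]; first by rewrite partial_sum0 mulr_ge0// ltW.
  by rewrite leNgt; apply/negP => h; apply: nx; exists k; rewrite ih.
exists 1 => // u /andP[tu _]; rewrite !renewal_count_out// => n; apply/negP => /andP[_]; rewrite ltNge => /negP; apply.
  exact: all.
by apply: le_trans (all _) _; rewrite ler_pM2l.
Qed.

(** The head-of-the-line bracket is strict on its upper side, so continuity and monotonicity of [S]
    preserve it on a short interval to the right. *)
Lemma right_const_service (x : nat -> R) (S : R -> R) (c : R) : (forall k, 0 < x k) -> 0 < c ->
  {within `[0, +oo[, continuous S} -> {in `[0, +oo[ &, {homo S : s t / s <= t}} ->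
  (forall t, 0 <= t -> partial_sum x (renewal_count x (S t)) <= S t < partial_sum x (renewal_count x (S t)).+1) ->
  right_const (fun t => renewal_count x (S (c * t))).
Proof.
move=> xp c0 cS hS hol t t0.
have ct0 : 0 <= c * t by rewrite mulr_ge0// ltW.
have /andP[h1 h2] := hol _ ct0.
set n := renewal_count x (S (c * t)) in h1 h2 *.
have e0 : 0 < partial_sum x n.+1 - S (c * t) by rewrite subr_gt0.
have [del del0 hd] := within_continuousP cS ct0 e0.
exists (del / c); first by rewrite divr_gt0.
move=> u /andP[tu ud]; have u0 : 0 <= u by exact: le_trans tu.
have ctu : c * t <= c * u by rewrite ler_pM2l.
have cu0 : 0 <= c * u by exact: le_trans ctu.
have := hd _ cu0; rewrite ler0_norm ?subr_le0// opprB => h.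
have {}h := h _.
have {}h : `|S (c * t) - S (c * u)| < partial_sum x n.+1 - S (c * t).
  by apply: h; rewrite -mulrBr mulrC -ltr_pdivlMr// ltrBlDl.
apply: (renewal_countE xp); apply/andP; split.
  by apply: (le_trans h1); apply: hS; rewrite ?in_itv/= ?andbT.
move: h; rewrite ltr_norml => /andP[? ?]; lra.
Qed.

End RenewalRightContinuity.

(** * The lower bound *)

Section Main.
Context {R : realType} {d : measure_display} {Om : measurableType d}.
Variable P : probability Om R.
Hypothesis P_complete : measure_is_complete P.
Variables (nI nJ : nat) (res : 'I_nJ -> {set 'I_nI}).
Hypotheses (net : network res) (hier : hierarchical res).
Variables (mu sigma beta : 'I_nJ -> R) (v ubar : 'I_nJ -> nat -> {RV P >-> R}).
Hypothesis mu_gt0 : forall j, 0 < mu j.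
Hypothesis v_gt0 : forall j n, {ae P, forall w, 0 < v j n w}.
Hypothesis v_iid : forall j, iid P (fun n => v j n : Om -> R).
Hypothesis v_mean : forall j, ('E_P[v j 0%N] = ((mu j)^-1)%:E)%E.
Hypothesis v_var : forall j, ('V_P[v j 0%N] = ((sigma j / mu j) ^+ 2)%:E)%E.
Hypothesis ubar_gt0 : forall j n, {ae P, forall w, 0 < ubar j n w}.
Hypothesis ubar_iid : forall j, iid P (fun n => ubar j n : Om -> R).
Hypothesis ubar_mean : forall j, ('E_P[ubar j 0%N] = 1)%E.
Hypothesis ubar_var : forall j, ('V_P[ubar j 0%N] = (beta j ^+ 2)%:E)%E.
Hypothesis prim_indep : mutually_independent P (fun a : 'I_nJ + 'I_nJ =>
  sigma_of (primitive (fun j n => v j n) (fun j n => ubar j n) a) setT).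
Hypothesis moments : exists2 abar : R, 0 < abar & forall a : R, - abar < a < abar ->
  forall j, ('M_P (ubar j 0%N) a < +oo)%E /\ ('M_P (v j 0%N) a < +oo)%E.
Variables (lamr : nat -> 'I_nJ -> R) (lam : 'I_nJ -> R).
Hypothesis lamr_gt0 : forall r j, (0 < r)%N -> 0 < lamr r j.
Hypothesis lam_gt0 : forall j, 0 < lam j.
Hypothesis lamr_cvg : forall j, lamr r j @[r --> \oo] --> lam j.
Variable theta : 'I_nI -> \bar R.
Hypothesis traffic : forall i, (r%:R * (load res mu (lamr r) i - 1))%:E @[r --> \oo] --> theta i.
Variable Q0 : nat -> 'I_nJ -> {RV P >-> nat}.
Hypothesis Q0_indep : forall r, (0 < r)%N -> independent P
  (sigma_of (fun j => Q0 r j : Om -> nat) setT)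
  (sigma_of (fun a : ('I_nJ + 'I_nJ) * nat =>
    primitive (fun j n => v j n) (fun j n => ubar j n) a.1 a.2) setT).
Variable Q0t : 'I_nJ -> {RV P >-> R}.
Hypothesis Q0_diffusion : cvg_in_law P
  (fun r w => \row_j ((Q0 r j w)%:R / r%:R)) (fun w => \row_j Q0t j w).
Local Notation heavy := (heavy theta).
Let th (i : heavy) : R := fine (theta (val i)).
Let cov (i k : heavy) : R := \sum_(j in (jobs_of res (val i) :&: jobs_of res (val k))%SET)
  lam j * (beta j ^+ 2 + sigma j ^+ 2) / mu j ^+ 2.
Variable X : R -> Om -> heavy -> R.
Hypothesis bX : brownian P th cov X.
Hypothesis X0 : {ae P, forall w, forall k, X 0 w k = \sum_(j in jobs_of res (val k)) Q0t j w / mu j}.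
Variables (h : 'I_nJ -> R) (delta : R).
Hypotheses (h_gt0 : forall j, 0 < h j) (delta_gt0 : 0 < delta).
Variable T : nat -> 'I_nJ -> R -> Om -> R.
Hypothesis T_adm : forall r, (0 < r)%N -> admissible P res (heavy_set theta) (lamr r)
  (fun j n => v j n) (fun j n => ubar j n) (fun j => Q0 r j) (T r).

(* inl j: centered service times; inr j: centered unscaled interarrival times. *)
Let x (s : 'I_nJ + 'I_nJ) (n : nat) (w : Om) : R :=
  match s with inl j => v j n w - (mu j)^-1 | inr j => ubar j n w - 1 end.
Let s2 (s : 'I_nJ + 'I_nJ) : R :=
  match s with inl j => (sigma j / mu j) ^+ 2 | inr j => beta j ^+ 2 end.
Let la (s : 'I_nJ + 'I_nJ) : R := match s with inl j => lam j | inr j => lam j end.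
(** Weight of the centered walk [s] in the netput of resource [i]: longer services add work, while
    longer interarrival times remove arrivals, each worth [1 / mu j] on average. *)
Let gam (i : heavy) (s : 'I_nJ + 'I_nJ) : R :=
  match s with inl j => (j \in jobs_of res (val i))%:R
             | inr j => - ((j \in jobs_of res (val i))%:R / mu j) end.

Let la_ge0 s : 0 <= la s. Proof. by case: s => j; exact: ltW (lam_gt0 j). Qed.

Lemma walk (s : 'I_nJ + 'I_nJ) : exists G : nat -> set_system Om,
  centered_walk P (x s) G (s2 s) (Ex P (fun w => x s 0%N w ^+ 4)).
Proof.
have [ab ab0 mom] := moments.
case: s => j /=.
- have vm a : - ab < a < ab -> ('M_P (v j 0%N) a < +oo)%E by move=> /mom/(_ j) [].
  have [i1 i2 i4 e] := mgf_moments ab0 vm (v_mean j).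
  have e2 := variance_second_moment i2 (v_mean j) (v_var j).
  by eexists; exact: (iid_centered_walk (fun n => measurable_funPT (v j n)) (v_iid j) i4 e e2 i1 i2).
- have vm a : - ab < a < ab -> ('M_P (ubar j 0%N) a < +oo)%E by move=> /mom/(_ j) [].
  have [i1 i2 i4 e] := mgf_moments ab0 vm (ubar_mean j).
  have e2 := variance_second_moment i2 (ubar_mean j) (ubar_var j).
  by eexists; exact: (iid_centered_walk (fun n => measurable_funPT (ubar j n)) (ubar_iid j) i4 e e2 i1 i2).
Qed.

Lemma measurable_walk s n : measurable_fun setT (x s n).
Proof. by case: s => j; apply: measurable_funB. Qed.

Lemma walk_moments s n : [/\ integr P (x s n), integr P (fun w => x s n w ^+ 2),
     integr P (fun w => x s n w ^+ 4), Ex P (x s n) = 0 & Ex P (fun w => x s n w ^+ 2) = s2 s].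
Proof.
have [G cw] := walk s.
have i4 := cw_int cw n.
have le4 (z : R) : `|z| <= 1 + z ^+ 4 /\ z ^+ 2 <= 1 + z ^+ 4.
  have h0 := sqr_ge0 (z ^+ 2 - 1); have h' := sqr_ge0 (z ^+ 2 - 1 / 2).
  have e : (z ^+ 2) ^+ 2 = z ^+ 4 by rewrite -exprM.
  have := sqr_ge0 (`|z| - 1 / 2); rewrite !sqrrB real_normK ?num_real// in h0 h' *.
  rewrite !expr1n e in h0 h' *; split; lra.
have i5 : integr P (fun w => 1 + x s n w ^+ 4) by apply: integrD => //; exact: integr_cst.
split => //; last exact: (cw_var cw).
- by apply: (integr_le _ _ i5) => [|w]; [exact: measurable_walk|have [] := le4 (x s n w)].
- apply: (integr_le _ _ i5) => [|w]; first by apply: measurable_funX; exact: measurable_walk.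
  by rewrite ger0_norm ?sqr_ge0//; have [] := le4 (x s n w).
- exact: (cw_mean cw).
Qed.

Lemma walk_fourth : exists C : R, forall s n, 2 * (1 + Ex P (fun w => x s n w ^+ 4)) + s2 s ^+ 2 <= C.
Proof.
have cw s n : Ex P (fun w => x s n w ^+ 4) <= Ex P (fun w => x s 0%N w ^+ 4).
  by have [G cw] := walk s; exact: (cw_fourth cw n).
exists (\sum_s (2 * (1 + Ex P (fun w => x s 0%N w ^+ 4)) + s2 s ^+ 2)) => s n.
apply: (@le_trans _ _ (2 * (1 + Ex P (fun w => x s 0%N w ^+ 4)) + s2 s ^+ 2)).
  by rewrite lerD2r ler_pM2l// lerD2l.
rewrite (bigD1 s)//= lerDl sumr_ge0// => s' _.
rewrite addr_ge0 ?sqr_ge0// mulr_ge0// addr_ge0//; apply: Ex_ge0 => w.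
by rewrite -[4%N]/(2 * 2)%N exprM sqr_ge0.
Qed.

(** Each type feeds the covariance through its service walk and its interarrival walk. The sum of
    squares shows positivity and is exactly the variance rate that the prelimit produces. *)
Lemma cov_gram (b : heavy -> R) : \sum_i \sum_k b i * b k * cov i k =
  \sum_s s2 s * la s * (\sum_i b i * gam i s) ^+ 2.
Proof.
rewrite big_sumType/= -big_split/=.
transitivity (\sum_j lam j * (beta j ^+ 2 + sigma j ^+ 2) / mu j ^+ 2 *
   (\sum_(i : heavy) b i * (j \in jobs_of res (val i))%:R) ^+ 2); last first.
  apply: eq_bigr => j _.
  rewrite [X in beta j ^+ 2 * lam j * X ^+ 2](_ : _ = - (mu j)^-1 *
    \sum_(i : heavy) b i * (j \in jobs_of res (val i))%:R); last first.
    by rewrite mulr_sumr; apply: eq_bigr => i _; ring.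
  rewrite mulNr sqrrN !exprMn !exprVn; ring.
under [RHS]eq_bigr do rewrite [(\sum_i _) ^+ 2]expr2 big_distrlr mulr_sumr/=.
rewrite [RHS]exchange_big/=; apply: eq_bigr => i _.
under [RHS]eq_bigr do rewrite mulr_sumr/=.
rewrite [RHS]exchange_big/=; apply: eq_bigr => k _.
rewrite /cov mulr_sumr big_mkcond/=; apply: eq_bigr => j _; rewrite finset.in_setI.
by case: (j \in jobs_of res (val i)); case: (j \in jobs_of res (val k)); rewrite /= ?mulr1 ?mulr0//; ring.
Qed.

Lemma cov_psd (b : heavy -> R) : 0 <= \sum_i \sum_k b i * b k * cov i k.
Proof.
rewrite cov_gram; apply: sumr_ge0 => s _; rewrite mulr_ge0 ?sqr_ge0// mulr_ge0 ?la_ge0//.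
by case: s => j; rewrite sqr_ge0.
Qed.

Lemma sum_pair (I J : finType) (F : I * J -> R) : \sum_p F p = \sum_i \sum_k F (i, k).
Proof. by rewrite pair_bigA; apply: eq_bigr => -[]. Qed.

Let lp := lp_real res (theta := theta) h mu.

(** A lower bound tolerates capping the value at [M]; the result is a bounded Lipschitz function of
    finitely many coordinates, as [levy_lipschitz] requires. *)
Definition capped_value (m : nat) (M : R) (y : heavy * 'I_m.+1 -> R) : R :=
  Num.min (lp (fun i => grid_reflection (fun k => y (i, k)))) M.

Lemma capped_value_bounds m (M : R) y : 0 <= M -> 0 <= @capped_value m M y <= M.
Proof.
move=> M0; rewrite /capped_value ge_min lexx orbT andbT le_min.
by apply/andP; split; [exact: lp_real_ge0|exact: M0].
Qed.

Lemma capped_value_lipschitz : exists2 L : R, 0 <= L & forall m M y z,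
  @capped_value m M y - capped_value M z <= L * \sum_p `|y p - z p|.
Proof.
have [CL CL0 lpL] := lp_real_lipschitz theta net hier h_gt0 mu_gt0.
exists (CL * 2); first by rewrite mulr_ge0.
move=> m M y z; set rhs := leRHS.
have r0 : 0 <= rhs by rewrite /rhs mulr_ge0 ?sumr_ge0// mulr_ge0.
have : lp (fun i => grid_reflection (fun k => y (i, k))) - lp (fun i => grid_reflection (fun k => z (i, k))) <= rhs.
  apply: (le_trans (lpL _ _)); rewrite /rhs -mulrA ler_wpM2l// sum_pair mulr_sumr.
  by apply: ler_sum => i _; exact: grid_reflection_lip.
rewrite /capped_value; set a := lp (fun i => grid_reflection (fun k => y (i, k))).
set b := lp (fun i => grid_reflection (fun k => z (i, k))); rewrite !minElt => ab.
by case: (ltP a M) => ?; case: (ltP b M) => ?; lra.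
Qed.

Definition regular (r : nat) (w : Om) : Prop :=
  [/\ admissible_path res (heavy_set theta) (fun j => Q0 r j w)
    (interarrival (lamr r) (fun j n => ubar j n) w) (fun j n => v j n w) (fun j s => T r j s w),
   forall j n, 0 < v j n w & forall j n, 0 < ubar j n w].

Let qhat (r : nat) := scaled_queue r (lamr r) (fun j n => v j n) (fun j n => ubar j n)
  (fun j => Q0 r j) (T r).

Let C1 : R := 1 + \sum_j (2 + 3 / mu j).

(** * The netput on a grid of a fixed time interval *)

Section Grid.
Variables (t : R) (m : nat).
Hypotheses (t_gt0 : 0 < t) (m_gt0 : (0 < m)%N).
Let nk (s : 'I_nJ + 'I_nJ) (r k : nat) : nat := Num.truncn (la s * (r%:R ^+ 2 * (t * k%:R / m%:R))).

(* The scaled netput process on the grid t k / m, with deterministic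
   arrival-rate clocks in place of the renewal counts. *)
Definition netput (r : nat) (w : Om) (p : heavy * 'I_m.+1) : R :=
  \sum_(j in jobs_of res (val p.1)) (Q0 r j w)%:R / r%:R / mu j +
  r%:R^-1 * (\sum_s gam p.1 s * partial_sum (x s ^~ w) (nk s r p.2)) +
  th p.1 * (t * p.2%:R / m%:R).

Definition netput_lim (w : Om) (p : heavy * 'I_m.+1) : R := X (t * p.2%:R / m%:R) w p.1.

Lemma Q0_cos (z : 'I_nJ -> R) (b : R) :
  Ex P (fun w => cos (\sum_j z j * ((Q0 r j w)%:R / r%:R) + b)) @[r --> \oo] -->
  Ex P (fun w => cos (\sum_j z j * Q0t j w + b)).
Proof.
pose f (q : 'rV[R]_nJ) := cos (\sum_j z j * q ord0 j + b).
have cf : continuous f.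
  move=> q; apply: (@continuous_comp _ _ _ (fun q : 'rV[R]_nJ => \sum_j z j * q ord0 j + b) cos).
    apply: continuousD; last exact: cst_continuous.
    suff : forall s : seq 'I_nJ, {for q, continuous (fun q : 'rV[R]_nJ => \sum_(j <- s) z j * q ord0 j)} by apply.
    elim=> [|j s ih].
      by rewrite (_ : (fun _ => _) = fun=> 0); [exact: cst_continuous|apply/funext => u; rewrite big_nil].
    rewrite (_ : (fun _ => _) = fun u : 'rV[R]_nJ => z j * u ord0 j + \sum_(j <- s) z j * u ord0 j).
      apply: continuousD; last exact: ih.
      by apply: continuousM; [exact: cst_continuous|exact: coord_continuous].
    by apply/funext => u; rewrite big_cons.
  exact: continuous_cos.
have := Q0_diffusion cf; move=> /(_ (ex_intro _ 1 (fun q => _))).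
move=> /(_ (fun q => cos_max _)).
have EE (Y : 'I_nJ -> Om -> R) : (forall j, measurable_fun setT (Y j)) ->
    ('E_P[f \o (fun w => \row_j Y j w)] = (Ex P (fun w => cos (\sum_j z j * Y j w + b)%R))%:E)%E.
  move=> mY; rewrite unlock /Ex /Rintegral.
  have -> : (fun w => (f (\row_j Y j w))%:E) = (fun w => (cos (\sum_j z j * Y j w + b))%:E).
    by apply/funext => w; rewrite /f; congr (cos (_ + _))%:E; apply: eq_bigr => j _; rewrite mxE.
  have i1 : integr P (fun w => cos (\sum_j z j * Y j w + b)).
    apply: integr_cos; apply: measurable_funD => //; apply: measurable_sum => j.
    exact: measurable_funM.
  by rewrite fineK//; exact: (integrable_fin_num measurableT i1).
have mQ r j : measurable_fun setT (fun w => (Q0 r j w)%:R / r%:R : R).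
  by apply: measurable_funM => //; exact: measurableT_comp.
rewrite (EE (fun j w => Q0t j w))//.
have -> : (fun r => 'E_P[f \o (fun w => \row_j ((Q0 r j w)%:R / r%:R)%R)])%E =
    (fun r => (Ex P (fun w => cos (\sum_j z j * ((Q0 r j w)%:R / r%:R) + b)))%:E).
  by apply/funext => r; exact: (EE (fun j w => (Q0 r j w)%:R / r%:R) (mQ r)).
by move=> /fine_cvgP[_].
Qed.


Lemma measurable_netput r : coord_measurable (netput r).
Proof.
move=> p; apply: measurable_funD => //; apply: measurable_funD.
  apply: measurable_sum_cond => j; apply: measurable_funM => //; apply: measurable_funM => //.
  exact: measurableT_comp.
apply: measurable_funM => //; apply: measurable_sum => s; apply: measurable_funM => //.
by apply: measurable_sum => n; exact: measurable_walk.
Qed.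

Lemma measurable_netput_lim : coord_measurable netput_lim.
Proof.
move=> p; apply: (bm_measurable bX).
by rewrite !mulr_ge0// ?invr_ge0// ltW.
Qed.

(** A linear form of the netput splits into initial state, walks and drift: [prelimit_cvg] handles
    the first two and the drift is put in the phase [b1]. On the Brownian side [cov_gram] equates
    the variance of each grid interval, and the tail sums of the drift reassemble the grid times. *)
Lemma netput_cos (a : heavy * 'I_m.+1 -> R) (b : R) :
  Ex P (fun w => cos (\sum_p a p * netput r w p + b)) @[r --> \oo] -->
  Ex P (fun w => cos (\sum_p a p * netput_lim w p + b)).
Proof.
have [C0 xC] := walk_fourth.
pose al s (k : 'I_m.+1) := \sum_i a (i, k) * gam i s.
pose z j := \sum_(i : heavy) (j \in jobs_of res (val i))%:R * (\sum_k a (i, k)) / mu j.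
pose b1 := \sum_(i : heavy) \sum_k a (i, k) * (th i * (t * k%:R / m%:R)).
pose Zl w := \sum_j z j * Q0t j w.
pose F0 r := sigma_of (fun j => Q0 r j : Om -> nat) setT.
have F0m r : (0 < r)%N -> F0 r `<=` measurable.
  move=> _; apply: smallest_sub; first exact: sigma_algebra_measurable.
  by move=> B [j _ [C mC <-]]; exact: measurable_funPT.
have F0T r : F0 r setT by exact: (@measurableT _ (g_sigma_algebraType _)).
have F0I r : setI_closed (F0 r).
  by move=> A B FA FB; exact: (@measurableI _ (g_sigma_algebraType _)).
have ZF r : (0 < r)%N -> preimage_set_system setT (fun w => \sum_j z j * ((Q0 r j w)%:R / r%:R)) measurable `<=` F0 r.
  move=> r0 B [C mC <-]; rewrite setTI.
  pose G : set_system Om := \bigcup_(j in [set: 'I_nJ]) preimage_set_system setT (Q0 r j : Om -> nat) measurable.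
  apply: (@gmeas_preimage _ _ _ G) => //; apply: gmeas_sum => j; apply: gmeasM; first exact: gmeas_cst.
  apply: gmeasM; last exact: gmeas_cst.
  apply: gmeas_gen => _ [D mD <-]; exists j => //.
  by exists ((fun n : nat => n%:R : R) @^-1` D).
have iF r N : (0 < r)%N -> indep_family P (fun o : option (('I_nJ + 'I_nJ) * 'I_N) =>
    if o is Some p then preimage_set_system setT (x p.1 p.2) measurable else F0 r).
  move=> r0; pose y s n : Om -> R := primitive (fun j n => v j n) (fun j n => ubar j n) s n.
  have my s n : measurable_fun setT (y s n) by case: s => j; exact: measurable_funPT.
  have iy s : mutually_independent P (fun n => sigma_of (y s) [set n]).
    by case: s => j; [have [] := v_iid j|have [] := ubar_iid j].
  apply: (indep_familyS _ (@indep_family_walks _ _ _ P _ y (F0 r) N my (Q0_indep r0) prim_indep iy (F0m r r0))).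
  move=> [[s n]|//] /=; case: s => j A.
    by move=> [B mB <-]; apply: (@preimage_system_comp _ _ _ (v j n) (fun c => c - (mu j)^-1)); [exact: measurable_funB|exists B].
  by move=> [B mB <-]; apply: (@preimage_system_comp _ _ _ (ubar j n) (fun c => c - 1)); [exact: measurable_funB|exists B].
have H := @prelimit_cvg _ _ _ P _ x s2 la C0 t m F0 _ Zl walk_moments xC F0m F0T F0I ZF iF la_ge0 (ltW t_gt0) m_gt0
  (@Q0_cos z) al (b + b1).
have -> : (fun r => Ex P (fun w => cos (\sum_p a p * netput r w p + b))) =
  (fun r => Ex P (fun w => cos (\sum_j z j * ((Q0 r j w)%:R / r%:R) +
   r%:R^-1 * (\sum_s \sum_k al s k * partial_sum (x s ^~ w) (nk s r k)) + (b + b1)))).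
  apply/funext => r; congr Ex; apply/funext => w; congr cos.
  rewrite [b + b1]addrC [RHS]addrA; congr (_ + _).
  rewrite sum_pair /netput/=.
  under eq_bigr => i _ do under eq_bigr => k _ do rewrite mulrDr mulrDr.
  under eq_bigr => i _ do rewrite big_split big_split/=.
  rewrite big_split big_split/=; congr (_ + _ + _).
    under [RHS]eq_bigr => j _ do rewrite /z mulr_suml.
    rewrite [RHS]exchange_big/=; apply: eq_bigr => i _.
    rewrite -mulr_suml mulr_sumr big_mkcond/=; apply: eq_bigr => j _.
    by case: ifP => _; rewrite ?mul1r ?mul0r ?mulr0//; ring.
  rewrite mulr_sumr; under [RHS]eq_bigr => s _ do rewrite mulr_sumr.
  under eq_bigr => i _ do under eq_bigr => k _ do rewrite mulrCA mulr_sumr mulr_sumr.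
  under eq_bigr => i _ do rewrite exchange_big.
  rewrite exchange_big/=; apply: eq_bigr => s _; rewrite exchange_big/=; apply: eq_bigr => k _.
  by rewrite /al mulr_suml mulr_sumr; apply: eq_bigr => i _; ring.
congr (_ @ \oo --> _): H; rewrite -/Zl.
pose be (p : nat) (i : heavy) : R := \sum_(k < m.+1 | (p < k)%N) a (i, k).
rewrite (_ : (fun w => cos (\sum_p a p * netput_lim w p + b)) =
  (fun w => cos (\sum_i \sum_k a (i, k) * X (t * k%:R / m%:R) w i + b))); last first.
  by apply/funext => w; rewrite sum_pair.
rewrite (brownian_grid_cos bX cov_psd (fun i k => a (i, k)) t_gt0 m_gt0 b).
congr (expR (- _) * _).
  under eq_bigr => s _ do rewrite mulr_sumr.
  rewrite exchange_big/=; apply: eq_bigr => p _.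
  transitivity ((\sum_i \sum_k be p i * be p k * cov i k) * (t / m%:R) / 2).
    rewrite cov_gram !mulr_suml; apply: eq_bigr => s _.
    rewrite (_ : \sum_(k < m.+1 | (p < k)%N) al s k = \sum_i be p i * gam i s); first ring.
    by rewrite /al exchange_big/=; apply: eq_bigr => i _; rewrite -mulr_suml.
  congr (_ / _); rewrite mulr_suml; apply: eq_bigr => i _; rewrite mulr_suml; apply: eq_bigr => k _.
  by rewrite -[LHS]mulrA.
apply: Ex_ae.
- apply: measurable_cosT; apply: measurable_funD => //; apply: measurable_sum => j; exact: measurable_funM.
- apply: measurable_cosT; apply: measurable_funD => //; apply: measurable_sum => i; apply: measurable_funM => //.
  exact: (bm_measurable bX).
apply: filterS X0 => w Xw; congr cos; rewrite [b + b1]addrC; congr (_ + (_ + _)).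
  under [RHS]eq_bigr => i _ do rewrite Xw mulr_sumr big_mkcond/=.
  rewrite exchange_big/=; apply: eq_bigr => j _; rewrite /z mulr_suml; apply: eq_bigr => i _.
  by case: ifP => _; rewrite ?mul1r ?mul0r ?mulr0//; ring.
rewrite /b1 [RHS]exchange_big/=; apply: eq_bigr => i _.
under [RHS]eq_bigr => p _ do rewrite mulr_suml big_mkcond/=.
rewrite [RHS]exchange_big/=; apply: eq_bigr => k _.
have km : (k <= m)%N by rewrite -ltnS ltn_ord.
have e : (k%:R : R) = \sum_(p < m) (p < k)%N%:R * 1.
  by rewrite (@sum_indicator R k m (fun=> 1) km) sumr_const card_ord.
rewrite e mulr_sumr mulr_suml mulr_sumr mulr_sumr; apply: eq_bigr => p _.
by case: (p < k)%N => /=; ring.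
Qed.

Lemma netput_path r w (i : heavy) (k : 'I_m.+1) : (0 < r)%N -> r%:R * netput r w (i, k) =
  \sum_(j in jobs_of res (val i)) ((Q0 r j w)%:R / mu j + partial_sum (fun n => v j n w - (mu j)^-1) (nk (inl j) r k)
    - partial_sum (fun n => ubar j n w - 1) (nk (inr j) r k) / mu j) + th i * r%:R * (t * k%:R / m%:R).
Proof.
move=> r0; have rn : r%:R != 0 :> R by rewrite pnatr_eq0 -lt0n.
rewrite /netput/= !mulrDr; congr (_ + _); last by ring.
rewrite mulrA divff// mul1r big_sumType/= -big_split/= mulr_sumr.
rewrite (big_mkcond (fun j => j \in _))/= [RHS]big_mkcond/= -big_split; apply: eq_bigr => j _ /=.
case: ifP => _ /=; last by rewrite !mul0r oppr0 mul0r !add0r.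
by rewrite mul1r mulNr mul1r -addrA; congr (_ + (_ - _)); [field; rewrite rn gt_eqF|rewrite mulrC].
Qed.

Variables (eta kap Mq C : R).
Hypotheses (eta_gt0 : 0 < eta) (kap_gt0 : 0 < kap) (Mq_ge0 : 0 <= Mq) (CP : forall j, lam j * t + 1 <= C).
(** Horizon and window at scale [r]. As [C] exceeds each [lam j t] by at least 1, there is a spare
    [r^2]: half of it absorbs the rate error, the other half the initial jobs and the arrival
    fluctuations. *)
Let Nr (r : nat) := (Num.truncn (C * r%:R ^+ 2)).+1.
Let Lr (r : nat) := (Num.truncn (kap * r%:R ^+ 2)).+1.
Let Bc : R := ((C + 1) / kap + 1) * eta.
Let Hc : R := \sum_j Mq / mu j + \sum_i \sum_s `|gam i s| * Bc + \sum_i `|th i| * t.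

Definition quiet (r : nat) (w : Om) : bool :=
  [forall j, (Q0 r j w)%:R / r%:R <= Mq] && [forall s, osc_le (x s ^~ w) (Nr r) (Lr r) (eta * r%:R)].

Let C_ge0 (j : 'I_nJ) : 0 <= C.
Proof. by apply: le_trans (CP j); rewrite addr_ge0// mulr_ge0// ltW. Qed.

Let tk_le k : (k <= m)%N -> 0 <= t * k%:R / m%:R <= t.
Proof.
move=> km; rewrite !mulr_ge0 ?invr_ge0 ?(ltW t_gt0)//= -mulrA ler_piMr ?(ltW t_gt0)//.
by rewrite ler_pdivrMr ?ltr0n// mul1r ler_nat.
Qed.

Let nkN s r k : (k <= m)%N -> (nk s r k <= Nr r)%N.
Proof.
move=> km; have /andP[a b] := tk_le km; apply: leqW; apply: le_truncn.
rewrite [r%:R ^+ 2 * _]mulrC mulrA ler_wpM2r ?exprn_ge0//.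
case: s => j /=; apply: le_trans (CP j); rewrite (@le_trans _ _ (lam j * t)) ?lerDl// ler_wpM2l//; exact: ltW.
Qed.

Lemma quiet_range r w s n : (0 < r)%N -> quiet r w -> (n <= Nr r)%N -> `|partial_sum (x s ^~ w) n| <= Bc * r%:R.
Proof.
move=> r0 /andP[_ /forallP/(_ s) o] nN; apply: osc_range_scaled o _ nN => //; last by rewrite ler1n.
by case: s => j; exact: C_ge0 j.
Qed.

Lemma quiet_bound r w p : (0 < r)%N -> quiet r w -> `|netput r w p| <= Hc.
Proof.
move=> r0 qw; have rp : 0 < (r%:R : R) by rewrite ltr0n.
case: p => i k; have km : (k <= m)%N by rewrite -ltnS ltn_ord.
rewrite /netput/= /Hc; apply: (le_trans (ler_normD _ _)); apply: lerD.
  apply: (le_trans (ler_normD _ _)); apply: lerD.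
    apply: (le_trans (ler_norm_sum _ _ _)); rewrite big_mkcond/=; apply: ler_sum => j _.
    case: ifP => _; last by rewrite divr_ge0// ltW.
    rewrite ger0_norm ?divr_ge0// ?(ltW (mu_gt0 j))// ler_wpM2r ?invr_ge0 ?(ltW (mu_gt0 j))//.
    by case/andP: qw => /forallP/(_ j).
  rewrite mulr_sumr; apply: (le_trans (ler_norm_sum _ _ _)); rewrite (bigD1 i)//=.
  apply: (@le_trans _ _ (\sum_s `|gam i s| * Bc)).
    apply: ler_sum => s _; rewrite !normrM mulrCA ler_wpM2l//.
    rewrite gtr0_norm ?invr_gt0// mulrC ler_pdivrMr//; apply: quiet_range => //; exact: nkN.
  rewrite lerDl sumr_ge0// => i' _; apply: sumr_ge0 => s _; rewrite mulr_ge0//.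
  have := quiet_range s (n := 0%N) r0 qw (leq0n _).
  by move=> /(le_trans (normr_ge0 _)); rewrite pmulr_lge0.
have /andP[a b] := tk_le km.
rewrite normrM (bigD1 i)//= (ger0_norm a) -[leLHS]addr0 lerD ?ler_wpM2l// sumr_ge0// => i' _.
by rewrite mulr_ge0// ltW.
Qed.

Hypotheses (m_kap : forall j, lam j * t / m%:R <= kap / 4) (m_eta : forall i, `|th i| * t / m%:R <= eta / 2).

(* On quiet paths the renewal clocks stay within the oscillation
   window of the deterministic ones, which is all that [path_bound] needs. *)
Lemma workload_near : \forall r \near \oo, forall w, regular r w -> quiet r w -> forall i : heavy,
  `|\sum_(j in jobs_of res (val i)) qhat r j t w / mu j - grid_reflection (fun k => netput r w (i, k))|
    <= 5 * C1 * eta.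
Proof.
have lc j : \forall r \near \oo, `|lamr r j - lam j| * t <= Num.min (1 / 2) (kap / 4).
  have e0 : 0 < Num.min (1 / 2) (kap / 4) / t by rewrite divr_gt0// lt_min !divr_gt0.
  have /cvgrPdist_le/(_ _ e0) := @lamr_cvg j; apply: filterS => r; rewrite distrC.
  by rewrite ler_pdivlMr.
have tc (i : heavy) : \forall r \near \oo, `|r%:R * (load res mu (lamr r) (val i) - 1) - th i| * t <= eta / 2.
  have e0 : 0 < eta / 2 / t by rewrite !divr_gt0.
  have thE : theta (val i) = (th i)%:E by rewrite /th fineK//; have := valP i; rewrite finset.inE.
  have := @traffic (val i); rewrite thE => /fine_cvgP[_ /cvgrPdist_le/(_ _ e0)].
  by apply: filterS => r /=; rewrite distrC ler_pdivlMr.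
have lcA : \forall r \near \oo, forall j, `|lamr r j - lam j| * t <= Num.min (1 / 2) (kap / 4).
  by apply: filter_forall => j; exact: lc.
have tcA : \forall r \near \oo, forall i : heavy, `|r%:R * (load res mu (lamr r) (val i) - 1) - th i| * t <= eta / 2.
  by apply: filter_forall => i; exact: tc.
(* [K1] and [K2] gather the terms of order [r] in the horizon and window hypotheses of [path_bound];
   for large [r] they are beaten by fractions of [r^2] and [kap r^2]. *)
pose K1 := Mq + Bc + 2.
pose K2 := \sum_j mu j * (2 * Hc + 5 * C1 * eta + 2 * Bc) + 1.
near=> r; move=> w [adm vp up] qw i.
have r0 : (0 < r)%N by near: r; exact: nbhs_infty_gt.
have r1 : 1 <= (r%:R : R) by rewrite ler1n.
have rp : 0 < (r%:R : R) by lra.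
have re : 1 <= eta * r%:R by rewrite mulrC -ler_pdivrMr//; near: r; exact: nbhs_infty_ger.
have rK1 : 2 * K1 <= r%:R by near: r; exact: nbhs_infty_ger.
have rK1' : 4 * K1 / kap <= r%:R by near: r; exact: nbhs_infty_ger.
have rK2 : K2 / kap <= r%:R by near: r; exact: nbhs_infty_ger.
have lr j : `|lamr r j - lam j| * t <= Num.min (1 / 2) (kap / 4) by move: j; near: r.
have tr : `|r%:R * (load res mu (lamr r) (val i) - 1) - th i| * t <= eta / 2 by move: i; near: r.
have K1r : K1 * r%:R <= r%:R ^+ 2 / 2 by rewrite expr2; nra.
have K1r' : K1 * r%:R <= kap / 4 * r%:R ^+ 2.
  rewrite ler_pdivrMr// in rK1'; rewrite expr2; nra.
have K2r : K2 * r%:R <= kap * r%:R ^+ 2.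
  rewrite ler_pdivrMr// in rK2; rewrite expr2; nra.
have r2p : 0 <= (r%:R : R) ^+ 2 by rewrite exprn_ge0.
have /andP[_ Lk] := truncn_itv (mulr_ge0 (ltW kap_gt0) r2p); rewrite -/(Lr r) in Lk.
have NC : (0 < nJ)%N -> C * r%:R ^+ 2 <= (Nr r)%:R.
  move=> nJ0; have /andP[_ h1] := truncn_itv (mulr_ge0 (C_ge0 (Ordinal nJ0)) r2p); exact: ltW h1.
have qj j : (Q0 r j w)%:R <= Mq * r%:R.
  by rewrite -ler_pdivrMr//; case/andP: qw => /forallP/(_ j).
have os s : osc_le (x s ^~ w) (Nr r) (Lr r) (eta * r%:R) by case/andP: qw => _ /forallP/(_ s).
have t2 : (r%:R : R) ^+ 2 * t = t * r%:R ^+ 2 by rewrite mulrC.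
have lrP j : `|lamr r j - lam j| * (r%:R ^+ 2 * t) <= Num.min (1 / 2) (kap / 4) * r%:R ^+ 2.
  by rewrite t2 mulrA ler_wpM2r.
have lr2 j : `|lamr r j - lam j| * (r%:R ^+ 2 * t) <= r%:R ^+ 2 / 2.
  apply: (le_trans (lrP j)); rewrite mulrC ler_wpM2l// ge_min; apply/orP; left; lra.
have lr4 j : `|lamr r j - lam j| * (r%:R ^+ 2 * t) <= kap / 4 * r%:R ^+ 2.
  by apply: (le_trans (lrP j)); rewrite ler_wpM2r// ge_min lexx orbT.
have lamC j : lam j * (r%:R ^+ 2 * t) + r%:R ^+ 2 <= C * r%:R ^+ 2.
  by rewrite t2 mulrA -[X in _ + X <= _]mul1r -mulrDl ler_wpM2r.
have lamL j : lam j * (r%:R ^+ 2 * t) / m%:R <= kap / 4 * r%:R ^+ 2.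
  have -> : lam j * (r%:R ^+ 2 * t) / m%:R = lam j * t / m%:R * r%:R ^+ 2 by ring.
  by rewrite ler_wpM2r.
have K1E : K1 * r%:R >= Mq * r%:R + Bc * r%:R + 2.
  by rewrite /K1 !mulrDl lerD2l; lra.
have dl j : lamr r j * (r%:R ^+ 2 * t) <= lam j * (r%:R ^+ 2 * t) + `|lamr r j - lam j| * (r%:R ^+ 2 * t).
  rewrite -mulrDl ler_wpM2r ?mulr_ge0 ?(ltW t_gt0)//.
  have := ler_norm (lamr r j - lam j); lra.
have Lp : (0 < Lr r)%N by [].
have pb : `|\sum_(j in jobs_of res (val i)) queue (Q0 r j w) (interarrival (lamr r) (fun j n => ubar j n) w j)
      (fun n => v j n w) (fun s => T r j s w) (r%:R ^+ 2 * t) / mu j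
    - grid_reflection (fun k => r%:R * netput r w (i, k))| <= 5 * C1 * (eta * r%:R).
  rewrite (_ : (fun k => r%:R * netput r w (i, k)) = (fun k : 'I_m.+1 => \sum_(j in jobs_of res (val i)) ((Q0 r j w)%:R / mu j + partial_sum (fun n => v j n w - (mu j)^-1) (nk (inl j) r k)
    - partial_sum (fun n => ubar j n w - 1) (nk (inr j) r k) / mu j) + th i * r%:R * (t * k%:R / m%:R))); last first.
    by apply/funext => k; rewrite netput_path.
  apply: (path_bound (B := Bc * r%:R) (H := Hc * r%:R) (N := Nr r) (L := Lr r) (lam := lam) (lamr := lamr r)
    (T := fun j s => T r j s w)) => //.
  - by move=> j; exact: lamr_gt0.
  - by move=> j; exact: ltW.
  - by move=> j s s0; exact: (adm_queue adm).
  - by move=> j s s0; exact: (adm_hol adm).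
  - exact: (adm_idle adm (val i)).
  - by move=> s s0; apply: (adm_work adm) => //; exact: (valP i).
  - by move=> j; exact: (os (inl j)).
  - by move=> j; exact: (os (inr j)).
  - by move=> j n nN; exact: (quiet_range (inl j) r0 qw nN).
  - by move=> j n nN; exact: (quiet_range (inr j) r0 qw nN).
  - move=> j; have := NC (leq_ltn_trans (leq0n j) (ltn_ord j)).
    have := dl j; have := lr2 j; have := lamC j; have := qj j; lra.
  - move=> j; have := NC (leq_ltn_trans (leq0n j) (ltn_ord j)); have := lamC j; lra.
  - have kr : 0 <= kap * r%:R ^+ 2 by rewrite mulr_ge0// ltW.
    move=> j; have := lr4 j; have := lamL j; have := qj j.
    move: K1E K1r' Lk kr; set q := (r%:R : R) ^+ 2; move: (`|_| * _) (lam j * _ / _) => z1 z2; lra.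
  - have h1 : `|r%:R * (\sum_(j in jobs_of res (val i)) lamr r j / mu j - 1) - th i| * (r%:R * t) <= eta / 2 * r%:R.
      by rewrite [r%:R * t]mulrC mulrA ler_wpM2r// ltW.
    have h2 : `|th i| * (r%:R * t / m%:R) <= eta / 2 * r%:R.
      have -> : `|th i| * (r%:R * t / m%:R) = `|th i| * t / m%:R * r%:R by ring.
      by rewrite ler_wpM2r// ltW.
    lra.
  - move=> k; rewrite -netput_path// normrM (ger0_norm (ltW rp)) mulrC ler_wpM2r ?(ltW rp)//.
    exact: quiet_bound.
  - move=> j; apply: (@le_trans _ _ (K2 * r%:R)); last by lra.
    have Bc0 : 0 <= Bc by have := quiet_range (inl j) (n := 0%N) r0 qw (leq0n _); move=> /(le_trans (normr_ge0 _)); rewrite pmulr_lge0.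
    have Hc0 : 0 <= Hc by have := quiet_bound (i, ord0) r0 qw; move=> /(le_trans (normr_ge0 _)).
    have C10 : 0 <= C1 by rewrite addr_ge0// sumr_ge0// => l _; rewrite addr_ge0// divr_ge0// ltW.
    have Ce : 0 <= C1 * eta by rewrite mulr_ge0// ltW.
    have q0 : 0 <= 2 * Hc + 5 * C1 * eta + 2 * Bc by rewrite -mulrA; lra.
    have h1 : mu j * (2 * Hc + 5 * C1 * eta + 2 * Bc) <= \sum_j mu j * (2 * Hc + 5 * C1 * eta + 2 * Bc).
      rewrite (bigD1 j)//= lerDl sumr_ge0// => l _; rewrite mulr_ge0//; exact: ltW.
    rewrite -/C1; have -> : mu j * (2 * (Hc * r%:R) + 5 * C1 * (eta * r%:R) + 2 * (Bc * r%:R)) + 1 =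
      mu j * (2 * Hc + 5 * C1 * eta + 2 * Bc) * r%:R + 1 by ring.
    by rewrite /K2 [leRHS]mulrDl mul1r; apply: lerD => //; rewrite ler_wpM2r// ltW.
rewrite grid_reflectionZ ?(ltW rp)// in pb.
have -> : \sum_(j in jobs_of res (val i)) qhat r j t w / mu j = r%:R^-1 *
   \sum_(j in jobs_of res (val i)) queue (Q0 r j w) (interarrival (lamr r) (fun j n => ubar j n) w j)
      (fun n => v j n w) (fun s => T r j s w) (r%:R ^+ 2 * t) / mu j.
  by rewrite mulr_sumr; apply: eq_bigr => j _; rewrite mulrA.
rewrite -(ler_pM2l rp) -[X in X * `|_|](gtr0_norm rp) -normrM mulrBr mulrA divff ?gt_eqF// mul1r.
by apply: (le_trans pb); rewrite mulrCA mulrC -!mulrA; lra.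
Unshelve. all: by end_near.
Qed.

(** On quiet paths the scaled queues are feasible for their own workloads, which are close to the
    grid reflections, and the value is Lipschitz; on other paths the cap [M] is the whole error. *)
Lemma cost_near (CL : R) : 0 <= CL -> (forall w w', lp w - lp w' <= CL * \sum_i `|w i - w' i|) ->
  \forall r \near \oo, forall w (M : R), 0 <= M -> regular r w ->
  capped_value M (netput r w) <=
    \sum_j h j * qhat r j t w + (CL * (#|heavy|%:R * (5 * C1)) * eta + M * (~~ quiet r w)%:R).
Proof.
move=> CL0 lpL; near=> r => w M M0 rw.
have wl : forall w, regular r w -> quiet r w -> forall i : heavy,
  `|\sum_(j in jobs_of res (val i)) qhat r j t w / mu j - grid_reflection (fun k => netput r w (i, k))|
    <= 5 * C1 * eta by near: r; exact: workload_near.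
have {}wl := wl w rw.
have q0 j : 0 <= qhat r j t w.
  rewrite mulr_ge0 ?invr_ge0//; have [adm _ _] := rw; apply: (adm_queue adm).
  by rewrite mulr_ge0 ?exprn_ge0// ltW.
have hq0 : 0 <= \sum_j h j * qhat r j t w by apply: sumr_ge0 => j _; rewrite mulr_ge0// ltW.
have C10 : 0 <= C1 by rewrite addr_ge0// sumr_ge0// => l _; rewrite addr_ge0// divr_ge0// ltW.
have K0 : 0 <= CL * (#|heavy|%:R * (5 * C1)) * eta by rewrite !mulr_ge0// ltW.
have [qw|nq] := boolP (quiet r w); rewrite /= ?mulr0 ?mulr1 ?addr0; last first.
  have /andP[_] := capped_value_bounds (netput r w) M0; lra.
have h1 := lpL (fun i => grid_reflection (fun k => netput r w (i, k)))
  (fun i : heavy => \sum_(j in jobs_of res (val i)) qhat r j t w / mu j).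
have h2 := lp_real_le net hier h_gt0 mu_gt0 (fun i : heavy => erefl (\sum_(j in jobs_of res (val i)) qhat r j t w / mu j)) q0.
have h3 : \sum_(i : heavy) `|grid_reflection (fun k => netput r w (i, k)) -
   \sum_(j in jobs_of res (val i)) qhat r j t w / mu j| <= #|heavy|%:R * (5 * C1 * eta).
  apply: (@le_trans _ _ (\sum_(i : heavy) 5 * C1 * eta)); first by apply: ler_sum => i _; rewrite distrC; exact: wl.
  by rewrite sumr_const -[_ *+ #|_|]mulr_natl.
have h4 : CL * \sum_(i : heavy) `|grid_reflection (fun k => netput r w (i, k)) -
   \sum_(j in jobs_of res (val i)) qhat r j t w / mu j| <= CL * (#|heavy|%:R * (5 * C1)) * eta.
  by apply: (le_trans (ler_wpM2l CL0 h3)); rewrite -!mulrA.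
apply: (@le_trans _ _ (lp (fun i => grid_reflection (fun k => netput r w (i, k))))).
  by rewrite /capped_value ge_min lexx.
rewrite /lp in h1 *; lra.
Unshelve. all: by end_near.
Qed.

End Grid.

(* A measurable upper bound for the indicator of the non-quiet event. *)
Definition noise (eta kap Mq C : R) (r : nat) (w : Om) : R :=
  outside Mq (fun j => (Q0 r j w)%:R / r%:R : R) +
  \sum_s (~~ osc_le (x s ^~ w) (Num.truncn (C * r%:R ^+ 2)).+1 (Num.truncn (kap * r%:R ^+ 2)).+1 (eta * r%:R))%:R.

Lemma noise_quiet eta kap Mq C r w : (~~ quiet eta kap Mq C r w)%:R <= noise eta kap Mq C r w.
Proof.
have s0 (s' : pred ('I_nJ + 'I_nJ)) : 0 <= \sum_(s | s' s) (~~ osc_le (x s ^~ w) (Num.truncn (C * r%:R ^+ 2)).+1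
  (Num.truncn (kap * r%:R ^+ 2)).+1 (eta * r%:R))%:R :> R by apply: sumr_ge0.
rewrite /noise /outside; have [qw|] := boolP (quiet eta kap Mq C r w); first by rewrite /= addr_ge0//; exact: s0.
rewrite /quiet negb_and => /orP[].
  rewrite negb_forall => /existsP[j hj].
  rewrite (_ : [forall i, `|(Q0 r i w)%:R / r%:R : R| <= Mq] = false) ?lerDl; first exact: s0.
  by apply/negbTE; rewrite negb_forall; apply/existsP; exists j; apply: contra hj; exact: le_trans (ler_norm _).
rewrite negb_forall => /existsP[s ns]; rewrite (bigD1 s)//= ns addrCA lerDl addr_ge0//; exact: s0.
Qed.

Lemma measurable_noise eta kap Mq C r : measurable_fun setT (noise eta kap Mq C r).
Proof.
apply: measurable_funD.
  apply: (measurable_outside Mq (Y := fun w j => (Q0 r j w)%:R / r%:R : R)) => j.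
  by apply: measurable_funM => //; exact: measurableT_comp.
by apply: measurable_sum => s; apply: measurable_osc => n; exact: measurable_walk.
Qed.

Lemma noise_bounds eta kap Mq C r w : 0 <= noise eta kap Mq C r w <= 1 + #|{: 'I_nJ + 'I_nJ}|%:R.
Proof.
rewrite /noise /outside addr_ge0 ?sumr_ge0//= lerD ?lern1 ?leq_b1//.
rewrite -[leRHS](_ : \sum_(s : 'I_nJ + 'I_nJ) 1 = _); last by rewrite sumr_const.
by apply: ler_sum => s _; rewrite lern1 leq_b1.
Qed.

(** Indicators are not continuous, so convergence in law is tested with [1 - exp (- c |q|^2)]. With
    [c = 1 / (n + 1)] it is at least 1/2 once a coordinate passes [n + 1], and its limiting
    expectation vanishes as [n] grows. *)
Lemma Q0_tight (e : R) : 0 < e -> exists2 B : R, 0 <= B &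
  \forall r \near \oo, Ex P (fun w => outside B (fun j => (Q0 r j w)%:R / r%:R : R)) <= e.
Proof.
move=> e0.
pose g (c : R) (q : 'I_nJ -> R) := 1 - expR (- (c * \sum_j q j ^+ 2)).
have mg c (Y : 'I_nJ -> Om -> R) : (forall j, measurable_fun setT (Y j)) -> measurable_fun setT (fun w => g c (Y ^~ w)).
  move=> mY; apply: measurable_funB => //; apply: measurableT_comp => //; apply: measurableT_comp => //.
  by apply: measurable_funM => //; apply: measurable_sum => j; exact: measurable_funX.
have S0 (q : 'I_nJ -> R) : 0 <= \sum_j q j ^+ 2 by apply: sumr_ge0 => j _; exact: sqr_ge0.
have g0 c q : 0 <= c -> 0 <= g c q <= 1.
  move=> c0; have h1 := expR_ge0 (- (c * \sum_j q j ^+ 2)).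
  have : expR (- (c * \sum_j q j ^+ 2)) <= expR 0 by rewrite ler_expR oppr_le0 mulr_ge0.
  by rewrite expR0 /g => h2; apply/andP; split; lra.
have gb c q : 0 <= c -> `|g c q| <= 1 by move=> /(g0 _ q)/andP[a b]; rewrite ger0_norm.
have lim0 : Ex P (fun w => g n.+1%:R^-1 (fun j => Q0t j w)) @[n --> \oo] --> (0 : R).
  rewrite -[X in _ --> X](Ex_cst P 0); apply: (@Ex_cvg _ _ _ P _ (fun=> 0) 1) => //.
  - by move=> n; apply: (mg n.+1%:R^-1 (fun j => Q0t j : Om -> R)) => j.
  - by move=> n w; apply: gb; rewrite invr_ge0.
  move=> w; rewrite /g; set q := \sum_j _.
  rewrite -[X in _ --> X](subrr 1); apply: cvgB; first exact: cvg_cst.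
  have cv : - (n.+1%:R^-1 * q) @[n --> \oo] --> - (0 * q).
    by apply: cvgN; apply: cvgM; [exact: cvg_harmonic|exact: cvg_cst].
  rewrite mul0r oppr0 in cv; rewrite -[X in _ --> X](@expR0 R).
  exact: (@cvg_comp _ _ _ (fun n => - (n.+1%:R^-1 * q)) expR _ _ _ cv (@continuous_expR R 0)).
have e4 : 0 < e / 4 by rewrite divr_gt0.
have /cvgrPdist_le/(_ _ e4)[n _ /(_ n (leqnn n))/=] := lim0.
rewrite sub0r normrN => /(le_trans (ler_norm _)) gn.
pose c : R := n.+1%:R^-1; have c0 : 0 <= c by rewrite invr_ge0.
pose f (q : 'rV[R]_nJ) := g c (fun j => q ord0 j).
have cf : continuous f.
  move=> q; suff : {for q, continuous (fun q : 'rV[R]_nJ => 1 - expR (- (c * \sum_j q ord0 j ^+ 2)) : R)} by [].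
  apply: continuousB; first exact: cst_continuous.
  apply: (@continuous_comp _ _ _ (fun q : 'rV[R]_nJ => - (c * \sum_j q ord0 j ^+ 2)) expR); last exact: continuous_expR.
  apply: continuousN; apply: continuousM; first exact: cst_continuous.
  suff : forall s : seq 'I_nJ, {for q, continuous (fun q : 'rV[R]_nJ => \sum_(j <- s) q ord0 j ^+ 2)} by apply.
  elim=> [|j s ih].
    by rewrite (_ : (fun _ => _) = fun=> 0); [exact: cst_continuous|apply/funext => u; rewrite big_nil].
  rewrite (_ : (fun _ => _) = fun u : 'rV[R]_nJ => u ord0 j * u ord0 j + \sum_(j <- s) u ord0 j ^+ 2).
    apply: continuousD; last exact: ih.
    by apply: continuousM; exact: coord_continuous.
  by apply/funext => u; rewrite big_cons expr2.
have fb : exists M, forall q, `|f q| <= M by exists 1 => q; exact: gb.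
have := Q0_diffusion cf fb.
have EE (Y : 'I_nJ -> Om -> R) : (forall j, measurable_fun setT (Y j)) ->
    ('E_P[f \o (fun w => \row_j Y j w)] = (Ex P (fun w => g c (Y ^~ w)))%:E)%E.
  move=> mY; rewrite unlock /Ex /Rintegral.
  have -> : (fun w => (f (\row_j Y j w))%:E) = (fun w => (g c (Y ^~ w))%:E).
    by apply/funext => w; rewrite /f; congr ((g _ _)%:E); apply/funext => j; rewrite mxE.
  have i1 : integr P (fun w => g c (Y ^~ w)) by apply: (@integr_bd _ _ _ P _ 1) => [|w]; [exact: mg|exact: gb].
  by rewrite fineK//; exact: (integrable_fin_num measurableT i1).
have mQ r j : measurable_fun setT (fun w => (Q0 r j w)%:R / r%:R : R).
  by apply: measurable_funM => //; exact: measurableT_comp.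
rewrite (EE (fun j w => Q0t j w))//.
have -> : (fun r => 'E_P[f \o (fun w => \row_j ((Q0 r j w)%:R / r%:R)%R)])%E =
    (fun r => (Ex P (fun w => g c (fun j => (Q0 r j w)%:R / r%:R)))%:E).
  by apply/funext => r; exact: (EE (fun j w => (Q0 r j w)%:R / r%:R) (mQ r)).
move=> /fine_cvgP[_ /cvgrPdist_le/(_ _ e4) h1].
exists n.+1%:R => //.
apply: filterS h1 => r; rewrite /= ler_norml => /andP[h2 _].
have ig : integr P (fun w => g c (fun j => (Q0 r j w)%:R / r%:R)).
  by apply: (@integr_bd _ _ _ P _ 1) => [|w]; [exact: (mg c (fun j w => (Q0 r j w)%:R / r%:R))|exact: gb].
apply: (@le_trans _ _ (2 * Ex P (fun w => g c (fun j => (Q0 r j w)%:R / r%:R)))); last first.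
  by move: h2 gn; rewrite -/c; move: (Ex P _) (Ex P _) => ? ?; lra.
rewrite -ExZ//; apply: Ex_le.
- apply: (@integr_bd _ _ _ P _ 1) => [|w]; first exact: (measurable_outside _ (Y := fun w j => (Q0 r j w)%:R / r%:R : R)).
  by rewrite /outside ger0_norm// lern1 leq_b1.
- exact: integrZ.
move=> w; rewrite /outside; have [h3|] := boolP [forall j, `|(Q0 r j w)%:R / r%:R : R| <= n.+1%:R]; first by rewrite /= mulr_ge0//; have /andP[] := g0 c (fun j => (Q0 r j w)%:R / r%:R) c0.
rewrite negb_forall => /existsP[j]; rewrite -ltNge => h3 /=.
set q := fun j => (Q0 r j w)%:R / r%:R : R.
have h4 : n.+1%:R ^+ 2 <= \sum_j q j ^+ 2.
  rewrite (bigD1 j)//= -[leLHS]addr0 lerD ?sumr_ge0//; last by move=> l _; exact: sqr_ge0.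
  by rewrite -[q j ^+ 2]real_normK ?num_real// lerXn2r ?nnegrE// ltW.
have h5 : 1 <= c * \sum_j q j ^+ 2.
  apply: (@le_trans _ _ (c * n.+1%:R ^+ 2)); last by rewrite ler_wpM2l.
  by rewrite /c expr2 mulrA mulVf ?gt_eqF// mul1r ler1n.
have h6 := expR_ge1Dx (c * \sum_j q j ^+ 2).
rewrite /g expRN; have h7 : (expR (c * \sum_j q j ^+ 2))^-1 <= 2^-1.
  by rewrite lef_pV2 ?posrE ?expR_gt0//; lra.
lra.
Qed.

Lemma noise_small (eta C e : R) : 0 < eta -> 0 <= C -> 0 < e -> exists kap Mq : R,
  [/\ 0 < kap, 0 <= Mq & \forall r \near \oo, Ex P (noise eta kap Mq C r) <= e].
Proof.
move=> eta0 C0 e0.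
have e2 : 0 < e / 2 by rewrite divr_gt0.
pose n := #|{: 'I_nJ + 'I_nJ}|.
have en : 0 < e / 2 / n.+1%:R by rewrite divr_gt0.
have [Mq Mq0 Q1] := Q0_tight e2.
have /choice[k0 k0P] : forall s, exists k0 : R, 0 < k0 /\ forall k, 0 < k -> k <= k0 ->
  \forall r \near \oo, Ex P (fun w => (~~ osc_le (x s ^~ w) (Num.truncn (C * r%:R ^+ 2)).+1
     (Num.truncn (k * r%:R ^+ 2)).+1 (eta * r%:R))%:R) <= e / 2 / n.+1%:R.
  by move=> s; have [G cw] := walk s; exact: (osc_small cw C0 eta0 en).
have S0 : 0 < 1 + \sum_s (k0 s)^-1.
  by rewrite ltr_wpDr// sumr_ge0// => s _; rewrite invr_ge0 ltW//; case: (k0P s).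
(* A positive number below every [k0 s], which also makes sense when there is no [s]. *)
exists (1 + \sum_s (k0 s)^-1)^-1, Mq; split => //; first by rewrite invr_gt0.
have osc_s s : \forall r \near \oo, Ex P (fun w => (~~ osc_le (x s ^~ w) (Num.truncn (C * r%:R ^+ 2)).+1
     (Num.truncn ((1 + \sum_s (k0 s)^-1)^-1 * r%:R ^+ 2)).+1 (eta * r%:R))%:R) <= e / 2 / n.+1%:R.
  have [ks hs] := k0P s; apply: hs; first by rewrite invr_gt0.
  rewrite -[leRHS]invrK lef_pV2 ?posrE ?invr_gt0// (bigD1 s)//= addrCA lerDl addr_ge0// sumr_ge0// => s' _.
  by rewrite invr_ge0 ltW//; case: (k0P s').
have hA : \forall r \near \oo, forall s, Ex P (fun w => (~~ osc_le (x s ^~ w) (Num.truncn (C * r%:R ^+ 2)).+1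
     (Num.truncn ((1 + \sum_s (k0 s)^-1)^-1 * r%:R ^+ 2)).+1 (eta * r%:R))%:R) <= e / 2 / n.+1%:R.
  by apply: filter_forall => s; exact: osc_s.
near=> r.
have q1 : Ex P (fun w => outside Mq (fun j => (Q0 r j w)%:R / r%:R : R)) <= e / 2 by near: r.
have o1 s : Ex P (fun w => (~~ osc_le (x s ^~ w) (Num.truncn (C * r%:R ^+ 2)).+1
     (Num.truncn ((1 + \sum_s (k0 s)^-1)^-1 * r%:R ^+ 2)).+1 (eta * r%:R))%:R) <= e / 2 / n.+1%:R by move: s; near: r.
have io s : integr P (fun w => (~~ osc_le (x s ^~ w) (Num.truncn (C * r%:R ^+ 2)).+1
     (Num.truncn ((1 + \sum_s (k0 s)^-1)^-1 * r%:R ^+ 2)).+1 (eta * r%:R))%:R).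
  apply: (@integr_bd _ _ _ P _ 1) => [|w]; first by apply: measurable_osc => k; exact: measurable_walk.
  by rewrite ger0_norm// lern1 leq_b1.
rewrite /noise ExD; last 2 first.
- apply: (@integr_bd _ _ _ P _ 1) => [|w].
    apply: (measurable_outside _ (Y := fun w j => (Q0 r j w)%:R / r%:R : R)) => j.
    by apply: measurable_funM => //; exact: measurableT_comp.
  by rewrite /outside ger0_norm// lern1 leq_b1.
- exact: integr_sum.
rewrite Ex_sum//.
have : \sum_s Ex P (fun w => (~~ osc_le (x s ^~ w) (Num.truncn (C * r%:R ^+ 2)).+1
     (Num.truncn ((1 + \sum_s (k0 s)^-1)^-1 * r%:R ^+ 2)).+1 (eta * r%:R))%:R) <= e / 2.
  apply: (@le_trans _ _ (\sum_(s : 'I_nJ + 'I_nJ) e / 2 / n.+1%:R)); first by apply: ler_sum => s _; exact: o1.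
  by rewrite sumr_const -[_ *+ #|_|]mulr_natr mulrAC ler_pdivrMr// ler_wpM2l ?(ltW e2)// ler_nat.
lra.
Unshelve. all: by end_near.
Qed.

(** The tightness asked by [levy_lipschitz] comes from quiet paths with [eta = 1], on which the
    netput is bounded by a constant; [noise_small] bounds the probability of the others for all
    large [r]. *)
Lemma capped_netput_cvg (t : R) (m : nat) (M : R) : 0 < t -> (0 < m)%N -> 0 <= M ->
  Ex P (fun w => capped_value M (netput t (m := m) r w)) @[r --> \oo] -->
  Ex P (fun w => capped_value M (netput_lim t (m := m) w)).
Proof.
move=> t0 m0 M0; have [L L0 FL] := capped_value_lipschitz.
have mZ : coord_measurable (netput_lim t (m := m)) by apply: measurable_netput_lim.
apply: (@levy_lipschitz _ _ _ P _ (netput t (m := m)) (netput_lim t (m := m)) (fun y => capped_value M y) M L) => //.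
- by move=> r; exact: measurable_netput.
- by move=> a b; exact: netput_cos.
- move=> e e0.
  pose C := \sum_j lam j * t + 1.
  have CP j : lam j * t + 1 <= C.
    by rewrite /C lerD2r (bigD1 j)//= lerDl sumr_ge0// => i _; rewrite mulr_ge0// ltW.
  have C0 : 0 <= C by rewrite addr_ge0// sumr_ge0// => j _; rewrite mulr_ge0// ltW.
  have [kap [Mq [kap0 Mq0 nz]]] := noise_small (ltr01 : (0 : R) < 1) C0 e0.
  have [H HP] : exists H : R, forall r w p, (0 < r)%N -> quiet 1 kap Mq C r w -> `|netput t (m := m) r w p| <= H.
    eexists => r w p r0 qw; exact: (quiet_bound t0 m0 ltr01 kap0 Mq0 CP p r0 qw).
  have lim0 : Ex P (fun w => outside n%:R (netput_lim t (m := m) w)) @[n --> \oo] --> (0 : R).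
    rewrite -[X in _ --> X](Ex_cst P 0); apply: (@Ex_cvg _ _ _ P _ (fun=> 0) 1) => //.
    + by move=> n; exact: measurable_outside.
    + by move=> n w; rewrite /outside ger0_norm// lern1 leq_b1.
    move=> w; apply: cvg_near_cst; near=> n; rewrite /outside (_ : [forall i, _] = true)//.
    apply/forallP => p; apply: (@le_trans _ _ (\sum_p `|netput_lim t (m := m) w p|)).
      by rewrite (bigD1 p)//= lerDl sumr_ge0.
    by near: n; exact: nbhs_infty_ger.
  have /cvgrPdist_le/(_ _ e0)[n _ /(_ n (leqnn n))/=] := lim0.
  rewrite sub0r normrN => /(le_trans (ler_norm _)) Zn.
  have mono (B B' : R) (y : heavy * 'I_m.+1 -> R) : B <= B' -> outside B' y <= outside B y.
    move=> BB; rewrite /outside ler_nat; case: (boolP [forall i, `|y i| <= B]) => [/forallP h1|_]; last exact: leq_b1.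
    by rewrite (_ : [forall i, `|y i| <= B'] = true)//; apply/forallP => i; exact: le_trans (h1 i) BB.
  have io B (Y : Om -> heavy * 'I_m.+1 -> R) : coord_measurable Y -> integr P (fun w => outside B (Y w)).
    move=> mY; apply: (@integr_bd _ _ _ P _ 1) => [|w]; first exact: measurable_outside.
    by rewrite /outside ger0_norm// lern1 leq_b1.
  exists (1 + n%:R + `|H|); split.
  + by rewrite -addrA ltr_pwDl// addr_ge0.
  + apply: le_trans Zn; apply: Ex_le => [||w]; [exact: io|exact: io|apply: mono].
    by rewrite addrAC lerDr addr_ge0.
  + near=> r; have r0 : (0 < r)%N by near: r; exact: nbhs_infty_gt.
    apply: (@le_trans _ _ (Ex P (noise 1 kap Mq C r))); last by near: r.
    apply: Ex_le => [||w].
    * by apply: io; exact: measurable_netput.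
    * apply: (@integr_bd _ _ _ P _ (1 + #|{: 'I_nJ + 'I_nJ}|%:R)) => [|w]; first exact: measurable_noise.
      by have /andP[? ?] := noise_bounds 1 kap Mq C r w; rewrite ger0_norm.
    * apply: le_trans (noise_quiet 1 kap Mq C r w); rewrite /outside ler_nat.
      have [qw|_] := boolP (quiet _ _ _ _ _ _); last exact: leq_b1.
      rewrite (_ : [forall i, _] = true)//; apply/forallP => p; apply: (le_trans (HP r w p r0 qw)).
      by apply: (le_trans (ler_norm _)); rewrite lerDr addr_ge0.
- by move=> y; exact: capped_value_bounds.
Unshelve. all: by end_near.
Qed.

Lemma regular_set : exists A : nat -> set Om, forall r, [/\ measurable (A r), (0 < r)%N -> P (~` A r) = 0 &
  forall w, A r w -> (0 < r)%N /\ regular r w].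
Proof.
suff /choice[A AP] : forall r, exists A : set Om, [/\ measurable A, (0 < r)%N -> P (~` A) = 0 &
  forall w, A w -> (0 < r)%N /\ regular r w] by exists A.
(* There is no system of index 0: it gets the empty set, and the null-complement claim is guarded by
   [0 < r]. *)
move=> [|r]; first by exists set0; split.
have vp : {ae P, forall w, forall j n, 0 < v j n w}.
  by apply: filter_forall => j; apply/ae_foralln => n; exact: v_gt0.
have up : {ae P, forall w, forall j n, 0 < ubar j n w}.
  by apply: filter_forall => j; apply/ae_foralln => n; exact: ubar_gt0.
have [_ adm] := T_adm (ltn0Sn r).
have [A [mA A0 AR]] : exists A : set Om, [/\ measurable A, P (~` A) = 0 & forall w, A w -> regular r.+1 w].
  by apply: ae_set; apply: filterS3 adm vp up => w a1 a2 a3; split.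
by exists A; split => // w /AR.
Qed.

Lemma limit_set : exists B : set Om, [/\ measurable B, P (~` B) = 0 &
  forall w, B w -> forall k, {within `[0, +oo[, continuous (fun t => X t w k)}].
Proof. exact: ae_set (bm_continuous bX). Qed.

(** * Everywhere-defined versions of the costs, and passage to the limit *)

Section Patched.
Variables (A : nat -> set Om) (B : set Om).
Hypothesis AP : forall r, [/\ measurable (A r), (0 < r)%N -> P (~` A r) = 0 &
  forall w, A r w -> (0 < r)%N /\ regular r w].
Hypothesis BP : [/\ measurable B, P (~` B) = 0 &
  forall w, B w -> forall k, {within `[0, +oo[, continuous (fun t => X t w k)}].

(** Versions of the scaled queue and of the limiting value that vanish off the good events. They are
    nonnegative and right-continuous at every outcome, as the Tonelli argument demands, and equal to
    the originals almost surely. *)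
Let y (r : nat) (j : 'I_nJ) (t : R) (w : Om) : R := \1_(A r) w * qhat r j t w.
Let z (t : R) (w : Om) : R := \1_B w * lp (fun k => reflection (fun s => X s w k) t).

Let indic_cases (D : set Om) w : (D w /\ \1_D w = 1 :> R) \/ (~ D w /\ \1_D w = 0 :> R).
Proof.
have [Dw|nD] := pselect (D w); [left|right]; split => //; rewrite indicE; first by rewrite mem_set.
by rewrite memNset.
Qed.

Let y_ge0 r j t w : 0 <= t -> 0 <= y r j t w.
Proof.
move=> t0; have [_ _ AR] := AP r.
have [[/AR[r0 [adm _ _]] e]|[_ e]] := indic_cases (A r) w; rewrite /y e ?mul0r// mul1r.
rewrite mulr_ge0 ?invr_ge0//; apply: (adm_queue adm).
by rewrite mulr_ge0 ?exprn_ge0.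
Qed.

Let measurable_y r j t : 0 <= t -> measurable_fun setT (y r j t).
Proof.
move=> t0; have [mA _ AR] := AP r; case: r => [|r] in mA AR *.
  rewrite (_ : y 0 j t = fun=> 0)//; apply/funext => w; rewrite /y.
  by have [[/AR[]]|[_ ->]] := indic_cases (A 0%N) w; rewrite ?mul0r.
have rt0 : 0 <= r.+1%:R ^+ 2 * t by rewrite mulr_ge0 ?exprn_ge0.
have [mT _] := T_adm (ltn0Sn r).
rewrite (_ : y r.+1 j t = fun w => r.+1%:R^-1 * (\1_(A r.+1) w * (Q0 r.+1 j w)%:R +
  \1_(A r.+1) w * (renewal_count (interarrival (lamr r.+1) (fun j n => ubar j n) w j) (r.+1%:R ^+ 2 * t))%:R -
  \1_(A r.+1) w * (renewal_count (fun n => v j n w) (T r.+1 j (r.+1%:R ^+ 2 * t) w))%:R)); last first.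
  by apply/funext => w; rewrite /y /qhat /scaled_queue /queue; ring.
apply: measurable_funM => //; apply: measurable_funB; first apply: measurable_funD.
- by apply: measurable_funM; [exact: measurable_indic|exact: measurableT_comp].
- apply: (@measurable_renewal _ _ _ (A r.+1) (fun n w => ubar j n w / lamr r.+1 j) (fun=> r.+1%:R ^+ 2 * t)) => //.
    by move=> n; exact: measurable_funM.
  by move=> w /AR[_ [_ _ up]] n; rewrite divr_gt0// lamr_gt0.
- apply: (@measurable_renewal _ _ _ (A r.+1) (fun n w => v j n w) (fun w => T r.+1 j (r.+1%:R ^+ 2 * t) w)) => //.
    exact: mT.
  by move=> w /AR[_ [_ vp _]] n; exact: vp.
Qed.

Let right_cont_y r j w : right_cont (fun t => y r j t w).
Proof.
move=> t e t0 e0; have [_ _ AR] := AP r.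
have [[/AR[r0 [adm vp up]] e1]|[_ e1]] := indic_cases (A r) w; last first.
  by exists 1 => // u _; rewrite /y e1 !mul0r subrr normr0 ltW.
have rr0 : 0 < (r%:R : R) ^+ 2 by rewrite exprn_gt0// ltr0n.
have uc : forall n, 0 < interarrival (lamr r) (fun j n => ubar j n) w j n by move=> n; rewrite divr_gt0// lamr_gt0.
have [cT hT _] := adm_busy adm j.
have [d1 d10 h1] := right_const_renewal uc rr0 t0.
have [d2 d20 h2] := right_const_service (vp j) rr0 cT hT (fun s s0 => adm_hol adm j s0) t0.
exists (Num.min d1 d2); first by rewrite lt_min d10.
move=> u /andP[tu]; rewrite -ltrBlDl lt_min => /andP[u1 u2].
have {}h1 := h1 u; have {}h2 := h2 u; rewrite tu/= -!ltrBlDl in h1 h2.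
by rewrite /y /qhat /scaled_queue /queue h1// h2// subrr normr0 ltW.
Qed.

Let z_ge0 t w : 0 <= z t w.
Proof. by have [[_ e]|[_ e]] := indic_cases B w; rewrite /z e ?mul0r// mul1r lp_real_ge0. Qed.

Let lp_cvg (I : Type) (F : set_system I) (FF : Filter F) (f : I -> heavy -> R) (g : heavy -> R) :
  (forall k, f i k @[i --> F] --> g k) -> lp (f i) @[i --> F] --> lp g.
Proof.
move=> fg; have [CL CL0 lpL] := lp_real_lipschitz theta net hier h_gt0 mu_gt0.
have S0 : CL * \sum_k `|f i k - g k| @[i --> F] --> CL * \sum_(k : heavy) (0 : R).
  apply: cvgM; first exact: cvg_cst.
  apply: cvg_big => [|k _]; first exact: add_continuous.
  rewrite -(@normr0 R R) -(subrr (g k)); apply: cvg_norm; apply: cvgB; [exact: fg|exact: cvg_cst].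
rewrite big1// mulr0 in S0.
apply/cvgrPdist_le => e e0; have /cvgrPdist_le/(_ _ e0) := S0; apply: filterS => i.
rewrite sub0r normrN => /(le_trans (ler_norm _)) h1.
have h2 := lpL (f i) g; have h3 := lpL g (f i).
have e3 : \sum_i0 `|g i0 - f i i0| = \sum_k `|f i k - g k| by apply: eq_bigr => k _; rewrite distrC.
rewrite e3 in h3; rewrite ler_norml /lp; apply/andP; split; lra.
Qed.

Let zM_cvg (t M : R) w : 0 < t -> 0 <= M ->
  \1_B w * capped_value M (netput_lim t (m := m.+1) w) @[m --> \oo] --> Num.min (z t w) M.
Proof.
move=> t0 M0; have [_ _ Bc] := BP.
have [[/Bc Bw e]|[_ e]] := indic_cases B w; rewrite /z e; last first.
  by rewrite mul0r min_l//; under eq_fun do rewrite mul0r; exact: cvg_cst.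
rewrite mul1r; under eq_fun do rewrite mul1r.
have h1 : lp (fun k => grid_reflection (fun l : 'I_m.+2 => X (t * l%:R / m.+1%:R) w k)) @[m --> \oo] -->
    lp (fun k => reflection (fun s => X s w k) t).
  apply: lp_cvg => k; exact: grid_reflection_cvg (Bw k).
apply/cvgrPdist_le => c c0; have /cvgrPdist_le/(_ _ c0) := h1; apply: filterS => n.
rewrite /capped_value /netput_lim/=.
move: (lp (fun k => reflection _ t)) (lp (fun k => grid_reflection _)) => a b; rewrite !ler_norml => /andP[? ?].
by rewrite !minElt; case: (ltP a M) => ?; case: (ltP b M) => ?; apply/andP; split; lra.
Qed.

Let measurable_capped_lim (t M : R) m : 0 < t -> 0 <= M ->
  measurable_fun setT (fun w => capped_value M (netput_lim t (m := m.+1) w)).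
Proof.
move=> t0 M0; have [L L0 FL] := capped_value_lipschitz.
apply: (@measurable_lipschitz _ _ _ _ (fun y => capped_value M y) M L (netput_lim t (m := m.+1))) => //.
- exact: measurable_netput_lim.
- by move=> q; exact: capped_value_bounds.
Qed.

Let measurable_zM (t M : R) : 0 < t -> 0 <= M -> measurable_fun setT (fun w => Num.min (z t w) M).
Proof.
move=> t0 M0; have [mB _ _] := BP.
apply: (@measurable_fun_cvg _ _ _ _ (fun m w => \1_B w * capped_value M (netput_lim t (m := m.+1) w))).
  move=> m; apply: measurable_funM; first exact: measurable_indic.
  exact: measurable_capped_lim.
by move=> w _; exact: zM_cvg.
Qed.

Let right_cont_z w : right_cont (fun t => z t w).
Proof.
move=> t e t0 e0; have [_ _ Bc] := BP.
have [[/Bc Bw e1]|[_ e1]] := indic_cases B w; last first.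
  by exists 1 => // u _; rewrite /z e1 !mul0r subrr normr0 ltW.
have [CL CL0 lpL] := lp_real_lipschitz theta net hier h_gt0 mu_gt0.
pose c := e / (CL * (#|heavy|%:R * 3) + 1).
have K0 : 0 < CL * (#|heavy|%:R * 3) + 1 by rewrite ltr_wpDl// !mulr_ge0.
have c0 : 0 < c by rewrite divr_gt0.
have /choice[del delP] : forall k, exists del : R, 0 < del /\
    forall u, t <= u < t + del -> `|reflection (fun s => X s w k) u - reflection (fun s => X s w k) t| <= 3 * c.
  move=> k; have [del del0 hd] := within_continuousP (Bw k) t0 c0.
  exists del; split => // u /andP[tu ud]; have u0 : 0 <= u by exact: le_trans tu.
  have near_t s : t <= s <= u -> `|X t w k - X s w k| < c.
    move=> /andP[ts su]; apply: hd; first exact: le_trans ts.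
    by rewrite ler0_norm ?subr_le0// opprB; lra.
  have [a [/andP[a0 at_] am ->]] := reflection_argmax t0 (Bw k).
  have [b [/andP[b0 bu] bm ->]] := reflection_argmax u0 (Bw k).
  have h1 : - X a w k <= - X b w k by apply: bm; rewrite a0 (le_trans at_).
  have h2 : - X b w k <= - X a w k + c.
    have [bt|tb] := leP b t; first by have := am b; rewrite b0 bt => /(_ isT); lra.
    have := near_t b; rewrite (ltW tb) bu => /(_ isT); rewrite ltr_norml => /andP[? ?].
    have := am t; rewrite t0 lexx => /(_ isT); lra.
  have := near_t u; rewrite tu lexx => /(_ isT); rewrite ltr_norml => /andP[? ?].
  rewrite ler_norml !maxElt; case: (ltP (- X a w k) 0) => ?; case: (ltP (- X b w k) 0) => ?; apply/andP; split; lra.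
exists (1 + \sum_k (del k)^-1)^-1.
  by rewrite invr_gt0 ltr_wpDr// sumr_ge0// => k _; rewrite invr_ge0 ltW//; case: (delP k).
have dk k : (1 + \sum_k (del k)^-1)^-1 <= del k.
  have d0 i : 0 < del i by case: (delP i).
  rewrite -[leRHS]invrK lef_pV2 ?posrE ?invr_gt0//; last by rewrite ltr_wpDr// sumr_ge0// => i _; rewrite invr_ge0 ltW.
  by rewrite (bigD1 k)//= addrCA lerDl addr_ge0// sumr_ge0// => i _; rewrite invr_ge0 ltW.
move=> u /andP[tu ud].
have hk k : `|reflection (fun s => X s w k) u - reflection (fun s => X s w k) t| <= 3 * c.
  by have [_ hd] := delP k; apply: hd; rewrite tu (lt_le_trans ud)// lerD2l.
have S3 : CL * \sum_k `|reflection (fun s => X s w k) u - reflection (fun s => X s w k) t| <= e.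
  apply: (@le_trans _ _ (CL * \sum_(k : heavy) (3 * c))); first by rewrite ler_wpM2l// ler_sum.
  rewrite sumr_const -[_ *+ #|_|]mulr_natl.
  have ce : (CL * (#|heavy|%:R * 3) + 1) * c = e by rewrite /c mulrC divfK// gt_eqF.
  have -> : CL * (#|heavy|%:R * (3 * c)) = CL * (#|heavy|%:R * 3) * c by ring.
  by rewrite -[leRHS]ce ler_wpM2r ?(ltW c0)// lerDl.
have l1 := lpL (fun k => reflection (fun s => X s w k) u) (fun k => reflection (fun s => X s w k) t).
have l2 := lpL (fun k => reflection (fun s => X s w k) t) (fun k => reflection (fun s => X s w k) u).
have S4 : \sum_i `|reflection (fun s => X s w i) t - reflection (fun s => X s w i) u| =
  \sum_k `|reflection (fun s => X s w k) u - reflection (fun s => X s w k) t|.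
  by apply: eq_bigr => k _; rewrite distrC.
rewrite S4 in l2; rewrite /z e1 !mul1r ler_norml /lp; apply/andP; split; lra.
Qed.

Let measurable_z_pos t : 0 < t -> measurable_fun setT (z t).
Proof.
move=> t0; apply: (@measurable_fun_cvg _ _ _ _ (fun n w => Num.min (z t w) n%:R)).
  by move=> n; exact: measurable_zM.
move=> w _; apply: cvg_near_cst; near=> n; apply/min_idPl.
by near: n; exact: nbhs_infty_ger.
Unshelve. all: by end_near.
Qed.

Let measurable_z t : 0 <= t -> measurable_fun setT (z t).
Proof.
(* Grids of [[0, t]] need [t > 0]; the time 0 is reached as a limit from the right. *)
rewrite le_eqVlt => /predU1P[<-|]; last exact: measurable_z_pos.
apply: (@measurable_fun_cvg _ _ _ _ (fun n => z n.+1%:R^-1)).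
  by move=> n; apply: measurable_z_pos; rewrite invr_gt0.
move=> w _; apply/cvgrPdist_le => e e0; have [del del0 hd] := right_cont_z w (lexx 0) e0.
near=> n; rewrite distrC; apply: hd; rewrite invr_ge0 ler0n add0r/=.
by near: n; exact: (near_infty_natSinv_lt (PosNum del0)).
Unshelve. all: by end_near.
Qed.

Let ExE (f : Om -> R) : integr P f -> (\int[P]_w (f w)%:E = (Ex P f)%:E)%E.
Proof. by move=> i1; rewrite /Ex /Rintegral fineK//; exact: (integrable_fin_num measurableT i1). Qed.

(** Budget: [e / 4] for refining the grid, [e / 4] for the convergence in [r], and [e / 2] for [G],
    half of it from the Lipschitz error [K eta] and half from the noisy event. The mesh conditions
    involve [kap] and [eta], so [m] is chosen after them and [r] after all. *)
Lemma fixed_time (t M e : R) : 0 < t -> 0 <= M -> 0 < e -> \forall r \near \oo,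
  ((Ex P (fun w => Num.min (z t w) M) - e)%:E <= \sum_j (h j)%:E * \int[P]_w (y r j t w)%:E)%E.
Proof.
move=> t0 M0 e0; have [CL CL0 lpL] := lp_real_lipschitz theta net hier h_gt0 mu_gt0.
have C10 : 0 <= C1 by rewrite addr_ge0// sumr_ge0// => l _; rewrite addr_ge0// divr_ge0// ltW.
pose K := CL * (#|heavy|%:R * (5 * C1)).
have K0 : 0 <= K by rewrite !mulr_ge0.
pose eta := e / 4 / (K + 1).
have eta0 : 0 < eta by rewrite !divr_gt0// ltr_wpDl.
have Keta : K * eta <= e / 4.
  have E : (K + 1) * eta = e / 4 by rewrite /eta mulrC divfK// gt_eqF// ltr_wpDl.
  by rewrite -E ler_wpM2r ?(ltW eta0)// lerDl.
pose e' := e / 4 / (M + 1).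
have e'0 : 0 < e' by rewrite !divr_gt0// ltr_wpDl.
have Me : M * e' <= e / 4.
  have E : (M + 1) * e' = e / 4 by rewrite /e' mulrC divfK// gt_eqF// ltr_wpDl.
  by rewrite -E ler_wpM2r ?(ltW e'0)// lerDl.
pose C := \sum_j lam j * t + 1.
have CP j : lam j * t + 1 <= C.
  rewrite /C lerD2r (bigD1 j)//= lerDl; apply: sumr_ge0 => i _.
  exact: mulr_ge0 (ltW (lam_gt0 i)) (ltW t0).
have C0 : 0 <= C.
  by apply: addr_ge0 => //; apply: sumr_ge0 => j _; exact: mulr_ge0 (ltW (lam_gt0 j)) (ltW t0).
have [kap [Mq [kap0 Mq0 nz]]] := noise_small eta0 C0 e'0.
have [mB B0 _] := BP.
have e4 : 0 < e / 4 by rewrite divr_gt0.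
have Bae : {ae P, forall w, \1_B w = 1 :> R}.
  by apply: filterS (ae_of_set mB B0) => w Bw; rewrite indicE mem_set.
have bnd m (q : heavy * 'I_m.+1 -> R) : `|capped_value M q| <= M.
  by have /andP[q0 q1] := capped_value_bounds q M0; rewrite ger0_norm.
have lim1 : Ex P (fun w => \1_B w * capped_value M (netput_lim t (m := m.+1) w)) @[m --> \oo] -->
    Ex P (fun w => Num.min (z t w) M).
  apply: (@Ex_cvg _ _ _ P _ _ M) => [m||m w|w].
  - by apply: measurable_funM; [exact: measurable_indic|exact: measurable_capped_lim].
  - exact: measurable_zM.
  - rewrite normrM; have [[_ ->]|[_ ->]] := indic_cases B w; rewrite ?normr1 ?normr0 ?mul1r ?mul0r//.
  - exact: zM_cvg.
have small (c b : R) : 0 <= c -> 0 < b -> \forall m \near \oo, c / m.+1%:R <= b.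
  move=> c0 b0; have bc : 0 < b / (c + 1) by rewrite divr_gt0// ltr_wpDl.
  near=> m; apply: (@le_trans _ _ ((c + 1) * (b / (c + 1)))); last by rewrite mulrC divfK// gt_eqF// ltr_wpDl.
  rewrite ler_pM ?invr_ge0 ?lerDl//; apply: ltW; near: m; exact: (near_infty_natSinv_lt (PosNum bc)).
have near1 : \forall m \near \oo, forall j, lam j * t / m.+1%:R <= kap / 4.
  by apply: filter_forall => j; apply: small; [exact: mulr_ge0 (ltW (lam_gt0 j)) (ltW t0)|exact: divr_gt0].
have near2 : \forall m \near \oo, forall i : heavy, `|th i| * t / m.+1%:R <= eta / 2.
  by apply: filter_forall => i; apply: small; [exact: mulr_ge0 (normr_ge0 _) (ltW t0)|exact: divr_gt0].
have /cvgrPdist_le/(_ _ e4) near3 := lim1.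
have [m [m1 m2 m3]] : exists m : nat, [/\ forall j, lam j * t / m.+1%:R <= kap / 4,
    forall i : heavy, `|th i| * t / m.+1%:R <= eta / 2 &
    `|Ex P (fun w => Num.min (z t w) M) - Ex P (fun w => \1_B w * capped_value M (netput_lim t (m := m.+1) w))| <= e / 4].
  near \oo => m; exists m; split; [by near: m|by near: m|by near: m].
have E1 : Ex P (fun w => \1_B w * capped_value M (netput_lim t (m := m.+1) w)) =
    Ex P (fun w => capped_value M (netput_lim t (m := m.+1) w)).
  have mcl := @measurable_capped_lim t M m t0 M0.
  apply: Ex_ae => //; first by apply: measurable_funM => //; exact: measurable_indic.
  by apply: filterS Bae => w ->; rewrite mul1r.
rewrite {}E1 in m3.
have /cvgrPdist_le/(_ _ e4) near4 := capped_netput_cvg t0 (ltn0Sn m) M0.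
have near5 := cost_near t0 (ltn0Sn m) eta0 kap0 Mq0 CP m1 m2 CL0 lpL.
near=> r.
have r0 : (0 < r)%N by near: r; exact: nbhs_infty_gt.
have [mA A0 AR] := AP r.
have n4 : `|Ex P (fun w => capped_value M (netput_lim t (m := m.+1) w)) -
  Ex P (fun w => capped_value M (netput t (m := m.+1) r w))| <= e / 4 by near: r.
have n5 : forall w (M : R), 0 <= M -> regular r w -> capped_value M (netput t (m := m.+1) r w) <=
    \sum_j h j * qhat r j t w + (K * eta + M * (~~ quiet eta kap Mq C r w)%:R) by near: r.
have nn : Ex P (noise eta kap Mq C r) <= e' by near: r.
have [L L0 FL] := capped_value_lipschitz.
have mc : measurable_fun setT (fun w => capped_value M (netput t (m := m.+1) r w)).
  apply: (@measurable_lipschitz _ _ _ _ (fun y => capped_value M y) M L (netput t (m := m.+1) r)) => //.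
  - exact: measurable_netput.
  - by move=> q; exact: capped_value_bounds.
pose F w := \1_(A r) w * capped_value M (netput t (m := m.+1) r w).
have mF : measurable_fun setT F by apply: measurable_funM => //; exact: measurable_indic.
have E2 : Ex P (fun w => capped_value M (netput t (m := m.+1) r w)) = Ex P F.
  apply: Ex_ae => //; apply: filterS (ae_of_set mA (A0 r0)) => w Aw.
  by rewrite /F indicE mem_set// mul1r.
have iF : integr P F.
  apply: (@integr_bd _ _ _ P _ M) => // w; rewrite /F normrM.
  by have [[_ ->]|[_ ->]] := indic_cases (A r) w; rewrite ?normr1 ?normr0 ?mul1r ?mul0r.
pose G w := K * eta + M * noise eta kap Mq C r w.
have nz0 w : 0 <= noise eta kap Mq C r w by have /andP[] := noise_bounds eta kap Mq C r w.
have inz : integr P (noise eta kap Mq C r).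
  apply: (@integr_bd _ _ _ P _ (1 + #|{: 'I_nJ + 'I_nJ}|%:R)) => [|w]; first exact: measurable_noise.
  by have /andP[? ?] := noise_bounds eta kap Mq C r w; rewrite ger0_norm.
have iG : integr P G by apply: integrD; [exact: integr_cst|exact: integrZ].
have G0 w : 0 <= G w by rewrite addr_ge0// mulr_ge0// ltW.
have EG : Ex P G <= e / 2.
  rewrite /G ExD ?Ex_cst ?ExZ//; [|exact: integr_cst|exact: integrZ].
  have := ler_wpM2l M0 nn; lra.
have FG w : F w <= \sum_j h j * y r j t w + G w.
  rewrite /F /y; have [[Aw e1]|[_ e1]] := indic_cases (A r) w; rewrite e1.
    rewrite mul1r; under eq_bigr do rewrite mul1r.
    have [_ rw] := AR _ Aw; apply: (le_trans (n5 w M M0 rw)); rewrite lerD2l /G lerD2l ler_wpM2l//.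
    exact: noise_quiet.
  by rewrite mul0r addr_ge0// sumr_ge0// => j _; rewrite mul0r mulr0.
have my j : measurable_fun setT (fun w => (y r j t w)%:E) by apply/measurable_EFinP; apply: measurable_y; exact: ltW.
have y0 j w : (0 <= (y r j t w)%:E)%E by rewrite lee_fin y_ge0// ltW.
(* Stated in [\bar R], as expected queue lengths may be infinite; the finite [Ex P G] is moved to
   the other side afterwards. *)
have main : ((Ex P F)%:E <= \sum_j (h j)%:E * \int[P]_w (y r j t w)%:E + (Ex P G)%:E)%E.
  rewrite -(ExE iF) -(ExE iG).
  under eq_bigr => j _ do rewrite -ge0_integralZl_EFin ?ltW//.
  rewrite -ge0_integral_sum//; last 2 first.
  - by move=> j; apply: emeasurable_funM.
  - by move=> j w _; rewrite mule_ge0// lee_fin ltW.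
  rewrite -ge0_integralD//; last 4 first.
  - by move=> w _; apply: sume_ge0 => j _; rewrite mule_ge0// lee_fin ltW.
  - by apply: emeasurable_sum => j; apply: emeasurable_funM.
  - by move=> w _; rewrite lee_fin.
  - by apply/measurable_EFinP; exact: integr_measurable iG.
  apply: ge0_le_integral => //.
  - move=> w _; rewrite lee_fin /F; have [[_ ->]|[_ ->]] := indic_cases (A r) w; rewrite ?mul0r ?mul1r//.
    by have /andP[] := capped_value_bounds (netput t (m := m.+1) r w) M0.
  - exact/measurable_EFinP.
  - apply: emeasurable_funD; first by apply: emeasurable_sum => j; apply: emeasurable_funM.
    by apply/measurable_EFinP; exact: integr_measurable iG.
  - move=> w _; under eq_bigr do rewrite -EFinM.
    by rewrite sumEFin -EFinD lee_fin.
apply: (@le_trans _ _ ((Ex P F)%:E - (Ex P G)%:E)%E); last by rewrite leeBlDr.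
rewrite -EFinB lee_fin; move: m3 n4; rewrite E2 !ler_norml => /andP[? ?] /andP[? ?]; lra.
Unshelve. all: by end_near.
Qed.

(** Fatou in time leaves the lower limit of the costs at each [t], and [fixed_time] places it above
    the capped limiting value for every cap; a second use of Fatou removes the cap. *)
Lemma discounted_bound (W : R -> Om -> heavy -> R) :
  {ae P, forall w, forall k t, 0 <= t -> W t w k = reflection (fun s => X s w k) t} ->
  (discounted P delta (fun t w => lp_value res h mu (W t w)) <=
   limn_einf (fun r => \sum_(j < nJ) (h j)%:E * discounted P delta (fun t w => (qhat r j t w)%:E)))%E.
Proof.
move=> WX; have [mB B0 Bc] := BP.
rewrite (_ : discounted _ _ _ = \int[lebesgue_measure]_t \int[P]_w (disc_fun z delta t w)%:E)%E; last first.
  apply: discounted_swap => //.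
  apply: filterS2 (ae_of_set mB B0) WX => w Bw Ww t t0.
  rewrite /z indicE mem_set// mul1r -(lp_realE net hier h_gt0 mu_gt0); last by move=> i; exact: reflection_ge0 (Bc w Bw i).
  by congr lp_value; apply/funext => k; exact: Ww.
pose G r t := (\sum_j (h j)%:E * \int[P]_w (disc_fun (y r j) delta t w)%:E)%E.
have d0 r j t w : 0 <= disc_fun (y r j) delta t w by apply: disc_fun_ge0 => s w' s0; exact: y_ge0.
have mI r j : measurable_fun setT (fun t => \int[P]_w (disc_fun (y r j) delta t w)%:E)%E.
  apply: measurable_disc; [exact: measurable_y|exact: right_cont_y|by move=> s w s0; exact: y_ge0].
have mhI r j : measurable_fun setT (fun t => (h j)%:E * \int[P]_w (disc_fun (y r j) delta t w)%:E)%E.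
  exact: emeasurable_funM.
have mG r : measurable_fun setT (G r) by apply: emeasurable_sum.
have I0 r j t : (0 <= \int[P]_w (disc_fun (y r j) delta t w)%:E)%E by apply: integral_ge0 => w _; rewrite lee_fin.
have hI0 r j t : (0 <= (h j)%:E * \int[P]_w (disc_fun (y r j) delta t w)%:E)%E by rewrite mule_ge0// lee_fin ltW.
have G0 r t : (0 <= G r t)%E by apply: sume_ge0.
have GE r : (0 < r)%N -> (\sum_(j < nJ) (h j)%:E * discounted P delta (fun t w => (qhat r j t w)%:E) =
    \int[lebesgue_measure]_t G r t)%E.
  move=> r0; have [mA A0 _] := AP r.
  rewrite /G ge0_integral_sum//; try exact: mhI; try by move=> j t _; exact: hI0.
  apply: eq_bigr => j _.
  rewrite ge0_integralZl_EFin//; try exact: mI; try (by move=> t _; exact: I0); try exact: ltW.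
  congr (_ * _)%E; apply: (@discounted_swap _ _ _ P (y r j)) => //.
  - by move=> t; exact: measurable_y.
  - by move=> t w; exact: y_ge0.
  - apply: filterS (ae_of_set mA (A0 r0)) => w Aw t t0.
    by rewrite /y indicE mem_set// mul1r.
apply: (@le_trans _ _ (limn_einf (fun r => \int[lebesgue_measure]_t G r t)%E)); last first.
  apply: limn_einf_near_le; exists 1%N => // r /= r0.
  by rewrite GE.
have Fat := @fatou _ _ R (@lebesgue_measure R) setT measurableT G mG (fun r t _ => G0 r t).
apply: (@le_trans _ _ (\int[lebesgue_measure]_t limn_einf (G ^~ t))%E); last exact: Fat.
have zd0 t w : 0 <= disc_fun z delta t w by apply: disc_fun_ge0 => s w' _; exact: z_ge0.
apply: ae_ge0_le_integral => //.
- by move=> t _; apply: integral_ge0 => w _; rewrite lee_fin.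
- by apply: measurable_disc; [exact: measurable_z|exact: right_cont_z|move=> s w _; exact: z_ge0].
- by move=> t _; apply: limn_einf_near_ge; exact: nearW.
(* The lower limit is the opposite of the upper limit of the opposites, and measurability is taken
   from the latter. *)
- have mN (f : measurableTypeR R -> \bar R) : measurable_fun setT f -> measurable_fun setT (fun t => - f t)%E.
    move=> mf; rewrite (_ : (fun t => - f t)%E = (fun t => 0 - f t)%E); first exact: emeasurable_funB.
    by apply/funext => t; rewrite sub0e.
  apply: (mN (fun t => limn_esup (fun r => - G r t)%E)).
  by apply: (@measurable_fun_limn_esup _ _ _ setT (fun r t => - G r t)%E) => r; apply: mN; exact: mG.
(* [fixed_time] requires [t > 0], so the time 0 forms the exceptional null set; negative times
   contribute zero. *)
exists [set 0]; split => [||t]; [exact: measurable_set1|exact: lebesgue_measure_set1|].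
apply: contra_notP => /= t0 _.
have [tneg|tpos] := ltP t 0.
  rewrite integral0_eq; first by apply: limn_einf_near_ge; exact: nearW.
  by move=> w _; rewrite /disc_fun leNgt tneg.
have tp : 0 < t by rewrite lt_neqAle tpos andbT eq_sym; apply/eqP.
pose E := expR (- delta * t).
have E0 : 0 <= E by exact: expR_ge0.
have E1 : E <= 1 by rewrite /E -[leRHS]expR0 ler_expR mulNr oppr_le0 mulr_ge0// ltW.
set L := limn_einf _.
(* The discount factor is at most 1, so it does not enlarge the error [e], which is sent to 0 with
   the cap [n] fixed. *)
have bound (n : nat) : (\int[P]_w (E * Num.min (z t w) n%:R)%:E <= L)%E.
  have im : integr P (fun w => Num.min (z t w) n%:R).
    apply: (@integr_bd _ _ _ P _ n%:R) => [|w]; first exact: measurable_zM.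
    by rewrite ger0_norm ?ge_min ?lexx ?orbT// le_min z_ge0 ler0n.
  rewrite (ExE (integrZ E im)) ExZ//; apply/lee_addgt0Pr => e e0.
  rewrite -leeBlDr// -EFinB; apply: limn_einf_near_ge.
  apply: filterS (fixed_time tp (ler0n R n) e0) => r h1.
  apply: (@le_trans _ _ (E%:E * (Ex P (fun w => Num.min (z t w) n%:R) - e)%:E)%E).
    by rewrite -EFinM lee_fin mulrBr lerD2l lerN2 ler_piMl// ltW.
  apply: (@le_trans _ _ (E%:E * \sum_j (h j)%:E * \int[P]_w (y r j t w)%:E)%E).
    by rewrite lee_wpmul2l// lee_fin.
  have y0 j w : (0 <= (y r j t w)%:E)%E by rewrite lee_fin y_ge0.
  rewrite ge0_sume_distrr; last by move=> j _; rewrite mule_ge0 ?lee_fin ?(ltW (h_gt0 j))//; exact: integral_ge0.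
  apply: lee_sum => j _; rewrite muleCA lee_wpmul2l ?lee_fin ?(ltW (h_gt0 j))//.
  rewrite -ge0_integralZl_EFin//; last by apply/measurable_EFinP; exact: measurable_y.
  rewrite le_eqVlt; apply/orP; left; apply/eqP; apply: eq_integral => w _.
  by rewrite /disc_fun tpos EFinM.
(* Fatou in the cap: at each outcome the capped value is eventually equal to the value itself. *)
have := @fatou _ _ R P setT measurableT (fun (n : nat) w => (E * Num.min (z t w) n%:R)%:E) _ _.
rewrite (_ : (fun w => limn_einf _) = (fun w => (disc_fun z delta t w)%:E)); last first.
  apply/funext => w.
  have cv : (fun n : nat => (E * Num.min (z t w) n%:R)%:E) @ \oo --> (disc_fun z delta t w)%:E.
    rewrite /disc_fun tpos; apply: cvg_near_cst; near=> n; congr (_ * _)%:E; apply/min_idPl.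
    by near: n; exact: nbhs_infty_ger.
  by have [-> _] := cvg_limn_einf_sup cv.
move=> h1; apply: (le_trans (h1 _ _)).
- by move=> n; apply/measurable_EFinP; apply: measurable_funM => //; exact: measurable_zM.
- by move=> n w _; rewrite lee_fin mulr_ge0// le_min z_ge0 ler0n.
apply: (@le_trans _ _ (limn_einf (fun _ : nat => L))); first by apply: limn_einf_near_le; exact: nearW.
by have [-> _] := @cvg_limn_einf_sup R (fun=> L) L (cvg_cst L).
Unshelve. all: by end_near.
Qed.

End Patched.

Lemma discounted_cost_bound (W : R -> Om -> heavy -> R) :
  {ae P, forall w, forall k t, 0 <= t -> W t w k = reflection (fun s => X s w k) t} ->
  (discounted P delta (fun t w => lp_value res h mu (W t w)) <=
   limn_einf (fun r => \sum_(j < nJ) (h j)%:E * discounted P delta (fun t w => (qhat r j t w)%:E)))%E.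
Proof.
have [A AP] := regular_set; have [B BP] := limit_set.
exact: (discounted_bound AP BP).
Qed.

End Main.

Unset Implicit Arguments.
Set Strict Implicit.
Set Printing Implicit Defensive.

Theorem theorem1 (R : realType) (d : measure_display) (Om : measurableType d)
  (P : probability Om R) (P_complete : measure_is_complete P)
  (* network *)
  (nI nJ : nat) (nI_gt0 : (0 < nI)%N) (nJ_gt0 : (0 < nJ)%N)
  (res : 'I_nJ -> {set 'I_nI})
  (net : network res) (hier : hierarchical res)
  (conn : connected_architecture res)
  (* stochastic primitives; v j n and ubar j n are the (n+1)-st variables *)
  (mu sigma beta : 'I_nJ -> R)
  (mu_gt0 : forall j, 0 < mu j) (sigma_ge0 : forall j, 0 <= sigma j)
  (v ubar : 'I_nJ -> nat -> {RV P >-> R})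
  (v_gt0 : forall j n, {ae P, forall w, 0 < v j n w})
  (v_iid : forall j, iid P (fun n => v j n : Om -> R))
  (v_mean : forall j, ('E_P[v j 0%N] = ((mu j)^-1)%:E)%E)
  (v_var : forall j, ('V_P[v j 0%N] = ((sigma j / mu j) ^+ 2)%:E)%E)
  (ubar_gt0 : forall j n, {ae P, forall w, 0 < ubar j n w})
  (ubar_iid : forall j, iid P (fun n => ubar j n : Om -> R))
  (ubar_mean : forall j, ('E_P[ubar j 0%N] = 1)%E)
  (ubar_var : forall j, ('V_P[ubar j 0%N] = (beta j ^+ 2)%:E)%E)
  (prim_indep : mutually_independent P (fun a : 'I_nJ + 'I_nJ =>
     sigma_of (primitive (fun j n => v j n) (fun j n => ubar j n) a) setT))
  (moments : exists2 abar : R, 0 < abar & forall a : R, - abar < a < abar ->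
     forall j, ('M_P (ubar j 0%N) a < +oo)%E /\ ('M_P (v j 0%N) a < +oo)%E)
  (* asymptotic regime; only the indices r > 0 are meaningful *)
  (lamr : nat -> 'I_nJ -> R) (lam : 'I_nJ -> R)
  (lamr_gt0 : forall r j, (0 < r)%N -> 0 < lamr r j)
  (lam_gt0 : forall j, 0 < lam j)
  (lamr_cvg : forall j, lamr r j @[r --> \oo] --> lam j)
  (theta : 'I_nI -> \bar R) (theta_ltoo : forall i, (theta i < +oo)%E)
  (traffic : forall i,
     (r%:R * (load res mu (lamr r) i - 1))%:E @[r --> \oo] --> theta i)
  (heavy_neq0 : heavy_set theta != finset.set0)
  (* initial state *)
  (Q0 : nat -> 'I_nJ -> {RV P >-> nat})
  (Q0_indep : forall r, (0 < r)%N -> independent P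
     (sigma_of (fun j => Q0 r j : Om -> nat) setT)
     (sigma_of (fun a : ('I_nJ + 'I_nJ) * nat =>
        primitive (fun j n => v j n) (fun j n => ubar j n) a.1 a.2) setT))
  (Q0_fluid : forall j, {ae P, forall w,
     (Q0 r j w)%:R / r%:R ^+ 2 @[r --> \oo] --> (0 : R)})
  (Q0t : 'I_nJ -> {RV P >-> R})
  (Q0t_ge0 : forall j, {ae P, forall w, 0 <= Q0t j w})
  (Q0t_eq0 : forall j, j \in light_jobs res theta :|: mixed_jobs res theta ->
     {ae P, forall w, Q0t j w = 0})
  (Q0_diffusion : cvg_in_law P
     (fun r w => \row_j ((Q0 r j w)%:R / r%:R)) (fun w => \row_j Q0t j w))
  (* limit process *)
  (W : R -> Om -> heavy theta -> R)
  (W_srbm : srbm P (fun i : heavy theta => fine (theta (val i)))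
     (fun i k : heavy theta =>
        \sum_(j in jobs_of res (val i) :&: jobs_of res (val k))
          lam j * (beta j ^+ 2 + sigma j ^+ 2) / mu j ^+ 2)
     (fun w (i : heavy theta) => \sum_(j in jobs_of res (val i)) Q0t j w / mu j)
     W)
  (* cost *)
  (h : 'I_nJ -> R) (delta : R)
  (h_gt0 : forall j, 0 < h j) (delta_gt0 : 0 < delta)
  (* sequence of policies *)
  (T : nat -> 'I_nJ -> R -> Om -> R)
  (T_adm : forall r, (0 < r)%N ->
     admissible P res (heavy_set theta) (lamr r)
       (fun j n => v j n) (fun j n => ubar j n) (fun j => Q0 r j) (T r)) :
  (discounted P delta (fun t w => lp_value res h mu (W t w)) <=
   limn_einf (fun r => \sum_(j < nJ) (h j)%:E *
     discounted P delta (fun t w => (scaled_queue r (lamr r)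
       (fun j n => v j n) (fun j n => ubar j n) (fun j => Q0 r j) (T r)
       j t w)%:E)))%E.
Proof.
case: W_srbm => X [bX X0 WX].
exact: (discounted_cost_bound P_complete net hier mu_gt0 v_gt0 v_iid v_mean v_var ubar_gt0 ubar_iid
  ubar_mean ubar_var prim_indep moments lamr_gt0 lam_gt0 lamr_cvg traffic Q0_indep Q0_diffusion bX X0
  h_gt0 delta_gt0 T_adm WX).
Qed.
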